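(* Let $d\in\mathbb{N}$ and let $0\le a<\frac{d+1}{2}$. Then $\mathrm{Mult}(\mathcal{D}_a(\mathbb{B}_d))$ is not topologically subhomogeneous.
   Context: $\mathbb{B}_d$ is the open Euclidean unit ball in $\mathbb{C}^d$. For $a\in(0,\infty)$, $\mathcal{D}_a(\mathbb{B}_d)$ is the reproducing kernel Hilbert space on $\mathbb{B}_d$ with kernel $\frac{1}{(1-\langle z,w\rangle)^a}$; $\mathcal{D}_0(\mathbb{B}_d)$ is the one with kernel $\frac{1}{\langle z,w\rangle}\log\big(\frac{1}{1-\langle z,w\rangle}\big)$ (equal to $1$ when $\langle z,w\rangle=0$). For a reproducing kernel Hilbert space $\mathcal{H}$, $\mathrm{Mult}(\mathcal{H})$ is the algebra of functions $\varphi$ with $\varphi\mathcal{H}\subset\mathcal{H}$, regarded as a unital operator algebra in $\mathcal{B}(\mathcal{H})$ via $\varphi\mapsto M_\varphi$, where $M_\varphi f=\varphi f$. A unital operator algebra $\mathcal{A}$ is topologically $n$-subhomogeneous if there exist constants $C_1,C_2>0$ such that for all $b\in\mathcal{A}$, $\|b\|\le C_1\sup\{\|\pi(b)\|\}$, where the supremum is over all unital homomorphisms $\pi:\mathcal{A}\to M_k$ with $\|\pi\|\le C_2$ and all $k\le n$. It is topologically subhomogeneous if it is topologically $n$-subhomogeneous for some $n\in\mathbb{N}$. *)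

(* Defs.v *)
From HB Require Import structures.
From mathcomp Require Import all_boot all_order all_algebra.
From mathcomp Require Import complex.
From mathcomp Require Import all_classical all_reals all_analysis.

Set Implicit Arguments.
Unset Strict Implicit.
Unset Printing Implicit Defensive.

Import Order.TTheory GRing.Theory Num.Theory.
Import numFieldNormedType.Exports.

Local Open Scope classical_set_scope.
Local Open Scope ring_scope.
Local Open Scope complex_scope.

HB.instance Definition _ (R : rcfType) := GRing.Algebra.copy R[i] R[i]^o.

Section fct_lalg.
Variables (X : pointedType) (K : pzRingType) (A : lalgType K).
Let fct_scalerAl (k : K) (f g : X -> A) : k *: (f * g) = (k *: f) * g.
Proof. by apply/funext => x; exact: scalerAl. Qed.
HB.instance Definition _ :=
  GRing.Lmodule_isLalgebra.Build K (X -> A) fct_scalerAl.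
End fct_lalg.

Section fct_alg.
Variables (X : pointedType) (K : pzRingType) (A : algType K).
Let fct_scalerAr (k : K) (f g : X -> A) : k *: (f * g) = f * (k *: g).
Proof. by apply/funext => x; exact: scalerAr. Qed.
HB.instance Definition _ :=
  GRing.Lalgebra_isAlgebra.Build K (X -> A) fct_scalerAr.
End fct_alg.

(* Norms take values in \bar R, so that a supremum over an unbounded set is
   +oo instead of a default value; the supremum over the empty set is -oo. *)
Definition opnorm (R : realType) (U V : Type)
    (normU : U -> \bar R) (normV : V -> \bar R) (T : U -> V) : \bar R :=
  ereal_sup [set normV (T u) | u in [set u | (normU u <= 1)%E]].

Definition cV_l2norm (R : realType) (k : nat) (v : 'cV[R[i]]_k) : \bar R :=
  (Num.sqrt
    (\sum_(i < k) (complex.Re (v i 0) ^+ 2 + complex.Im (v i 0) ^+ 2)))%:E.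

Definition mx_opnorm (R : realType) (k : nat) (M : 'M[R[i]]_k) : \bar R :=
  opnorm (@cV_l2norm R k) (@cV_l2norm R k) (mulmx M).

Section subhomogeneous.
Variables (R : realType) (A : algType R[i]) (normA : A -> \bar R).

(* The values k = 1, ..., n are written k.+1 with k < n. *)
Definition topologically_n_subhomogeneous (n : nat) : Prop :=
  exists C1 C2 : R, [/\ 0 < C1, 0 < C2 &
    forall b : A,
      (normA b <= C1%:E * ereal_sup
        [set r | exists k : nat, exists pi : {lrmorphism A -> 'M[R[i]]_k.+1},
           [/\ (k < n)%N, (opnorm normA (@mx_opnorm R k.+1) pi <= C2%:E)%E
             & r = mx_opnorm (pi b)]])%E].

Definition topologically_subhomogeneous : Prop :=
  exists n : nat, topologically_n_subhomogeneous n.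

End subhomogeneous.

Arguments topologically_n_subhomogeneous {R} A normA n.
Arguments topologically_subhomogeneous {R} A normA.

(* A Hilbert space of functions on X is given as a Hilbert space together with
   an injective linear map to the functions on X; the inner product is linear
   in its first argument. *)
Record rkhs (R : realType) (X : Type) (K : X -> X -> R[i]) := Rkhs {
  rkhs_space :> completeNormedModType R[i] ;
  rkhs_dot : {dot rkhs_space for Num.conj} ;
  rkhs_dotE : forall f : rkhs_space, `|f| ^+ 2 = rkhs_dot f f ;
  rkhs_fun : {linear rkhs_space -> (X -> R[i])} ;
  rkhs_fun_inj : injective rkhs_fun ;
  rkhs_kernel : X -> rkhs_space ;
  rkhs_kernelE : forall z w, rkhs_fun (rkhs_kernel w) z = K z w ;
  rkhs_reproducing : forall (f : rkhs_space) w,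
    rkhs_fun f w = rkhs_dot f (rkhs_kernel w)
}.

(* The library's norm `|f| is R[i]-valued (with zero imaginary part). *)
Definition rkhs_norm (R : realType) (X : Type) (K : X -> X -> R[i])
  (H : rkhs K) (f : H) : \bar R := (complex.Re `|f|)%:E.

Section multipliers.
Variables (R : realType) (X : pointedType) (K : X -> X -> R[i]) (H : rkhs K).

Definition multiplier : {pred X -> R[i]} :=
  mem [set phi : X -> R[i] |
    forall f : H, exists g : H, rkhs_fun H g = phi * rkhs_fun H f].

Lemma multiplier_subalg_closed : subalg_closed multiplier.
Proof.
split=> [|c phi psi|phi psi].
- by rewrite inE => f; exists f; rewrite mul1r.
- rewrite !inE => Mphi Mpsi f.
  have [g gE] := Mphi f; have [h hE] := Mpsi f.
  by exists (c *: g + h); rewrite linearP gE hE mulrDl scalerAl.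
- rewrite !inE => Mphi Mpsi f.
  have [g gE] := Mpsi f; have [h hE] := Mphi g.
  by exists h; rewrite hE gE mulrA.
Qed.

HB.instance Definition _ := GRing.isSubalgClosed.Build R[i] (X -> R[i])
  multiplier multiplier_subalg_closed.

Record Mult := MkMult {
  mult_fun : X -> R[i] ;
  mult_funP : mult_fun \in multiplier
}.

HB.instance Definition _ := [isSub for mult_fun].
HB.instance Definition _ := [Choice of Mult by <:].
HB.instance Definition _ := [SubChoice_isSubAlgebra of Mult by <:].

Lemma mult_ex (phi : Mult) (f : H) :
  exists g : H, rkhs_fun H g = mult_fun phi * rkhs_fun H f.
Proof. by case: phi => phi /= /set_mem; apply. Qed.

(* M_phi f is the unique element of H representing the function phi f. *)
Definition mult_op (phi : Mult) (f : H) : H := projT1 (cid (mult_ex phi f)).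

Lemma mult_opE (phi : Mult) (f : H) :
  rkhs_fun H (mult_op phi f) = mult_fun phi * rkhs_fun H f.
Proof. exact: projT2 (cid (mult_ex phi f)). Qed.

Definition mult_norm (phi : Mult) : \bar R :=
  opnorm (@rkhs_norm R X K H) (@rkhs_norm R X K H) (mult_op phi).

End multipliers.

Arguments mult_norm {R X K} H phi.

Section unit_ball.
Variables (R : realType) (d : nat).

Definition unit_ball := {z : 'rV[R[i]]_d | \sum_(j < d) `|z 0 j| ^+ 2 < 1}.

Lemma unit_ball0 : \sum_(j < d) `|(0 : 'rV[R[i]]_d) 0 j| ^+ 2 < 1.
Proof. by rewrite big1 ?ltr01// => j _; rewrite mxE normr0 expr0n. Qed.

HB.instance Definition _ := Choice.on unit_ball.
HB.instance Definition _ := isPointed.Build unit_ball (exist _ 0 unit_ball0).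

Definition ball_dot (z w : unit_ball) : R[i] :=
  \sum_(j < d) sval z 0 j * (sval w 0 j)^*.

End unit_ball.

(* This is the principal branch of the logarithm on the half-plane Re x > 0,
   which contains 1 - <z, w> and its inverse for z, w in the unit ball. *)
Definition clog (R : realType) (x : R[i]) : R[i] :=
  ln (Num.sqrt (complex.Re x ^+ 2 + complex.Im x ^+ 2))
  +i* atan (complex.Im x / complex.Re x).

Definition cexp (R : realType) (x : R[i]) : R[i] :=
  (expR (complex.Re x))%:C * (cos (complex.Im x) +i* sin (complex.Im x)).

Definition cpow (R : realType) (x : R[i]) (a : R) : R[i] :=
  cexp (a%:C * clog x).

Definition dirichlet_kernel (R : realType) (d : nat) (a : R)
    (z w : unit_ball R d) : R[i] :=
  let u := ball_dot z w in
  if a == 0 then (if u == 0 then 1 else u^-1 * clog ((1 - u)^-1))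
  else (cpow (1 - u) a)^-1.

(* Main.v *)
Require Import Defs.
From mathcomp Require Import all_boot all_order all_algebra.
From mathcomp Require Import complex.
From mathcomp Require Import all_classical all_reals all_analysis.
From mathcomp Require Import ring lra zify.

Set Implicit Arguments.
Unset Strict Implicit.
Unset Printing Implicit Defensive.

Import Order.TTheory GRing.Theory Num.Theory.
Import numFieldNormedType.Exports.

Local Open Scope classical_set_scope.
Local Open Scope ring_scope.
Local Open Scope complex_scope.

Import ComplexField.Normc.

(** Let [m] be the least positive integer with [a < (m + 1) / 2]; then [m <= d]
and [s = (m + 1) / 2 - a] lies in [(0, 1]].  The powers of the monomial
[r = sqrt (m^m) z_1 .. z_m] have norms of the exact order [w n = (1 + n)^(s/2)],
both as elements of the space and as multipliers ([diagonal_powers]).  Since the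
powers are orthogonal, [b = sum_(j < N) r^(n_j) / w (n_j)] has norm at least
[sqrt N] for every choice of distinct exponents.  The theorem follows once the
exponents are chosen so that every representation of bounded norm and bounded
dimension keeps [b] bounded independently of [N].

Let [T] be the image of [r] under such a representation, of dimension at most
[K].  Then [|T^n| <= A w n], so the eigenvalues of [T] lie in the closed disc and
[|F(T)| <= A wnorm F] for polynomials [F], where [wnorm F = sum_l |F_l| w l]
([entry_horner_bound]).  By the theorem of Cayley and Hamilton, [T^n] may be
replaced by [F(T)] for any [F] congruent to [x^n] modulo the characteristic
polynomial.  If no distance [1 - |l|] or [|l - l'|] between eigenvalues and the
circle or each other falls into a window [(e, d)], then the eigenvalues form
clusters that are tight and well separated, each of them either close to the
circle or well inside the disc.  For [n] large in terms of [d] and [e] small in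
terms of [n], such an [F] exists with [wnorm F <= eta w n]
([small_remainder_at_scale]): well inside the disc [x^n] is small
([far_cluster]); at a multiple node on the circle [x^n] is, to finite order, the
[k]-th root of [x^(k n)], whose binomial series has coefficients of order [1/k],
while the weights of the terms grow more slowly than [k] as [s/2 < 1]
([near_cluster]); the clusters are put together by Chinese remaindering
([glue_clusters]).

So one can choose successive scales [n_j] with disjoint windows.  The at most
[K + K^2] distances attached to [T] spoil at most that many scales, at each of
which [|T^(n_j)| / w (n_j) <= A]; the other scales contribute at most [N eta],
which is [1] for [eta = 1/N] ([power_sum_bound]).

The norms of the monomials come from the power series of the kernel: it is
diagonal in the monomials, which are orthogonal by the rotational symmetry of the
ball, so that it determines their norms ([feature_norm]) and the norms of
multiplications by monomials ([multiplier_of_shift]).  The squared norm of [r^n] is a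
product over [0 < l <= n] of [m] quotients close to [1 + (m - a - j) / (m l)],
[j < m], and the sum of the numbers [(m - a - j) / m] is [s]; this makes the product
grow like [n^s] ([theta_growth]). *)

(** * Complex numbers *)

Section Abs.
Variable R : rcfType.
Local Notation C := R[i].
Local Notation abs := (@normc R).

Lemma abs_ge0 (x : C) : 0 <= abs x.
Proof. by case: x => a b; exact: sqrtr_ge0. Qed.

Lemma abs0 : abs 0 = 0. Proof. exact: normc0. Qed.
Lemma abs1 : abs 1 = 1. Proof. exact: normc1. Qed.

Lemma absX (x : C) n : abs (x ^+ n) = abs x ^+ n.
Proof. by elim: n => [|n IH]; rewrite ?expr0 ?abs1// !exprS normcM IH. Qed.

Lemma abs_sum (I : Type) (r : seq I) (P : pred I) (F : I -> C) :
  abs (\sum_(i <- r | P i) F i) <= \sum_(i <- r | P i) abs (F i).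
Proof.
elim/big_rec2: _ => [|i y x _ h]; first by rewrite abs0.
by rewrite (le_trans (le_normcD _ _))// lerD2l.
Qed.

Lemma abs_gt0 (x : C) : (0 < abs x) = (x != 0).
Proof.
rewrite lt_neqAle abs_ge0 andbT eq_sym; congr (~~ _); apply/eqP/eqP => [|->].
  exact: eq0_normc.
exact: abs0.
Qed.

End Abs.
#[global] Hint Extern 0 (is_true (0 <= normc _)) => exact: abs_ge0 : core.


Section ComplexParts.
Variable R : rcfType.
Local Notation C := R[i].
Local Notation abs := (@normc R).
Local Notation cj := (@conjc R).
Implicit Types x y : C.

Lemma cReD x y : complex.Re (x + y) = complex.Re x + complex.Re y.
Proof. by case: x; case: y. Qed.

Lemma cImD x y : complex.Im (x + y) = complex.Im x + complex.Im y.
Proof. by case: x; case: y. Qed.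

Lemma cReN x : complex.Re (- x) = - complex.Re x.
Proof. by case: x. Qed.

Lemma cReB x y : complex.Re (x - y) = complex.Re x - complex.Re y.
Proof. by rewrite cReD cReN. Qed.

Lemma Re_cj x : complex.Re (cj x) = complex.Re x.
Proof. by case: x. Qed.

Lemma cReMr (r : R) x : complex.Re (r%:C * x) = r * complex.Re x.
Proof. by case: x => a b /=; rewrite mul0r subr0. Qed.

Lemma abs_conj x : abs (cj x) = abs x.
Proof. by case: x => a b /=; rewrite sqrrN. Qed.

Lemma abs_real (r : R) : abs r%:C = `|r|.
Proof. by rewrite /= expr0n addr0 sqrtr_sqr. Qed.

Lemma abs_sqr x : abs x ^+ 2 = complex.Re x ^+ 2 + complex.Im x ^+ 2.
Proof. by case: x => a b /=; rewrite sqr_sqrtr// addr_ge0// sqr_ge0. Qed.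

Lemma mul_conj x : x * cj x = (abs x ^+ 2)%:C.
Proof.
rewrite abs_sqr; case: x => a b; apply/eqP; rewrite eq_complex /=.
by apply/andP; split; apply/eqP; ring.
Qed.

Lemma rcD (a b : R) : (a + b)%:C = a%:C + b%:C :> C. Proof. exact: rmorphD. Qed.
Lemma rcN (a : R) : (- a)%:C = - a%:C :> C. Proof. exact: rmorphN. Qed.
Lemma rcM (a b : R) : (a * b)%:C = a%:C * b%:C :> C. Proof. exact: rmorphM. Qed.
Lemma rcX (a : R) n : (a ^+ n)%:C = a%:C ^+ n :> C. Proof. exact: rmorphXn. Qed.
Lemma rcV (a : R) : (a^-1)%:C = a%:C^-1 :> C. Proof. exact: fmorphV. Qed.
Lemma rc_nat n : (n%:R : R)%:C = n%:R :> C. Proof. exact: rmorph_nat. Qed.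
Lemma rc_sum (I : Type) (r : seq I) (P : pred I) (F : I -> R) :
  (\sum_(i <- r | P i) F i)%:C = \sum_(i <- r | P i) (F i)%:C :> C.
Proof. exact: rmorph_sum. Qed.

Lemma cjM x y : cj (x * y) = cj x * cj y. Proof. exact: rmorphM. Qed.
Lemma cjX x n : cj (x ^+ n) = cj x ^+ n. Proof. exact: rmorphXn. Qed.
Lemma cj_sum (I : Type) (r : seq I) (P : pred I) (F : I -> C) :
  cj (\sum_(i <- r | P i) F i) = \sum_(i <- r | P i) cj (F i).
Proof. exact: rmorph_sum. Qed.
Lemma cj_prod (I : Type) (r : seq I) (P : pred I) (F : I -> C) :
  cj (\prod_(i <- r | P i) F i) = \prod_(i <- r | P i) cj (F i).
Proof. exact: rmorph_prod. Qed.

Lemma Re_le_abs x : complex.Re x <= abs x.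
Proof.
case: x => a b /=; rewrite (le_trans (ler_norm _))// -sqrtr_sqr ler_sqrt.
  by rewrite lerDl sqr_ge0.
by rewrite addr_ge0// sqr_ge0.
Qed.

Lemma abs_Re_le x : `|complex.Re x| <= abs x.
Proof. by rewrite ler_norml Re_le_abs andbT lerNl -cReN -(normcN x) Re_le_abs. Qed.

Lemma abs_Im_le x : `|complex.Im x| <= abs x.
Proof.
have -> : complex.Im x = complex.Re (- 'i%C * x) by case: x => a b /=; ring.
rewrite (le_trans (abs_Re_le _))// normcM normcN /= expr0n expr1n add0r sqrtr1.
by rewrite mul1r.
Qed.

Lemma cRe_sum (I : Type) (r : seq I) (P : pred I) (F : I -> C) :
  complex.Re (\sum_(i <- r | P i) F i) = \sum_(i <- r | P i) complex.Re (F i).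
Proof. by elim/big_rec2: _ => [//|i y x _ <-]; rewrite cReD. Qed.

Lemma abs_le_ReIm x : abs x <= `|complex.Re x| + `|complex.Im x|.
Proof.
case: x => a b /=.
rewrite -[leRHS]ger0_norm ?addr_ge0// -(sqrtr_sqr (`|a| + `|b|)) ler_sqrt ?sqr_ge0//.
by rewrite sqrrD !real_normK ?num_real// -addrA lerD2l lerDr mulrn_wge0.
Qed.

End ComplexParts.


(** * Weighted norms of polynomials *)

(** The growth that is allowed for the powers of an operator.  Submultiplicativity
makes the weighted sum of absolute coefficients an algebra norm. *)
Record weight (R : realType) := Weight {
  weight_fun :> nat -> R ;
  weight0 : weight_fun 0 = 1 ;
  weight_mono : {homo weight_fun : i j / (i <= j)%N >-> i <= j} ;
  weightD : forall i j, weight_fun (i + j)%N <= weight_fun i * weight_fun j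
}.

Section WeightedNorm.
Variables (R : realType) (w : weight R).
Local Notation C := R[i].
Local Notation abs := (@normc R).

(** The norm of the Beurling algebra of [w]: if the powers of an element are bounded
by [w], then a polynomial in this element is bounded by this norm. *)
Definition wnorm (p : {poly C}) : R := \sum_(l < size p) abs p`_l * w l.

Lemma w_ge1 n : 1 <= w n. Proof. by rewrite -(weight0 w); apply: weight_mono. Qed.
Lemma w_ge0 n : 0 <= w n. Proof. by rewrite (le_trans _ (w_ge1 n)). Qed.
Hint Extern 0 (is_true (0 <= weight_fun _ _)) => exact: w_ge0 : core.

Lemma wnorm_wide n (p : {poly C}) : (size p <= n)%N ->
  wnorm p = \sum_(l < n) abs p`_l * w l.
Proof.
move=> sp; rewrite /wnorm (big_ord_widen _ (fun l => abs p`_l * w l) sp).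
rewrite big_mkcond; apply: eq_bigr => i _; case: ltnP => // h.
by rewrite nth_default// abs0 mul0r.
Qed.

Lemma wnorm_ge0 p : 0 <= wnorm p.
Proof. by apply: sumr_ge0 => i _; rewrite mulr_ge0. Qed.
Hint Extern 0 (is_true (0 <= wnorm _)) => exact: wnorm_ge0 : core.

Lemma wnorm0 : wnorm 0 = 0.
Proof. by rewrite /wnorm size_poly0 big_ord0. Qed.

Lemma wnormD p q : wnorm (p + q) <= wnorm p + wnorm q.
Proof.
pose n := maxn (size p) (size q).
rewrite (@wnorm_wide n (p + q)) ?size_polyD// (@wnorm_wide n p) ?leq_maxl//.
rewrite (@wnorm_wide n q) ?leq_maxr// -big_split/=; apply: ler_sum => i _.
by rewrite -mulrDl ler_wpM2r// coefD le_normcD.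
Qed.

Lemma wnormCM (c : C) p : wnorm (c%:P * p) = abs c * wnorm p.
Proof.
rewrite (@wnorm_wide (size p)); last by rewrite mul_polyC size_scale_leq.
rewrite /wnorm mulr_sumr.
by apply: eq_bigr => i _; rewrite coefCM normcM mulrA.
Qed.

Lemma wnormN p : wnorm (- p) = wnorm p.
Proof. by rewrite -mulN1r -[-1]polyCN wnormCM normcN abs1 mul1r. Qed.

Lemma wnormB p q : wnorm (p - q) <= wnorm p + wnorm q.
Proof. by rewrite (le_trans (wnormD _ _))// wnormN. Qed.

Lemma wnorm_sum (I : Type) (r : seq I) (P : pred I) (F : I -> {poly C}) :
  wnorm (\sum_(i <- r | P i) F i) <= \sum_(i <- r | P i) wnorm (F i).
Proof.
elim/big_rec2: _ => [|i y x _ h]; first by rewrite wnorm0.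
by rewrite (le_trans (wnormD _ _))// lerD2l.
Qed.

Lemma wnormXn n : wnorm 'X^n = w n.
Proof.
rewrite (@wnorm_wide n.+1) ?size_polyXn// big_ord_recr/= coefXn eqxx abs1 mul1r.
by rewrite big1 ?add0r// => i _; rewrite coefXn ltn_eqF// abs0 mul0r.
Qed.

Lemma wnormC (c : C) : wnorm c%:P = abs c.
Proof. by rewrite (@wnorm_wide 1) ?size_polyC_leq1// big_ord1 coefC eqxx weight0 mulr1. Qed.

Lemma wnorm1 : wnorm 1 = 1.
Proof. by rewrite (wnormC 1) abs1. Qed.

Lemma wnormXnM n p : wnorm ('X^n * p) <= w n * wnorm p.
Proof.
rewrite (@wnorm_wide (n + size p)); last first.
  by rewrite (leq_trans (size_polyMleq _ _))// size_polyXn addSn.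
rewrite big_split_ord/= big1 ?add0r; last first.
  by move=> i _; rewrite coefXnM ltn_ord abs0 mul0r.
rewrite /wnorm mulr_sumr; apply: ler_sum => i _.
by rewrite coefXnM ltnNge leq_addr/= addKn mulrCA ler_wpM2l// weightD.
Qed.

Lemma wnormM p q : wnorm (p * q) <= wnorm p * wnorm q.
Proof.
rewrite [wnorm p]/wnorm.
rewrite -{1}[p]coefK poly_def mulr_suml (le_trans (wnorm_sum _ _ _))//.
rewrite mulr_suml; apply: ler_sum => i _.
by rewrite -mul_polyC -mulrA wnormCM -mulrA ler_wpM2l// wnormXnM.
Qed.

Lemma wnorm_exp p n : wnorm (p ^+ n) <= wnorm p ^+ n.
Proof.
elim: n => [|n IH]; first by rewrite !expr0 wnorm1.
by rewrite !exprS (le_trans (wnormM _ _))// ler_wpM2l.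
Qed.

Lemma wnorm_XsubC (l : C) : abs l <= 1 -> wnorm ('X - l%:P) <= 1 + w 1.
Proof.
move=> h; rewrite (le_trans (wnormB _ _))// -[X in wnorm X]expr1 wnormXn wnormC.
by rewrite addrC lerD2r.
Qed.

End WeightedNorm.
#[global] Hint Extern 0 (is_true (0 <= weight_fun _ _)) => exact: w_ge0 : core.
#[global] Hint Extern 0 (is_true (0 <= wnorm _ _)) => exact: wnorm_ge0 : core.

(** * The truncated binomial series of an m-th root *)

Section RootSeries.
Variables (F : numFieldType) (m : nat).
Hypothesis m_gt0 : (0 < m)%N.

(** Binomial coefficients [1/m] choose [i], the coefficients of [(1 + t)^(1/m)]. *)
Fixpoint root_coef (i : nat) : F :=
  if i is j.+1 then root_coef j * (m%:R^-1 - j%:R) / j.+1%:R else 1.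

Lemma root_coefS i : root_coef i.+1 = root_coef i * (m%:R^-1 - i%:R) / i.+1%:R.
Proof. by []. Qed.

(** Every factor after the first has absolute value at most [1], so the factor [1/m]
survives in all the coefficients. *)
Lemma root_coef_bound i : `|root_coef i.+1| <= m%:R^-1.
Proof.
have m1 : 1 <= m%:R :> F by rewrite ler1n.
have mV : 0 <= (m%:R^-1 : F) <= 1 by rewrite invr_ge0 ler0n invf_le1 ?ltr0n.
elim: i => [|i IH].
  by rewrite root_coefS /= mul1r subr0 divr1 ger0_norm//; case/andP: mV.
rewrite root_coefS normrM normrM normfV (ger0_norm (ler0n _ _)) -mulrA.
apply: le_trans IH; rewrite ler_piMr//.
rewrite ler_pdivrMr ?ltr0n// mul1r distrC ger0_norm.
  by rewrite lerBlDr ler_wpDr ?ler_nat//; case/andP: mV.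
rewrite subr_ge0; case/andP: mV => _ h; rewrite (le_trans h)// ler1n//.
Qed.

(** The truncated binomial series of [y = (1 + (y^m - 1))^(1/m)]. *)
Definition root_sum k : {poly F} :=
  \sum_(i < k) (root_coef i)%:P * ('X^m - 1) ^+ i.

(** The series represents a solution of [y P' = P]: the contributions of its terms to
[y P' - P] telescope, so a truncation leaves a single power of [y^m - 1]. *)
Lemma root_sum_ode k :
  'X * ('X - root_sum k.+1)^`() - ('X - root_sum k.+1)
  = - (root_coef k * (k%:R * m%:R - 1))%:P * ('X^m - 1) ^+ k.
Proof.
have dU : 'X * ('X^m - 1 : {poly F})^`() = (m%:R)%:P * 'X^m.
  rewrite derivB derivXn -(polyC1 F) derivC subr0 mulrnAr -exprS prednK//.
  by rewrite -mulr_natl polyC_natr.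
elim: k => [|k IH].
  rewrite /root_sum big_ord_recr big_ord0/= add0r !expr0 mulr1 mul0r.
  by rewrite derivB derivX derivC subr0 mulr1 mulr1 sub0r mulrN1 polyC1; ring.
rewrite /root_sum big_ord_recr/= -/(root_sum k.+1).
rewrite -!root_coefS.
set U := 'X^m - 1 in dU IH *; set A := 'X - root_sum k.+1 in IH *.
rewrite opprD addrA -/A derivB deriv_mulC deriv_exp -[k.+1.-1]/k.
have E : (root_coef k.+1)%:P * k.+1%:R * m%:R = (root_coef k)%:P * (1 - k%:R * m%:R) :> {poly F}.
  rewrite -!polyC_natr -polyC1 -!polyCM -polyCB -polyCM; congr _%:P.
  rewrite root_coefS -!mulrA; congr (_ * _).
  rewrite [_^-1 * _]mulrA mulVf ?pnatr_eq0// mul1r mulrBl mulVf//.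
  by rewrite pnatr_eq0 -lt0n.
have -> : 'X * (A^`() - (root_coef k.+1)%:P * (U^`() * U ^+ k *+ k.+1)) -
  (A - (root_coef k.+1)%:P * U ^+ k.+1) =
  ('X * A^`() - A) - (root_coef k.+1)%:P * (('X * U^`()) * U ^+ k *+ k.+1)
  + (root_coef k.+1)%:P * U ^+ k.+1 by ring.
rewrite IH dU -[_ * U ^+ k *+ _]mulr_natl.
have -> : 'X^m = U + 1 by rewrite /U subrK.
move: (root_coef k.+1) (root_coef k) E => rc rd E.
rewrite !(polyCM, polyCB, polyC_natr, polyC1) exprS.
set u := U ^+ k; set c := rc%:P in E *; set d := rd%:P in E *.
have -> : - (d * (k%:R * m%:R - 1)) * u - c * (k.+1%:R * (m%:R * (U + 1) * u)) + c * (U * u)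
 = - (c * (k.+1%:R * m%:R - 1)) * (U * u)
  - (c * k.+1%:R * m%:R - d * (1 - k%:R * m%:R)) * u by ring.
by rewrite E subrr mul0r subr0.
Qed.

(** If [P = (y - 1)^k h] is the remainder, then [y P' - P] has the leading term
[k h(1) (y - 1)^(k-1)] at [1], while by [root_sum_ode] it vanishes there to order
[k].  Hence [h(1) = 0]: each term of the series raises the order by one. *)
Lemma root_sum_dvd k : ('X - 1) ^+ k %| ('X - root_sum k).
Proof.
elim: k => [|k IH]; first by rewrite expr0 dvd1p.
have [h hE] : exists h, 'X - root_sum k.+1 = h * ('X - 1) ^+ k.
  have /dvdpP[g gE] := IH.
  have /dvdpP[v vE] : ('X - 1 : {poly F}) %| 'X^m - 1.
    by rewrite -(polyC1 F) dvdp_XsubCl /root !hornerE expr1n subrr.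
  exists (g - (root_coef k)%:P * v ^+ k).
  rewrite /root_sum big_ord_recr/= -/(root_sum k) opprD addrA gE vE exprMn.
  by rewrite mulrBl mulrA.
rewrite hE exprS dvdp_mul2r ?expf_neq0 ?monic_neq0 -?(polyC1 F) ?monicXsubC//.
rewrite dvdp_XsubCl.
case: k => [|k] in IH hE *.
  move: hE; rewrite /root_sum big_ord1 !expr0 !mulr1/= => <-.
  by rewrite /root !hornerE subrr.
have := root_sum_ode k.+1; rewrite hE derivM deriv_exp -(polyC1 F) derivXsubC mul1r/=.
rewrite (polyC1 F).
have /dvdpP[v ->] : ('X - 1 : {poly F}) %| 'X^m - 1.
  by rewrite -(polyC1 F) dvdp_XsubCl /root !hornerE expr1n subrr.
rewrite exprMn.
set e := _%:P => H.
have : ('X - 1) ^+ k * ('X * (k.+1)%:R * h) =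
  ('X - 1) ^+ k * (('X - 1) * (- 'X * h^`() + h - e * v ^+ k.+1)).
  apply/eqP; rewrite -subr_eq0; apply/eqP.
  rewrite -[RHS](subrr (- e * (v ^+ k.+1 * ('X - 1) ^+ k.+1))) -[X in _ = X - _]H.
  rewrite !exprS; ring.
move/mulfI => /(_ _) H2.
have {H2} := H2 _; rewrite expf_neq0 ?monic_neq0 -?(polyC1 F) ?monicXsubC// => /(_ isT).
move=> /(congr1 (fun p => p.[1])); rewrite !hornerE subrr mul0r.
move=> /eqP; rewrite -polyC_natr hornerC mulf_eq0 pnatr_eq0/=.
by [].
Qed.

End RootSeries.

(** * Powers of x modulo a power of a linear factor *)

Section Clusters.
Variables (R : realType) (w : weight R).
Local Notation C := R[i].
Local Notation abs := (@normc R).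

(** The unweighted norm.  Estimating a power of a polynomial of degree [N] by the
unweighted norm, and its degree by the weight, gives [w (N k)] where
submultiplicativity of the weighted norm would give the much larger [w N ^ k]. *)
Fact const_weightD (i j : nat) : (1 : R) <= 1 * 1. Proof. by rewrite mulr1. Qed.
Definition const_weight : weight R :=
  Weight (erefl (1 : R)) (fun _ _ _ => lexx 1) const_weightD.

Lemma wnorm_le_size d (p : {poly C}) : (size p <= d.+1)%N ->
  wnorm w p <= w d * wnorm const_weight p.
Proof.
move=> sp; rewrite !(wnorm_wide _ sp) mulr_sumr; apply: ler_sum => i _.
rewrite mulr1 mulrC ler_wpM2r//; apply: weight_mono.
by rewrite -ltnS.
Qed.

Lemma wnorm_binomial (b : C) N i k : abs b <= 2 -> (i <= k)%N ->
  wnorm w ((b%:P * 'X^N - 1) ^+ i) <= 3 ^+ k * w (N * k)%N.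
Proof.
move=> hb ik; have s1 : (size (b%:P * 'X^N - 1 : {poly C})%R <= N.+1)%N.
  rewrite (leq_trans (size_polyD _ _))// geq_max size_polyN size_poly1 /= andbT.
  by rewrite mul_polyC (leq_trans (size_scale_leq _ _))// size_polyXn.
have s2 : (size ((b%:P * 'X^N - 1 : {poly C}) ^+ i)%R <= (N * k).+1)%N.
  rewrite (leq_trans (size_poly_exp_leq _ _))// ltnS leq_mul//.
  by rewrite -ltnS (leq_trans (leqSpred _))//; case: size s1.
rewrite (le_trans (wnorm_le_size s2))// mulrC ler_wpM2r//.
rewrite (le_trans (wnorm_exp _ _ _))//.
apply: (@le_trans _ _ (3 ^+ i)); last by rewrite ler_weXn2l// ler1n.
rewrite lerXn2r// ?nnegrE//.
rewrite (le_trans (wnormB _ _ _))// wnorm1 wnormCM wnormXn mulr1.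
by move: hb; set t := normc b; lra.
Qed.

Lemma abs_root_coef m i : (0 < m)%N -> abs (root_coef C m i.+1) <= m%:R^-1.
Proof.
move=> m0; rewrite -lecR fmorphV rmorph_nat.
exact: (@root_coef_bound C m m0 i).
Qed.

Lemma subXX_factor (l : C) n : {S : {poly C} |
  'X^n - (l ^+ n)%:P = ('X - l%:P) * S & abs l <= 1 -> wnorm w S <= n%:R * w n}.
Proof.
exists (\sum_(i < n) 'X^(n.-1 - i) * l%:P ^+ i).
  by rewrite polyC_exp subrXX.
move=> hl; rewrite (le_trans (wnorm_sum _ _ _ _))// mulr_natl.
rewrite -[X in _ *+ X]card_ord -sumr_const; apply: ler_sum => i _.
rewrite -polyC_exp mulrC wnormCM wnormXn -[leRHS]mul1r ler_pM//.
  by rewrite absX exprn_ile1.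
by apply: weight_mono; lia.
Qed.

(** Nodes near the unit circle.  On a multiple node [l] the function
[y = x^n / l^n] is the [m]-th root of [y^m], hence up to order [K] a
combination of [1], with coefficient [1], and of higher powers of [y^m], with
coefficients [O(1/m)]. *)
Lemma near_cluster (K m : nat) : (0 < m)%N ->
  exists (D : nat -> nat) (G : nat -> R), forall n l, (0 < n)%N -> abs l <= 1 ->
    2^-1 <= abs l ^+ D n ->
    exists q g, [/\ 'X^n = q + ('X - l%:P) ^+ K * g,
      wnorm w q <= 1 + K%:R * (3 ^+ K / m%:R * w (n * m * K)%N) &
      wnorm w g <= G n].
Proof.
move=> m0; have /dvdpP[h hE] := @root_sum_dvd C m m0 K.
(* [E] exceeds every exponent with which [a = l^(-n)] occurs below, and
   [|l|^(n E) >= 1/2] keeps all these powers of [a] below [2]. *)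
pose E := (m * K + size h + K).+1.
exists (fun n => (n * E)%N).
exists (fun n => (\sum_(j < size h) abs h`_j * 2 * w (n * j)%N) * 2 * (n%:R * w n) ^+ K).
move=> n l n0 l1 hl.
have l0 : l != 0.
  apply: contraTneq hl => ->; rewrite abs0 expr0n muln_eq0 gtn_eqF//= -ltNge.
  by rewrite invr_gt0.
pose a := (l ^+ n)^-1.
have ha j : (j <= E)%N -> abs (a ^+ j) <= 2.
  move=> jE; rewrite exprVn -exprM normcV absX -[leRHS]invrK lef_pV2 ?posrE ?invr_gt0//.
    rewrite (le_trans hl)// ler_wiXn2l// leq_mul2l jE orbT//.
  by rewrite exprn_gt0// abs_gt0.
have al : l ^+ n * a = 1 by rewrite divff// expf_neq0.
have aln : abs (l ^+ n) <= 1 by rewrite absX exprn_ile1.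
pose y : {poly C} := a%:P * 'X^n.
have [S SE Sn] := subXX_factor l n.
have y1 : y - 1 = a%:P * (('X - l%:P) * S).
  by rewrite -SE /y mulrBr -polyCM [a * _]mulrC al.
have XE : 'X^n = (l ^+ n)%:P * y by rewrite /y mulrA -polyCM al mul1r.
have yE : y - (root_sum C m K \Po y) = (h \Po y) * (y - 1) ^+ K.
  move: hE => /(congr1 (fun p => p \Po y)).
  by rewrite comp_polyB comp_polyX comp_polyM rmorphXn/= comp_polyB comp_polyX -[1]polyC1 comp_polyC.
exists ((l ^+ n)%:P * (root_sum C m K \Po y)).
exists ((l ^+ n)%:P * ((h \Po y) * (a ^+ K)%:P * S ^+ K)); split.
- apply/eqP; rewrite -subr_eq0 XE; apply/eqP.
  transitivity ((l ^+ n)%:P * ((y - (root_sum C m K \Po y)) - (h \Po y) * (y - 1) ^+ K)).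
    by rewrite y1 [(a ^+ K)%:P]polyC_exp !exprMn; ring.
  by rewrite yE subrr mulr0.
- rewrite wnormCM -[leRHS]mul1r ler_pM//.
  rewrite /root_sum raddf_sum/= (le_trans (wnorm_sum _ _ _ _))//.
  set B := _ / _ * _.
  have B0 : 0 <= B by rewrite !mulr_ge0// ?invr_ge0// exprn_ge0.
  have -> : 1 + K%:R * B = 1 + \sum_(i < K) B by rewrite sumr_const card_ord mulr_natl.
  have term i : (i < K)%N ->
      wnorm w (((root_coef C m i)%:P * ('X^m - 1) ^+ i) \Po y) <= (i == 0)%:R + B.
    move=> iK; rewrite comp_polyM comp_polyC wnormCM rmorphXn/= comp_polyB comp_Xn_poly.
    rewrite -[1]polyC1 comp_polyC polyC1 /y exprMn -polyC_exp -exprM.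
    case: i iK => [|i] iK; first by rewrite expr0 wnorm1 abs1 mulr1 lerDl.
    rewrite add0r /B -mulrA mulrCA (le_trans (ler_pM _ _ (abs_root_coef i m0) (wnorm_binomial _ _ (ltnW iK))))//.
    by apply: ha; rewrite /E; nia.
  apply: (@le_trans _ _ (\sum_(i < K) (((i : nat) == 0)%:R + B))).
    by apply: ler_sum => i _; apply: term.
  rewrite big_split/= lerD2r; case: (K) => [|k]; first by rewrite big_ord0.
  by rewrite big_ord_recl/= big1 ?addr0.
rewrite wnormCM -[leRHS]mul1r ler_pM//.
rewrite (le_trans (wnormM _ _ _))// ler_pM//; last first.
  by rewrite (le_trans (wnorm_exp _ _ _))// lerXn2r ?nnegrE ?Sn// mulr_ge0.
rewrite mulrC wnormCM mulrC ler_pM//; last by apply: ha; rewrite /E; lia.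
rewrite comp_polyE (le_trans (wnorm_sum _ _ _ _))//; apply: ler_sum => j _.
rewrite -mul_polyC wnormCM -mulrA ler_wpM2l// /y exprMn -polyC_exp -exprM wnormCM wnormXn.
by rewrite ler_wpM2r//; apply: ha; rewrite (leq_trans (ltnW (ltn_ord j)))// leqW// addnAC leq_addl.
Qed.

(** Nodes well inside the disc: [x^(N K)] is small modulo [(x - l)^K] because
[(x^N - l^N)^K] is zero there and its other terms carry powers of [l^N]. *)
Lemma far_cluster (K N : nat) (l : C) (rho : R) : (0 < K)%N ->
  abs l <= rho -> rho <= 1 ->
  exists q g, [/\ 'X^(N * K) = q + ('X - l%:P) ^+ K * g,
      wnorm w q <= 2 ^+ K * rho ^+ N * w (N * K)%N &
      wnorm w g <= (N%:R * w N) ^+ K].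
Proof.
move=> K0 hl rho1; have l1 := le_trans hl rho1.
have [S SE Sn] := subXX_factor l N.
exists ('X^(N * K) - ('X^N - (l ^+ N)%:P) ^+ K), (S ^+ K); split.
- by rewrite SE exprMn subrK.
- rewrite exprDn -(prednK K0) big_ord_recl/= subn0 expr0 mulr1 bin0 mulr1n -exprM.
  rewrite opprD addrA subrr sub0r wnormN (le_trans (wnorm_sum _ _ _ _))//.
  rewrite -[2 ^+ _]/((1 + 1) ^+ K.-1.+1) (exprDn 1 1) !mulr_suml.
  rewrite [leRHS]big_ord_recl/= ler_wpDl//.
    by rewrite !expr1n mulr1 bin0 mul1r mulr_ge0// exprn_ge0// (le_trans _ hl).
  apply: ler_sum => i _; rewrite !expr1n mulr1.
  rewrite -mulr_natl -[in X in _ <= X]mulr_natr mul1r -polyC_natr wnormCM -!mulrA.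
  have -> : abs ('C(K.-1.+1, bump 0 i))%:R = ('C(K.-1.+1, bump 0 i))%:R.
    by rewrite -[LHS]/(complex.Re (`|_%:R : C|)) normr_nat -(rmorph_nat (real_complex R)).
  rewrite ler_wpM2l// -exprM mulrC -polyCN -polyC_exp wnormCM wnormXn ler_pM//.
    rewrite absX normcN absX -exprM.
    apply: (@le_trans _ _ (abs l ^+ N)).
      by rewrite ler_wiXn2l// /bump add1n mulnS leq_addr.
    by rewrite lerXn2r// nnegrE// (le_trans _ hl).
  by apply: weight_mono; rewrite leq_mul2l leq_subr orbT.
by rewrite (le_trans (wnorm_exp _ _ _))// lerXn2r ?nnegrE ?Sn// mulr_ge0.
Qed.

End Clusters.

(** * Powers of x modulo the polynomial of separated clusters of nodes *)

Section NodePolynomials.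
Variables (R : realType) (w : weight R).
Local Notation C := R[i].
Local Notation abs := (@normc R).
Local Notation W := (1 + w 1).

Definition node_poly (s : seq C) : {poly C} := \prod_(l <- s) ('X - l%:P).

Lemma node_poly_cons l s : node_poly (l :: s) = ('X - l%:P) * node_poly s.
Proof. by rewrite /node_poly big_cons. Qed.

Lemma W_ge2 : 2 <= W. Proof. by have := w_ge1 w 1; lra. Qed.
Lemma W_ge1 : 1 <= W. Proof. by have := W_ge2; lra. Qed.
Lemma W_ge0 : 0 <= W. Proof. by have := W_ge2; lra. Qed.
Hint Resolve W_ge0 W_ge1 : core.

Lemma wnorm_node_poly s : {in s, forall l, abs l <= 1} ->
  wnorm w (node_poly s) <= W ^+ size s.
Proof.
elim: s => [|l s IH] hs; first by rewrite /node_poly big_nil wnorm1.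
rewrite node_poly_cons exprS (le_trans (wnormM _ _ _))// ler_pM//.
  by rewrite wnorm_XsubC// hs// mem_head.
by apply: IH => x xs; rewrite hs// inE xs orbT.
Qed.

Lemma abs_node_poly s (r : C) : abs r <= 1 -> {in s, forall l, abs l <= 1} ->
  abs (node_poly s).[r] <= W ^+ size s.
Proof.
move=> hr; elim: s => [|l s IH] hs; first by rewrite /node_poly big_nil hornerC abs1.
rewrite node_poly_cons exprS hornerM normcM ler_pM//.
  rewrite !hornerE (le_trans (le_normcD _ _))// normcN (le_trans _ W_ge2)//.
  by have := hs l (mem_head _ _); move: hr; set a := normc r; set b := normc l; lra.
by apply: IH => x xs; rewrite hs// inE xs orbT.
Qed.

(** The nodes are moved to [l] one at a time. *)
Lemma node_poly_close s (l : C) (e : R) : abs l <= 1 ->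
  {in s, forall x, abs x <= 1} -> {in s, forall x, abs (x - l) <= e} ->
  wnorm w (('X - l%:P) ^+ size s - node_poly s) <= (size s)%:R * e * W ^+ size s.
Proof.
move=> hl; elim: s => [|x s IH] hs he.
  by rewrite /node_poly big_nil expr0 subrr wnorm0 !mul0r.
have hxl := he x (mem_head _ _).
have e0 : 0 <= e by rewrite (le_trans _ hxl).
rewrite node_poly_cons /= exprS.
have -> : ('X - l%:P) * ('X - l%:P) ^+ size s - ('X - x%:P) * node_poly s =
  ('X - l%:P) * (('X - l%:P) ^+ size s - node_poly s) + (x - l)%:P * node_poly s.
  by rewrite polyCB; ring.
rewrite (le_trans (wnormD _ _ _))// -[(size s).+1%:R]natr1 [in leRHS]mulrDl [in leRHS]mul1r [in leRHS]mulrDl lerD//.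
  rewrite (le_trans (wnormM _ _ _))// exprS mulrCA ler_pM ?wnorm_XsubC//.
  apply: IH => y ys; first by rewrite hs// inE ys orbT.
  by rewrite he// inE ys orbT.
rewrite wnormCM ler_pM//.
rewrite (le_trans (wnorm_node_poly _))//; first by move=> y ys; rewrite hs// inE ys orbT.
by rewrite exprS ler_peMl// exprn_ge0.
Qed.

Lemma node_poly_factor s (r : C) : abs r <= 1 -> {in s, forall l, abs l <= 1} ->
  exists h, node_poly s - (node_poly s).[r]%:P = ('X - r%:P) * h /\
    wnorm w h <= (size s)%:R * W ^+ size s.
Proof.
move=> hr; elim: s => [|l s IH] hs.
  by exists 0; rewrite /node_poly big_nil hornerC subrr mulr0 wnorm0 mul0r.
have hs' : {in s, forall l, abs l <= 1} by move=> x xs; rewrite hs// inE xs orbT.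
have [h [hE hn]] := IH hs'.
exists (('X - l%:P) * h + ((node_poly s).[r])%:P); split.
  rewrite node_poly_cons hornerM !hornerE polyCM polyCB.
  rewrite mulrDr mulrCA -hE; ring.
rewrite (le_trans (wnormD _ _ _))// -[(size s).+1%:R]natr1 [in leRHS]mulrDl [in leRHS]mul1r lerD//.
  rewrite (le_trans (wnormM _ _ _))// exprS mulrCA ler_pM ?wnorm_XsubC//.
  by rewrite hs// mem_head.
rewrite wnormC (le_trans (abs_node_poly _ _))//=.
by rewrite exprS ler_peMl// exprn_ge0.
Qed.

(** With [p = node_poly s], the factorisation [p - p(r) = (x - r) h] shows that
[- h / p(r)] inverts [x - r] modulo [p], and [|p(r)| >= d^K] by the separation.  The
product of these inverses over [r] in [t] inverts [node_poly t]. *)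
Lemma node_poly_bezout (K : nat) (d : R) s t : 0 < d -> d <= 1 -> (size s <= K)%N ->
  {in s, forall l, abs l <= 1} -> {in t, forall l, abs l <= 1} ->
  {in t & s, forall x y, d <= abs (x - y)} ->
  exists b, node_poly s %| 1 - node_poly t * b /\
    wnorm w b <= (K%:R * W ^+ K * d^-1 ^+ K) ^+ size t.
Proof.
move=> d0 d1 sK hs; elim: t => [|r t IH] ht hd.
  by exists 1; rewrite /node_poly big_nil mulr1 subrr dvdp0 wnorm1.
have [|x y xt|b [bd bn]] := IH; first by move=> x xt; rewrite ht// inE xt orbT.
  by move=> ys; rewrite hd// inE xt orbT.
have hr : abs r <= 1 by rewrite ht// mem_head.
have [h [hE hn]] := node_poly_factor hr hs.
have pr : d ^+ K <= abs (node_poly s).[r].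
  apply: (@le_trans _ _ (d ^+ size s)); first by rewrite ler_wiXn2l// ltW.
  have : {in s, forall y, d <= abs (r - y)} by move=> y ys; rewrite hd// mem_head.
  elim: (s) => [|y u IHu] hu; first by rewrite /node_poly big_nil hornerC abs1.
  rewrite node_poly_cons hornerM normcM exprS ler_pM ?(ltW d0)//.
  - by rewrite exprn_ge0// ltW.
  - by rewrite hornerXsubC; apply: hu; rewrite mem_head.
  - by apply: IHu => z zu; rewrite hu// inE zu orbT.
set p := (node_poly s).[r] in hE pr.
have p0 : p != 0 by rewrite -abs_gt0 (lt_le_trans _ pr)// exprn_gt0.
exists (b * ((- p^-1)%:P * h)); split.
  have -> : 1 - node_poly (r :: t) * (b * ((- p^-1)%:P * h)) =
    (1 - node_poly t * b) + (node_poly t * b * (p^-1)%:P) * node_poly s.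
    rewrite node_poly_cons polyCN.
    have -> : node_poly s = ('X - r%:P) * h + p%:P by rewrite -hE subrK.
    have H : (p^-1)%:P * p%:P = 1 :> {poly C} by rewrite -polyCM mulVf.
    have : node_poly t * b * ((p^-1)%:P * p%:P) = node_poly t * b by rewrite H mulr1.
    move=> H2; rewrite -[X in 1 - X + _ ]H2; ring.
  by rewrite dvdp_add// dvdp_mull.
rewrite (le_trans (wnormM _ _ _))//= exprSr ler_pM// wnormCM normcN normcV mulrC ler_pM ?invr_ge0//.
  rewrite (le_trans hn)// ler_pM ?ler_nat ?exprn_ge0 ?ler_weXn2l//.
by rewrite exprVn lef_pV2 ?posrE ?exprn_gt0 ?abs_gt0.
Qed.

(** The cost of adding one cluster: the second summand bounds twice the norm of
[node_poly t * b], with [b] from [node_poly_bezout]. *)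
Definition crt_const (K : nat) (d : R) : R :=
  1 + 2 * (W ^+ K * (K%:R * W ^+ K * d^-1 ^+ K) ^+ K).

Lemma crt_const_ge1 K d : 0 < d -> 1 <= crt_const K d.
Proof.
move=> d0; rewrite /crt_const lerDl !mulr_ge0// exprn_ge0// !mulr_ge0// exprn_ge0//.
by rewrite invr_ge0 ltW.
Qed.

(** Chinese remaindering: remainders modulo well separated clusters of nodes are
glued into a remainder modulo all nodes, at a cost that depends on the number of
nodes and on the separation [d] alone.  As [2 e < d], being within [e] is transitive on
the nodes, so the nodes within [e] of a given one form a cluster that is separated by
[d] from the remaining ones, to which induction applies. *)
Lemma glue_clusters (K : nat) (e d M : R) (A : {poly C}) s :
  0 <= e -> 0 < d -> d <= 1 -> e + e < d -> 0 <= M ->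
  (size s <= K)%N -> {in s, forall l, abs l <= 1} ->
  {in s &, forall x y, abs (x - y) <= e \/ d <= abs (x - y)} ->
  (forall l c, l \in s -> {subset c <= s} -> (size c <= K)%N ->
     {in c, forall x, abs (x - l) <= e} ->
     exists F, node_poly c %| A - F /\ wnorm w F <= M) ->
  exists F, node_poly s %| A - F /\ wnorm w F <= crt_const K d ^+ size s * M.
Proof.
move=> e0 d0 d1 ed M0.
have B1 := crt_const_ge1 K d0; have B0 := le_trans ler01 B1.
have [N] := ubnP (size s); elim: N s => // N IH [|l s0] sN sK hs hsep hc.
  by exists 0; rewrite /node_poly big_nil dvd1p wnorm0 mul1r.
set s := l :: s0 in sN sK hs hsep hc *.
have ls : l \in s by rewrite mem_head.
pose c := [seq x <- s | abs (x - l) <= e].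
pose t := [seq x <- s | ~~ (abs (x - l) <= e)].
have cs x : x \in c -> x \in s /\ abs (x - l) <= e by rewrite mem_filter => /andP[].
have ts x : x \in t -> x \in s /\ d <= abs (x - l).
  rewrite mem_filter => /andP[h xs]; split => //.
  by case: (hsep x l xs ls) => // h2; rewrite h2 in h.
have cK : (size c <= K)%N by rewrite size_filter (leq_trans (count_size _ _)).
have tlt : (size t < size s)%N.
  by rewrite size_filter /= subrr abs0 e0/= add0n ltnS count_size.
have tK : (size t <= K)%N by rewrite (leq_trans (ltnW tlt)).
have K0 : (0 < K)%N by rewrite (leq_trans _ sK).
have pE : node_poly s = node_poly t * node_poly c.
  by rewrite /node_poly !big_filter mulrC [LHS](bigID (fun x => abs (x - l) <= e)).
have [|x xt|x y xt yt|l' c' l't c't|F1 [F1d F1n]] := IH t _ tK.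
- by rewrite (leq_trans tlt)// -ltnS.
- by apply: hs; case: (ts x xt).
- by apply: hsep; [case: (ts x xt)|case: (ts y yt)].
- apply: hc; first by case: (ts _ l't).
  by move=> x /c't /ts[].
have [Fc [Fcd Fcn]] : exists F, node_poly c %| A - F /\ wnorm w F <= M.
  by apply: (hc l c) => // x /cs[].
have tc : {in t & c, forall x y, d <= abs (x - y)}.
  move=> x y /ts[xs xl] /cs[ys yl]; case: (hsep x y xs ys) => // h.
  have : abs (x - l) <= abs (x - y) + abs (y - l).
    by rewrite (le_trans _ (le_normcD _ _))// addrA subrK.
  by move: xl yl h ed; set n1 := normc _; set n2 := normc _; set n3 := normc _; lra.
have [b [bd bn]] : exists b, node_poly c %| 1 - node_poly t * b /\
    wnorm w b <= (K%:R * W ^+ K * d^-1 ^+ K) ^+ size t.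
  by apply: node_poly_bezout => // x; [case/cs => /hs|case/ts => /hs].
exists (F1 + node_poly t * b * (Fc - F1)); split.
  rewrite pE Gauss_dvdp; last first.
    have /dvdpP[v vE] := bd.
    apply/Bezout_eq1_coprimepP; exists (b, v) => /=.
    by rewrite -vE [b * _]mulrC addrC subrK.
  rewrite opprD addrA; apply/andP; split.
    by rewrite dvdp_sub// -mulrA dvdp_mulr.
  have -> : A - F1 - node_poly t * b * (Fc - F1) =
    (A - Fc) + (1 - node_poly t * b) * (Fc - F1) by ring.
  by rewrite dvdp_add// dvdp_mulr.
set B := crt_const K d in B1 B0 F1n *.
have Bt : 1 <= B ^+ size t by rewrite exprn_ege1.
have Dd : 1 <= d^-1 by rewrite invf_ge1.
apply: (@le_trans _ _ (B ^+ (size t).+1 * M)); last first.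
  by rewrite ler_wpM2r// ler_weXn2l.
set Y := B ^+ size t * M in F1n *.
have MY : M <= Y by rewrite /Y ler_peMl.
have Y0 : 0 <= Y by rewrite (le_trans M0).
set Z := W ^+ K * (K%:R * W ^+ K * d^-1 ^+ K) ^+ K.
have hZ : wnorm w (node_poly t * b) <= Z.
  rewrite (le_trans (wnormM _ _ _))// ler_pM//.
    apply: le_trans (wnorm_node_poly _) _; first by move=> x /ts[/hs].
    by rewrite ler_weXn2l.
  rewrite (le_trans bn)// ler_weXn2l// mulr_ege1 ?exprn_ege1//.
  by rewrite mulr_ege1 ?exprn_ege1// ler1n.
have Z0 : 0 <= Z by rewrite (le_trans _ hZ).
rewrite exprS.
have -> : B * B ^+ size t * M = Y + 2 * Y * Z by rewrite /Y {1}/B /crt_const -/Z; ring.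
rewrite (le_trans (wnormD _ _ _))// lerD//.
rewrite (le_trans (wnormM _ _ _))// mulrC ler_pM//.
rewrite (le_trans (wnormB _ _ _))//; move: Fcn F1n MY.
by set n1 := wnorm _ _; set n2 := wnorm _ _; lra.
Qed.

End NodePolynomials.

(** * Scales at which powers of x have small remainders *)

Lemma geometric_small (R : realType) (rho x : R) : 0 <= rho -> rho < 1 -> 0 < x ->
  exists N0, forall N, (N0 <= N)%N -> rho ^+ N <= x.
Proof.
move=> r0 r1 x0.
have h : (fun N => rho ^+ N) @ \oo --> (0 : R) by apply: cvg_expr; rewrite ger0_norm.
have /cvgrPdist_le/(_ _ x0)[N0 _ H] := h.
exists N0 => N NN; have := H N NN; rewrite /= sub0r normrN ger0_norm// exprn_ge0//.
Qed.

Lemma bernoulli_inequality (R : realFieldType) (x : R) n : 0 <= 1 + x ->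
  1 + n%:R * x <= (1 + x) ^+ n.
Proof.
move=> x1; elim: n => [|n IH]; first by rewrite mul0r addr0 expr0.
rewrite exprS (le_trans _ (ler_wpM2l x1 IH))// -natr1 -subr_ge0.
have -> : (1 + x) * (1 + n%:R * x) - (1 + (n%:R + 1) * x) = n%:R * x ^+ 2 by ring.
by rewrite mulr_ge0// sqr_ge0.
Qed.

Section Scales.
Variables (R : realType) (w : weight R).
Local Notation C := R[i].
Local Notation abs := (@normc R).
Local Notation W := (1 + w 1).

(** Stretching the argument by [m] costs a factor [o(m)], uniformly in [n], as for
[n^b] with [b < 1].  This is what the coefficients [O(1/m)] of the [m]-th root
compensate. *)
Definition sublinear_weight := forall (K : nat) (eta : R), 0 < eta ->
  exists2 m, (0 < m)%N & forall n, (0 < n)%N -> w (n * m * K)%N <= eta * m%:R * w n.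

Definition unbounded_weight := forall A : R, exists n0, forall n, (n0 <= n)%N -> A <= w n.

(** A remainder modulo [(x - l)^K] is adjusted to nodes within [e] of [l]; the change
is at most [1] if [e] is small in terms of the quotient [g]. *)
Lemma tight_cluster (K n : nat) (e Q G : R) (l : C) c (q g : {poly C}) :
  (size c <= K)%N -> 0 <= e -> abs l <= 1 -> {in c, forall x, abs x <= 1} ->
  {in c, forall x, abs (x - l) <= e} ->
  'X^n = q + ('X - l%:P) ^+ K * g -> wnorm w q <= Q -> wnorm w g <= G ->
  K%:R * e * W ^+ K * G <= 1 ->
  exists F, node_poly c %| 'X^n - F /\ wnorm w F <= Q + 1.
Proof.
move=> cK e0 hl hc he XE hq hg small.
(* the list is completed by copies of the centre to exactly [K] nodes *)
pose c' := c ++ nseq (K - size c) l.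
have sc' : size c' = K by rewrite size_cat size_nseq subnKC.
have hc' : {in c', forall x, abs x <= 1}.
  move=> x; rewrite mem_cat mem_nseq => /orP[/hc//|/andP[_ /eqP->]//].
have he' : {in c', forall x, abs (x - l) <= e}.
  move=> x; rewrite mem_cat mem_nseq => /orP[/he//|/andP[_ /eqP->]//].
  by rewrite subrr abs0.
exists (q + (('X - l%:P) ^+ K - node_poly c') * g); split.
  apply: (@dvdp_trans _ (node_poly c')).
    by rewrite /node_poly /c' big_cat/= dvdp_mulr.
  have -> : 'X^n - (q + (('X - l%:P) ^+ K - node_poly c') * g) = node_poly c' * g.
    by rewrite XE; ring.
  by rewrite dvdp_mulr.
rewrite (le_trans (wnormD _ _ _))// lerD// (le_trans (wnormM _ _ _))//.
rewrite (le_trans _ small)// ler_pM//.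
by have := node_poly_close w hl hc' he'; rewrite sc'.
Qed.

Hypothesis wsub : sublinear_weight.
Hypothesis wunb : unbounded_weight.

(** The parameters are chosen in the order [m], [n], [e]: the degree [m] of the root
makes the remainder of [near_cluster] at most [eta' w n / 4 + 1], [n] is
then large enough for [far_cluster] and for constants to be absorbed in [w n], and [e]
is small in terms of the quotients that occur for this [n].  All is done for
[eta' = eta / B'], where [B'] is the cost of gluing the clusters. *)
Lemma small_remainder_at_scale (K n0 : nat) (d eta : R) :
  (0 < K)%N -> 0 < d -> d <= 1 -> 0 < eta ->
  exists n e, [/\ (n0 <= n)%N, 0 < e, e < d &
  forall s : seq C, (size s <= K)%N -> {in s, forall l, abs l <= 1} ->
    {in s, forall l, 1 - abs l <= e \/ d <= 1 - abs l} ->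
    {in s &, forall x y, abs (x - y) <= e \/ d <= abs (x - y)} ->
    exists F, node_poly s %| 'X^n - F /\ wnorm w F <= eta * w n].
Proof.
move=> K0 d0 d1 eta0.
have B1 := crt_const_ge1 w K d0; set B := crt_const w K d in B1.
pose B' := B ^+ K; have B'1 : 1 <= B' by rewrite exprn_ege1.
have B'0 : 0 < B' by rewrite (lt_le_trans ltr01).
pose eta' := eta / B'; have eta'0 : 0 < eta' by rewrite divr_gt0.
have eta4 : 0 < eta' / 4 by rewrite divr_gt0.
have [m m0 hm] : exists2 m, (0 < m)%N &
    forall n, (0 < n)%N -> K%:R * (3 ^+ K / m%:R * w (n * m * K)%N) <= eta' / 4 * w n.
  have c0 : 0 < K%:R * 3 ^+ K :> R by rewrite mulr_gt0 ?ltr0n// exprn_gt0.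
  have [m m0 hm] := wsub K (divr_gt0 eta4 c0).
  exists m => // n n0'; have mR : 0 < m%:R :> R by rewrite ltr0n.
  have := hm n n0'; rewrite -(ler_pM2l (divr_gt0 c0 mR)).
  have -> : K%:R * 3 ^+ K / m%:R * (eta' / 4 / (K%:R * 3 ^+ K) * m%:R * w n) = eta' / 4 * w n.
    by field; rewrite !gt_eqF// ?exprn_gt0// ?ltr0n.
  by rewrite !mulrA.
have [D [G hDG]] := near_cluster w K m0.
have r0 : 0 <= 1 - d by rewrite subr_ge0.
have r1 : 1 - d < 1 by rewrite gtrBl.
have [N1 hN1] := geometric_small r0 r1 (divr_gt0 eta4 (exprn_gt0 K (ltr0n R 2))).
have [N2 hN2] := wunb (8 / eta').
pose N := (n0 + N1 + N2).+1; pose n := (N * K)%N.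
have Nn : (N <= n)%N by rewrite leq_pmulr.
have n_gt0 : (0 < n)%N by rewrite (leq_trans _ Nn).
have wn : 8 / eta' <= w n by apply: hN2; apply: leq_trans Nn; rewrite /N; lia.
have hN : 2 ^+ K * (1 - d) ^+ N <= eta' / 4.
  rewrite mulrC -ler_pdivlMr ?exprn_gt0//; apply: hN1; rewrite /N; lia.
pose G' := 1 + `|G n| + (N%:R * w N) ^+ K.
have P0 : 0 <= (N%:R * w N) ^+ K by rewrite exprn_ge0// mulr_ge0.
have G'1 : 1 <= G' by rewrite /G' -addrA lerDl addr_ge0.
have KW : 1 <= K%:R * W ^+ K * G'.
  by rewrite !mulr_ege1// ?ler1n// exprn_ege1// W_ge1.
pose Dn := (D n).*2.+2.
pose e := Num.min (d / 3) (Num.min (Dn%:R^-1) (K%:R * W ^+ K * G')^-1).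
have Dn0 : 0 < Dn%:R :> R by rewrite ltr0n.
have e_gt0 : 0 < e by rewrite !lt_min divr_gt0//= !invr_gt0 Dn0 (lt_le_trans ltr01).
have e0 := ltW e_gt0.
have ed3 : e <= d / 3 by rewrite ge_min lexx.
have eD : e * Dn%:R <= 1.
  by rewrite -ler_pdivlMr// div1r ge_min ge_min lexx /= orbT.
have eG : K%:R * e * W ^+ K * G' <= 1.
  have -> : K%:R * e * W ^+ K * G' = e * (K%:R * W ^+ K * G') by ring.
  by rewrite -ler_pdivlMr ?(lt_le_trans ltr01)// div1r !ge_min lexx !orbT.
have e1 : e <= 1 by move: ed3 d1; lra.
have ed : e + e < d by move: ed3 d0; lra.
have n0n : (n0 <= n)%N by apply: leq_trans Nn; rewrite leqW// -addnA leq_addr.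
have nE : n = (N * K)%N by [].
have eltd : e < d by move: ed e_gt0; lra.
have GG : `|G n| <= G' by rewrite /G' addrAC lerDr addr_ge0.
have GP : (N%:R * w N) ^+ K <= G' by rewrite /G' lerDr addr_ge0.
have DnE : e * (2 * (D n)%:R) <= 1.
  by apply: le_trans eD; rewrite ler_wpM2l// -natrM ler_nat /Dn -mul2n leqW// leqW.
have BE : B' * eta' = eta by rewrite /eta' mulrC divfK// gt_eqF.
have BB j : (j <= K)%N -> crt_const w K d ^+ j <= B' by move=> jK; rewrite /B' ler_weXn2l.
clearbody e n N G' B B' eta'.
exists n, e; split; [exact: n0n|exact: e_gt0|exact: eltd|].
move=> s sK hs hwin hsep.
have M0 : 0 <= eta' * w n by rewrite mulr_ge0// ltW.
have [] := @glue_clusters R w K e d (eta' * w n) 'X^n s; try by [].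
  move=> l c ls cs cK ce.
  have hc : {in c, forall x, abs x <= 1} by move=> x /cs /hs.
  have hl := hs l ls.
  have W8 : 2 <= eta' / 4 * w n.
    by move: wn; rewrite ler_pdivrMr//; move: (w n) => x; lra.
  case: (hwin l ls) => hl2.
    have [|q [g [XE hq hg]]] := hDG n l n_gt0 hl.
      have le1 : 1 - e <= abs l by move: hl2; set a := normc l; lra.
      rewrite (@le_trans _ _ ((1 - e) ^+ D n))//; last first.
        by rewrite lerXn2r// nnegrE// subr_ge0.
      have e1' : 0 <= 1 - e by rewrite subr_ge0.
      rewrite (le_trans _ (bernoulli_inequality _ e1'))// mulrN.
      by move: DnE; set x := (D n)%:R; lra.
    have [|F [Fd Fn]] := tight_cluster cK e0 hl hc ce XE hq hg.
      apply: le_trans eG; rewrite ler_wpM2l// ?mulr_ge0// ?exprn_ge0// ?W_ge0//.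
      by rewrite (le_trans (ler_norm _)).
    exists F; split => //; apply: le_trans Fn _.
    by have := hm n n_gt0; move: W8; set x := K%:R * _; lra.
  have hl3 : abs l <= 1 - d by move: hl2; set a := normc l; lra.
  have [q [g [XE hq hg]]] := far_cluster w N K0 hl3 (ltW r1).
  rewrite -nE in XE hq.
  have [|F [Fd Fn]] := tight_cluster cK e0 hl hc ce XE hq hg.
    by apply: le_trans eG; rewrite ler_wpM2l// ?mulr_ge0// ?exprn_ge0// ?W_ge0.
  exists F; split => //; apply: le_trans Fn _.
  have : 2 ^+ K * (1 - d) ^+ N * w n <= eta' / 4 * w n by rewrite ler_wpM2r.
  by move: W8; set x := 2 ^+ K * _ * _; lra.
move=> F [Fd Fn]; exists F; split => //; apply: le_trans Fn _.
rewrite (@le_trans _ _ (B' * (eta' * w n)))//.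
  by rewrite ler_wpM2r// (BB _ sK).
by rewrite mulrA BE.
Qed.

(** Each scale is chosen with the lower end of the previous window as its upper end,
so the windows [(d j.+1, d j)] are disjoint. *)
Lemma scale_sequence (K : nat) (eta : R) : 0 < eta ->
  exists (n : nat -> nat) (d : nat -> R), [/\ forall j, (n j < n j.+1)%N,
    forall j, d j.+1 < d j &
    forall j (s : seq C), (size s <= K)%N -> {in s, forall l, abs l <= 1} ->
      {in s, forall l, ~~ (d j.+1 < 1 - abs l < d j)} ->
      {in s &, forall x y, ~~ (d j.+1 < abs (x - y) < d j)} ->
      exists F, node_poly s %| 'X^(n j) - F /\ wnorm w F <= eta * w (n j)].
Proof.
move=> eta0.
have step (p : nat * R) : exists q : nat * R, 0 < p.2 <= 1 ->
    [/\ (p.1 <= q.1)%N, 0 < q.2, q.2 < p.2 &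
     forall s : seq C, (size s <= K.+1)%N -> {in s, forall l, abs l <= 1} ->
      {in s, forall l, 1 - abs l <= q.2 \/ p.2 <= 1 - abs l} ->
      {in s &, forall x y, abs (x - y) <= q.2 \/ p.2 <= abs (x - y)} ->
      exists F, node_poly s %| 'X^(q.1) - F /\ wnorm w F <= eta * w q.1].
  have [/andP[d0 d1]|h] := boolP (0 < p.2 <= 1); last by exists p.
  have [n [e [h1 h2 h3 h4]]] := small_remainder_at_scale p.1 (ltn0Sn K) d0 d1 eta0.
  by exists (n, e) => _; split.
have [f hf] := boolp.choice step.
pose st j := iter j (fun p => ((f p).1.+1, (f p).2)) (0%N, 1 : R).
have st_ok j : 0 < (st j).2 <= 1.
  elim: j => [|j IH]; first by rewrite /= ltr01 lexx.
  have [_ h1 h2 _] := hf _ IH; rewrite /= h1 /= (le_trans (ltW h2))//.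
  by case/andP: IH.
exists (fun j => (f (st j)).1), (fun j => (st j).2); split.
- by move=> j; have [h _ _ _] := hf _ (st_ok j.+1).
- by move=> j; have [_ _ h _] := hf _ (st_ok j).
move=> j s sK hs h1 h2; have [_ _ _ h] := hf _ (st_ok j).
apply: h => //; first exact: leqW.
  move=> l ls; have := h1 l ls; rewrite negb_and -!leNgt => /orP[]; [left|right] => //.
by move=> x y xs ys; have := h2 x y xs ys; rewrite negb_and -!leNgt => /orP[]; [left|right].
Qed.

End Scales.

Lemma window_count (R : realType) (d : nat -> R) (D : seq R) N : (forall j, d j.+1 < d j) ->
  (\sum_(j < N) has (fun x : R => d j.+1 < x < d j)%R D <= size D)%N.
Proof.
move=> dd.
have one x n : (\sum_(j < n) (d j.+1 < x < d j)%R <= (d n < x)%R)%N.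
  elim: n => [|n IH]; first by rewrite big_ord0.
  rewrite big_ord_recr/=; have [h|h] := ltP (d n) x.
    rewrite h in IH; rewrite (lt_trans (dd n) h)/= ltNge (ltW h)/= addn0.
    exact: IH.
  move: IH; rewrite ltNge h /= leqn0 => /eqP ->; rewrite add0n.
  by case: (d n.+1 < x); rewrite // leq_b1.
apply: (@leq_trans (\sum_(j < N) \sum_(x <- D) (d j.+1 < x < d j)%R)%N).
  apply: leq_sum => j _; elim: D => [|x D IH]; first by rewrite big_nil.
  rewrite big_cons/=; case: (d j.+1 < x < d j)%R => /=; first by rewrite add1n.
  by rewrite add0n.
rewrite exchange_big/= -sum1_size; apply: leq_sum => x _.
by rewrite (leq_trans (one x N))// leq_b1.
Qed.

(** * Power bounded matrices *)

Section Matrices.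
Variables (R : realType) (w : weight R).
Local Notation C := R[i].
Local Notation abs := (@normc R).
Hypothesis wsub : sublinear_weight w.

(** Iterating sublinearity along the powers of a fixed [m] gives
[w (m^k) <= (m/2)^k w 1], whereas [x > 1] would force [w (m^k)] to grow at least
like [m^k]. *)
Lemma weight_subexponential (x c : R) :
  (forall n, x ^+ n <= c * w n) -> x <= 1.
Proof.
move=> h; rewrite leNgt; apply/negP => x1.
have y0 : 0 < x - 1 by rewrite subr_gt0.
have [m m0 hm] := wsub 1 (divr_gt0 ltr01 (ltr0n R 2)).
have mk k : w (m ^ k)%N <= (2^-1 * m%:R) ^+ k * w 1.
  elim: k => [|k IH]; first by rewrite expn0 expr0 mul1r.
  have := hm (m ^ k)%N; rewrite expn_gt0 m0 muln1 -expnSr => /(_ isT) h2.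
  by rewrite (le_trans h2)// div1r exprS -[leRHS]mulrA ler_wpM2l// mulr_ge0// invr_ge0.
have mR : 0 < m%:R :> R by rewrite ltr0n.
have key k : (x - 1) * 2 ^+ k <= c * w 1.
  have c0 : 0 <= c by have := h 0%N; rewrite weight0 mulr1 expr0; lra.
  have x0 : 0 <= 1 + (x - 1) by rewrite addrC subrK ltW// (lt_trans ltr01).
  have := le_trans (bernoulli_inequality (m ^ k) x0) _.
  rewrite addrC subrK => /(_ _ (h _)) h3.
  have h4 : (x - 1) * m%:R ^+ k <= c * ((2^-1 * m%:R) ^+ k * w 1).
    rewrite (le_trans _ (ler_wpM2l c0 (mk k)))// (le_trans _ h3)// natrX mulrC.
    by rewrite ler_wpDl.
  rewrite -(ler_pM2r (exprn_gt0 k (divr_gt0 mR (ltr0n R 2)))).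
  apply: le_trans (le_trans h4 _).
    by rewrite -mulrA -exprMn mulrCA divff ?mulr1// gt_eqF.
  by rewrite mulrA mulrAC [2^-1 * _]mulrC.
have := key (Num.truncn (c * w 1 / (x - 1))).+1.
apply/negP; rewrite -ltNge -ltr_pdivrMl// [_^-1 * _]mulrC (lt_trans (truncnS_gt _))//.
by rewrite -(natrX R 2) ltr_nat ltn_expl.
Qed.

Variables (k K : nat) (T : 'M[C]_k.+1) (A : R).
Hypothesis kK : (k < K)%N.
Hypothesis hT : forall n i j, abs ((T ^+ n) i j) <= A * w n.

Lemma spectrum_in_disc (l : C) : root (char_poly T) l -> abs l <= 1.
Proof.
rewrite -eigenvalue_root_char => /eigenvalueP[v vT v0].
have [j vj] : exists j, v 0 j != 0.
  apply/existsP; apply: contraNT v0 => /existsPn h; apply/eqP/rowP => j.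
  by rewrite mxE; apply/eqP; have := h j; rewrite negbK.
have vTn n : v *m T ^+ n = l ^+ n *: v.
  elim: n => [|n IH]; first by rewrite !expr0 mulmx1 scale1r.
  by rewrite exprSr mulmxA IH -scalemxAl vT scalerA -exprSr.
have vj0 : 0 < abs (v 0 j) by rewrite abs_gt0.
apply: (@weight_subexponential _ (A * (\sum_i abs (v 0 i)) / abs (v 0 j))) => n.
rewrite mulrAC ler_pdivlMr// -absX -normcM.
have -> : l ^+ n * v 0 j = \sum_i v 0 i * (T ^+ n) i j.
  by have := congr1 (fun M : 'rV_k.+1 => M 0 j) (vTn n); rewrite !mxE.
rewrite (le_trans (abs_sum _ _ _))// mulrAC mulrC mulr_suml; apply: ler_sum => i _.
by rewrite normcM ler_wpM2l.
Qed.

Lemma char_poly_nodes : exists s : seq C, [/\ char_poly T = node_poly s,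
  size s = k.+1 & {in s, forall l, abs l <= 1}].
Proof.
have [s sE] := closed_field_poly_normal (char_poly T).
rewrite (monicP (char_poly_monic T)) scale1r in sE.
exists s; split => //.
  have := size_char_poly T; rewrite sE size_prod_XsubC => -[]//.
by move=> l ls; apply: spectrum_in_disc; rewrite sE root_prod_XsubC.
Qed.

Lemma entry_horner_bound (F : {poly C}) i j :
  abs ((horner_mx T F) i j) <= A * wnorm w F.
Proof.
have -> : horner_mx T F = \sum_(l < size F) F`_l *: T ^+ l.
  rewrite -{1}[F]coefK poly_def rmorph_sum; apply: eq_bigr => l _.
  by rewrite /= horner_mxZ rmorphXn/= horner_mx_X.
rewrite summxE (le_trans (abs_sum _ _ _))// /wnorm mulr_sumr; apply: ler_sum => l _.
by rewrite mxE normcM mulrCA ler_wpM2l.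
Qed.

(** The characteristic polynomial has [K] nodes at most, hence [K + K^2] distances.
At a scale whose window contains one of them the trivial bound [A] is used, at the
others the remainder of small norm; a distance lies in at most one window. *)
Lemma power_sum_bound (eta : R) n d : 0 < eta ->
  (forall j, d j.+1 < d j) ->
  (forall j (s : seq C), (size s <= K)%N -> {in s, forall l, abs l <= 1} ->
      {in s, forall l, ~~ (d j.+1 < 1 - abs l < d j)} ->
      {in s &, forall x y, ~~ (d j.+1 < abs (x - y) < d j)} ->
      exists F, node_poly s %| 'X^(n j) - F /\ wnorm w F <= eta * w (n j)) ->
  forall N i j, \sum_(l < N) abs ((T ^+ n l) i j) / w (n l) <=
    A * (N%:R * eta + (K + K * K)%:R).
Proof.
move=> eta0 dd hd N i j.
have [s [sE sk hs]] := char_poly_nodes.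
pose D := [seq 1 - abs l | l <- s] ++ [seq abs (x - y) | x <- s, y <- s].
have DK : (size D <= K + K * K)%N.
  by rewrite size_cat size_map size_allpairs sk leq_add// leq_mul.
have A0 : 0 <= A by have := hT 0 0 0; rewrite weight0 mulr1; apply: le_trans.
have wp l : 0 < w l by rewrite (lt_le_trans ltr01)// w_ge1.
have term l : abs ((T ^+ n l) i j) / w (n l) <=
    A * (eta + (has (fun x => d l.+1 < x < d l) D)%:R).
  rewrite ler_pdivrMr//; have [hb|hb] := boolP (has _ D).
    rewrite (le_trans (hT _ _ _))// ler_wpM2r// ler_peMr//= mulr1n.
    by rewrite lerDr ltW.
  rewrite addr0 -mulrA.
  have sK : (size s <= K)%N by rewrite sk.
  have [||F [Fd Fn]] := hd l s sK hs.
  - move=> z zs; apply: contra hb => h; apply/hasP; exists (1 - abs z) => //.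
    by rewrite mem_cat; apply/orP; left; apply/mapP; exists z.
  - move=> x y xs ys; apply: contra hb => h; apply/hasP; exists (abs (x - y)) => //.
    by rewrite mem_cat; apply/orP; right; apply/allpairsP; exists (x, y).
  have -> : T ^+ n l = horner_mx T F.
    apply/eqP; rewrite -subr_eq0; apply/eqP.
    have /dvdpP[g gE] := Fd.
    transitivity (horner_mx T ('X^(n l) - F)).
      by rewrite rmorphB rmorphXn/= horner_mx_X.
    by rewrite gE -sE rmorphM/= Cayley_Hamilton mulr0.
  by rewrite (le_trans (entry_horner_bound _ _ _))// ler_wpM2l.
apply: (@le_trans _ _ (\sum_(l < N) A * (eta + (has (fun x => d l.+1 < x < d l) D)%:R))).
  by apply: ler_sum => l _; apply: term.
rewrite -mulr_sumr ler_wpM2l// big_split/= sumr_const card_ord -[eta *+ N]mulr_natl lerD2l.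
by rewrite -natr_sum ler_nat (leq_trans (window_count _ _ dd)).
Qed.

End Matrices.

(** * Hilbert spaces *)

Section Hilbert.
Variables (R : realType) (E : completeNormedModType R[i]).
Variable dot : {dot E for Num.conj}.
Hypothesis dotE : forall f : E, `|f| ^+ 2 = dot f f.
Local Notation C := R[i].
Local Notation abs := (@normc R).
Local Notation cj := (@conjc R).
Implicit Types u v h : E.

(** The norm as a real number; the norm of the space takes nonnegative complex
values. *)
Definition hnorm (u : E) : R := complex.Re `|u|.

Lemma hnormE u : `|u| = (hnorm u)%:C.
Proof. by rewrite /hnorm RRe_real// ger0_real. Qed.

Lemma hnorm_ge0 u : 0 <= hnorm u.
Proof. by rewrite -ler0c -hnormE. Qed.
#[local] Hint Extern 0 (is_true (0 <= hnorm _)) => exact: hnorm_ge0 : core.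

Lemma hnormD u v : hnorm (u + v) <= hnorm u + hnorm v.
Proof. by rewrite -lecR rcD -!hnormE ler_normD. Qed.

Lemma hnormZ (a : C) u : hnorm (a *: u) = abs a * hnorm u.
Proof. by apply: (@complexI R); rewrite rcM -!hnormE normrZ. Qed.

Lemma hnormN u : hnorm (- u) = hnorm u.
Proof. by rewrite /hnorm normrN. Qed.

Lemma hnorm0 : hnorm 0 = 0. Proof. by rewrite /hnorm normr0. Qed.

Lemma hnorm_eq0 u : hnorm u = 0 -> u = 0.
Proof. by move=> h; apply/eqP; rewrite -normr_eq0 hnormE h. Qed.

Lemma dot_hnorm u : dot u u = (hnorm u ^+ 2)%:C.
Proof. by rewrite -dotE hnormE rcX. Qed.

Lemma dotC u v : dot u v = cj (dot v u).
Proof. by rewrite hermC expr0 mul1r. Qed.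

Lemma dotPl (a : C) u v h : dot (a *: u + v) h = a * dot u h + dot v h.
Proof. by rewrite linearPl. Qed.

Lemma dotZl (a : C) u h : dot (a *: u) h = a * dot u h.
Proof. by rewrite linearZl_LR. Qed.

Lemma dotZr (a : C) u h : dot u (a *: h) = cj a * dot u h.
Proof. by rewrite [LHS]dotC dotZl cjM -dotC. Qed.

Lemma hnorm_sqrD u v :
  hnorm (u + v) ^+ 2 = hnorm u ^+ 2 + hnorm v ^+ 2 + 2 * complex.Re (dot u v).
Proof.
apply: (@complexI R); rewrite -dot_hnorm dnormD !dot_hnorm.
by rewrite -[Num.conj _]/(conjc _) addcJ !rcD rcM rc_nat.
Qed.

Lemma hnorm_sqrB u v :
  hnorm (u - v) ^+ 2 = hnorm u ^+ 2 + hnorm v ^+ 2 - 2 * complex.Re (dot u v).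
Proof. by rewrite hnorm_sqrD hnormN linearNr cReN mulrN. Qed.

Lemma cauchy_schwarz u v : abs (dot u v) <= hnorm u * hnorm v.
Proof.
have [v0|v0] := eqVneq (hnorm v) 0.
  by rewrite (hnorm_eq0 v0) linear0r abs0 mulr_ge0.
set d := dot u v; set q := hnorm v ^+ 2.
have q0 : 0 < q by rewrite exprn_even_gt0.
have := sqr_ge0 (hnorm (u - (d / q%:C) *: v)).
rewrite hnorm_sqrB hnormZ dotZr -/d.
have -> : abs (d / q%:C) = abs d / q.
  by rewrite normcM normcV abs_real ger0_norm// ltW.
have -> : complex.Re (cj (d / q%:C) * d) = abs d ^+ 2 / q.
  rewrite cjM -rcV conjc_real mulrAC [cj _ * _]mulrC mul_conj.
  by rewrite -rcM.
have -> : (abs d / q * hnorm v) ^+ 2 = abs d ^+ 2 / q.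
  by rewrite exprMn -/q; field; rewrite gt_eqF.
rewrite -addrA => h.
have : abs d ^+ 2 / q <= hnorm u ^+ 2 by move: h; lra.
rewrite ler_pdivrMr// -exprMn => h2.
by rewrite -(ler_pXn2r (n := 2))// nnegrE// mulr_ge0.
Qed.

Lemma hnorm_complete (u : nat -> E) :
  (forall e : R, 0 < e -> exists N, forall m n, (N <= m)%N -> (N <= n)%N ->
     hnorm (u m - u n) < e) ->
  exists h, forall e : R, 0 < e -> exists N, forall n, (N <= n)%N ->
     hnorm (h - u n) <= e.
Proof.
move=> hc.
have cu : cvgn u.
  apply: cauchy_cvg; apply/cauchy_ballP => eps eps0.
  have er : eps \is Num.real by rewrite gtr0_real.
  have eR : 0 < complex.Re eps by rewrite -ltcR RRe_real.
  have [N hN] := hc _ eR.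
  pose U := [set x | exists2 n, (N <= n)%N & x = u n].
  exists (U, U); first by split; exists N => // n nN; exists n.
  move=> [_ _] [/= [m hm ->] [n hn ->]]; rewrite -ball_normE /ball_ /= hnormE -(RRe_real er) ltcR.
  exact: hN.
exists (limn u) => e e0.
have e0' : 0 < e%:C by rewrite ltcR.
have /cvgrPdist_le/(_ _ e0')[N _ hN] := cu.
by exists N => n nN; rewrite -lecR -hnormE; apply: hN.
Qed.

(** Riesz representation for a functional given by its graph [S].  A sequence
minimising [|u|^2 - 2 Re l] over [S] is Cauchy by the parallelogram identity, and
the first variation at its limit [h] vanishes.  The bound makes the linear relation [S]
single-valued, so a functional given on combinations of vectors need not be shown to
be well defined. *)
Lemma riesz_graph (S : E -> C -> Prop) (c : R) : 0 <= c -> S 0 0 ->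
  (forall a u v lu lv, S u lu -> S v lv -> S (a *: u + v) (a * lu + lv)) ->
  (forall u l, S u l -> abs l <= c * hnorm u) ->
  exists h, (forall u l, S u l -> dot u h = l) /\ hnorm h <= c.
Proof.
move=> c0 S0 SL Sb.
pose J u (l : C) := hnorm u ^+ 2 - 2 * complex.Re l.
pose A := [set r : R | exists u l, S u l /\ r = J u l].
have A_lb : lbound A (- c ^+ 2).
  move=> r [u [l [Sul ->]]]; rewrite /J.
  have h1 := Sb u l Sul; have h2 := Re_le_abs l.
  have : 0 <= (hnorm u - c) ^+ 2 by rewrite sqr_ge0.
  have -> : (hnorm u - c) ^+ 2 = hnorm u ^+ 2 + c ^+ 2 - 2 * (c * hnorm u) by ring.
  by move: h1 h2; set x := c * _; set y := normc l; lra.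
have A_inf : has_inf A.
  by split; [exists (J 0 0), 0, 0|exists (- c ^+ 2)].
have inf_le u l : S u l -> inf A <= J u l.
  by move=> Sul; apply: ge_inf; [exists (- c ^+ 2)|exists u, l].
have near_inf (n : nat) : exists p : E * C,
    S p.1 p.2 /\ J p.1 p.2 < inf A + n.+1%:R^-1.
  have n0 : 0 < n.+1%:R^-1 :> R by rewrite invr_gt0.
  have [r [u [l [Sul ->]]] hr] := inf_adherent n0 A_inf.
  by exists (u, l).
have [p hp] := boolp.choice near_inf.
pose u n := (p n).1; pose l n := (p n).2.
have Su n : S (u n) (l n) by case: (hp n).
have Ju n : J (u n) (l n) < inf A + n.+1%:R^-1 by case: (hp n).
have dist m n : hnorm (u m - u n) ^+ 2 <= 2 * (m.+1%:R^-1 + n.+1%:R^-1).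
  have := inf_le _ _ (SL 2^-1 _ _ _ _ (SL 1 _ _ _ _ (Su m) (Su n)) S0).
  rewrite scale1r mul1r !addr0 /J hnormZ exprMn.
  have -> : abs 2^-1 = 2^-1 :> R.
    have -> : (2^-1 : C) = (2^-1 : R)%:C by rewrite rcV rc_nat.
    by rewrite abs_real ger0_norm// invr_ge0.
  have -> : complex.Re (2^-1 * (l m + l n)) = 2^-1 * (complex.Re (l m) + complex.Re (l n)).
    have -> : (2^-1 : C) = (2^-1 : R)%:C by rewrite rcV rc_nat.
    by rewrite cReMr cReD.
  have := Ju m; have := Ju n; rewrite /J hnorm_sqrB hnorm_sqrD.
  set x := hnorm (u m) ^+ 2; set y := hnorm (u n) ^+ 2; set z := complex.Re (dot _ _).
  set a := complex.Re (l m); set b := complex.Re (l n); set i := inf A.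
  set e1 := m.+1%:R^-1; set e2 := n.+1%:R^-1.
  have -> : 2^-1 ^+ 2 = 4^-1 :> R by rewrite exprVn; congr _^-1; rewrite -natrX.
  lra.
have inv_small (e : R) : 0 < e -> exists N, forall n, (N <= n)%N -> n.+1%:R^-1 < e.
  move=> e0; exists (Num.truncn e^-1) => n nN.
  rewrite -[ltRHS]invrK ltf_pV2 ?posrE ?invr_gt0// (lt_le_trans (truncnS_gt _))//.
  by rewrite ler_nat ltnS.
have [h hh] : exists h, forall e : R, 0 < e -> exists N, forall n, (N <= n)%N ->
     hnorm (h - u n) <= e.
  apply: hnorm_complete => e e0.
  have e20 : 0 < e ^+ 2 / 4 by rewrite divr_gt0// exprn_gt0.
  have [N hN] := inv_small _ e20; exists N => m n Nm Nn.
  rewrite -(ltr_pXn2r (n := 2)) ?nnegrE//; last exact: ltW.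
  rewrite (le_lt_trans (dist m n))//; have := hN m Nm; have := hN n Nn.
  by set a := m.+1%:R^-1; set b := n.+1%:R^-1; lra.
have lim_dot v (n : nat) (e : R) : hnorm (h - u n) <= e -> abs (dot v h - dot v (u n)) <= hnorm v * e.
  move=> he; rewrite -linearBr (le_trans (cauchy_schwarz _ _))//.
  by rewrite ler_wpM2l.
have dotSh v m : S v m -> dot v h = m.
  move=> Svm; apply/eqP; rewrite -subr_eq0; set D := dot v h - m.
  (* the infimum of [J] against its value at [u n - t conj(D) v], for [n] large *)
  have var (t : R) : 0 < t -> 2 * t * abs D ^+ 2 <= t ^+ 2 * (abs D ^+ 2 * hnorm v ^+ 2).
    move=> t0; apply/ler_addgt0Pr => x x0.
    pose a : C := - t%:C * cj D.
    have absa : abs a = t * abs D by rewrite normcM normcN abs_real abs_conj gtr0_norm.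
    have a1 : 0 < 2 * abs a * hnorm v + 1 by rewrite ltr_pwDr// !mulr_ge0.
    pose e := x / 2 / (2 * abs a * hnorm v + 1).
    have e0 : 0 < e by rewrite !divr_gt0.
    have x2 : 0 < x / 2 by rewrite divr_gt0.
    have [N1 hN1] := hh _ e0; have [N2 hN2] := inv_small _ x2.
    pose n := maxn N1 N2.
    have h1 := hN1 n (leq_maxl _ _); have h2 := hN2 n (leq_maxr _ _).
    have h3 := inf_le _ _ (SL a _ _ _ _ Svm (Su n)).
    have h4 := Ju n; have h5 := lim_dot v n e h1.
    move: h3; rewrite /J hnorm_sqrD hnormZ dotZl cReD absa exprMn exprMn.
    move: h4; rewrite /J.
    have aD : complex.Re (a * D) = - (t * abs D ^+ 2).
      by rewrite /a mulNr mulNr -mulrA [cj D * _]mulrC mul_conj cReN cReMr.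
    have eq1 : complex.Re (a * dot v (u n)) - complex.Re (a * m) =
       - (t * abs D ^+ 2) - complex.Re (a * (dot v h - dot v (u n))).
      by rewrite -cReB -aD -cReB /D; congr complex.Re; ring.
    have h6 : `|complex.Re (a * (dot v h - dot v (u n)))| <= x / 4.
      rewrite (le_trans (abs_Re_le _))// normcM.
      rewrite (le_trans (ler_wpM2l (abs_ge0 _) h5))//.
      rewrite /e mulrA mulrA -[x / 2]/(x * 2^-1) ler_pdivrMr//.
      have : 0 <= abs a * hnorm v by rewrite mulr_ge0.
      rewrite -[2 * abs a * hnorm v]mulrA; by set y := abs a * _; nra.
    move: h6; rewrite ler_norml => /andP[h6 _].
    move: eq1 h2 h6; set X := complex.Re (a * _ (u n)); set Y := complex.Re (a * m).
    set Z := complex.Re _; set T := n.+1%:R^-1; set U := hnorm (u n) ^+ 2.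
    set V := abs D ^+ 2; set V2 := hnorm v ^+ 2; set i := inf A.
    set L := complex.Re (l n).
    rewrite -[t ^+ 2 * V * V2]mulrA; set Q := t ^+ 2 * _.
    rewrite -mulrA; set tV := t * V.
    by lra.
  rewrite -normr_eq0; apply/negP => /negP D0.
  have D1 : 0 < abs D by rewrite abs_gt0 -normr_eq0.
  have b0 : 0 < hnorm v ^+ 2 + 1 by rewrite ltr_pwDr// sqr_ge0.
  have t0 : 0 < (hnorm v ^+ 2 + 1)^-1 by rewrite invr_gt0.
  have := var _ t0; set t := _^-1 in t0 *.
  have -> : t ^+ 2 * (abs D ^+ 2 * hnorm v ^+ 2) = t * abs D ^+ 2 * (t * hnorm v ^+ 2) by ring.
  have -> : 2 * t * abs D ^+ 2 = t * abs D ^+ 2 * 2 by ring.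
  rewrite ler_pM2l ?mulr_gt0 ?exprn_gt0//.
  have : t * (hnorm v ^+ 2 + 1) = 1 by rewrite mulVf// gt_eqF.
  by have := sqr_ge0 (hnorm v); set q := hnorm v ^+ 2; nra.
exists h; split => //.
have hc : hnorm h ^+ 2 <= c * hnorm h.
  apply/ler_addgt0Pr => x x0.
  have ch : 0 < c + hnorm h + 1 by rewrite ltr_pwDr// addr_ge0.
  have [N hN] := hh _ (divr_gt0 x0 ch); have := hN N (leqnn _).
  set e := x / _ => he.
  have e0 : 0 <= e by rewrite divr_ge0// ltW.
  have h1 : abs (dot (h - u N) h) <= e * hnorm h.
    by rewrite (le_trans (cauchy_schwarz _ _))// ler_wpM2r.
  have h2 : abs (dot (u N) h) <= c * (hnorm h + e).
    rewrite (dotSh _ _ (Su N)) (le_trans (Sb _ _ (Su N)))// ler_wpM2l//.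
    have -> : u N = h - (h - u N) by rewrite opprB addrC subrK.
    by rewrite (le_trans (hnormD _ _))// hnormN lerD2l.
  have : hnorm h ^+ 2 <= abs (dot (h - u N) h) + abs (dot (u N) h).
    rewrite -[leLHS]ger0_norm ?sqr_ge0// -abs_real -dot_hnorm.
    by rewrite (le_trans _ (le_normcD _ _))// -linearDl subrK.
  have : e * (c + hnorm h + 1) = x by rewrite /e divfK// gt_eqF.
  move: h1 h2; rewrite !mulrDr mulr1 [e * c]mulrC.
  by set X := e * _; set Y := c * _; set Z := c * _; lra.
have [->|h0] := eqVneq (hnorm h) 0; first by [].
by rewrite -(ler_pM2r (x := hnorm h)) -?expr2// lt_neqAle eq_sym h0 /=.
Qed.

End Hilbert.
#[global] Hint Extern 0 (is_true (0 <= hnorm _)) => exact: hnorm_ge0 : core.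

(** * Reproducing kernels *)

Section Tends.
Variable R : realType.
Local Notation C := R[i].
Local Notation abs := (@normc R).

Definition tends (u : nat -> C) (l : C) := forall e : R, 0 < e ->
  exists M0, forall M, (M0 <= M)%N -> abs (l - u M) <= e.

Lemma tends_cst (l : C) : tends (fun=> l) l.
Proof. by move=> e e0; exists 0%N => M _; rewrite subrr abs0 ltW. Qed.

Lemma tends_ext u v l : u =1 v -> tends u l -> tends v l.
Proof. by move=> uv h e /h[M hM]; exists M => n /hM; rewrite uv. Qed.

Lemma tendsD u v l m : tends u l -> tends v m -> tends (fun n => u n + v n) (l + m).
Proof.
move=> hu hv e e0; have e2 : 0 < e / 2 by rewrite divr_gt0.
have [M1 h1] := hu _ e2; have [M2 h2] := hv _ e2.
exists (maxn M1 M2) => n; rewrite geq_max => /andP[n1 n2].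
rewrite opprD addrACA (le_trans (le_normcD _ _))// [leRHS]splitr lerD ?h1 ?h2//.
Qed.

Lemma tendsZ u l (a : C) : tends u l -> tends (fun n => a * u n) (a * l).
Proof.
move=> hu e e0; have a1 : 0 < abs a + 1 by rewrite ltr_pwDr.
have [M hM] := hu _ (divr_gt0 e0 a1); exists M => n /hM h.
rewrite -mulrBr normcM (le_trans (ler_wpM2l (abs_ge0 _) h))//.
by rewrite mulrCA ler_piMr ?(ltW e0)// ler_pdivrMr// mul1r lerDl.
Qed.

Lemma tends_sum (T : Type) (s : seq T) (u : T -> nat -> C) (l : T -> C) :
  (forall t, tends (u t) (l t)) ->
  tends (fun n => \sum_(t <- s) u t n) (\sum_(t <- s) l t).
Proof.
move=> h; elim: s => [|t s IH].
  by rewrite big_nil; apply: tends_ext (tends_cst 0) => n; rewrite big_nil.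
rewrite big_cons; apply: tends_ext (tendsD (h t) IH) => n.
by rewrite big_cons.
Qed.

Lemma tends_ge (u : nat -> R) (l : C) (b : R) : tends (fun n => (u n)%:C) l ->
  (exists M0, forall n, (M0 <= n)%N -> b <= u n) -> b <= complex.Re l.
Proof.
move=> hu [M0 hb]; apply/ler_addgt0Pr => e e0; have [M hM] := hu e e0.
have := hM _ (leq_maxl M M0); have := hb _ (leq_maxr M M0); set n := maxn _ _ => h1 h2.
have := le_trans (abs_Re_le _) h2; rewrite cReB /= ler_norml => /andP[+ _].
by move: h1; set x := u n; set y := complex.Re l; lra.
Qed.

Lemma tends_le (u : nat -> R) (l : C) (b : R) : tends (fun n => (u n)%:C) l ->
  (exists M0, forall n, (M0 <= n)%N -> u n <= b) -> complex.Re l <= b.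
Proof.
move=> hu [M0 hb]; rewrite -lerN2 -cReN; apply: (@tends_ge (fun n => - u n)).
  have := tendsZ (-1) hu; rewrite mulN1r; apply: tends_ext => n.
  by rewrite mulN1r rcN.
by exists M0 => n /hb; rewrite lerN2.
Qed.

End Tends.

Section ReproducingKernel.
Variables (R : realType) (X : Type) (K : X -> X -> R[i]) (H : rkhs K).
Local Notation C := R[i].
Local Notation abs := (@normc R).
Local Notation cj := (@conjc R).
Local Notation dot := (rkhs_dot H).
Local Notation fn := (rkhs_fun H).
Local Notation ker := (rkhs_kernel H).
Local Notation dE := (@rkhs_dotE _ _ _ H).

(** For [F] in [H], [dual F s] is the inner product of [comb s] with [F]
([dot_comb]); it makes sense for every function [F]. *)
Definition comb (s : seq (C * X)) : H := \sum_(p <- s) p.1 *: ker p.2.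
Definition dual (F : X -> C) (s : seq (C * X)) : C := \sum_(p <- s) p.1 * cj (F p.2).

Lemma dot_comb s h : dot (comb s) h = dual (fn h) s.
Proof.
rewrite /comb /dual; elim: s => [|p s IH]; first by rewrite !big_nil linear0l.
by rewrite !big_cons dotPl IH rkhs_reproducing [dot _ h]dotC.
Qed.

Lemma fnD (f g : H) z : fn (f + g) z = fn f z + fn g z.
Proof. by rewrite linearD. Qed.

Lemma fnB (f g : H) z : fn (f - g) z = fn f z - fn g z.
Proof. by rewrite linearB. Qed.

Lemma fnZ a (f : H) z : fn (a *: f) z = a * fn f z.
Proof. by rewrite linearZ. Qed.

Lemma dot_ker w z : dot (ker w) (ker z) = K z w.
Proof. by rewrite -rkhs_reproducing rkhs_kernelE. Qed.

Lemma comb_sqr s : (hnorm (comb s) ^+ 2)%:C =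
  \sum_(p <- s) \sum_(q <- s) (p.1 * cj q.1) * K q.2 p.2.
Proof.
rewrite -(dot_hnorm dE) dot_comb /dual; apply: eq_bigr => p _.
rewrite rkhs_reproducing dotC.
have -> : dot (ker p.2) (comb s) = \sum_(q <- s) cj q.1 * K q.2 p.2.
  rewrite /comb linear_sum; apply: eq_bigr => q _ /=.
  by rewrite dotZr dot_ker.
rewrite conjcK mulr_sumr; apply: eq_bigr => q _.
by rewrite mulrA.
Qed.

(** The functions of [H] are those dominated by the kernel: this is the
representation theorem applied to [sum b K_w |-> sum b conj (F w)]. *)
Lemma dominated_in_rkhs (F : X -> C) (c : R) : 0 <= c ->
  (forall s, abs (dual F s) <= c * hnorm (comb s)) ->
  exists h : H, fn h = F /\ hnorm h <= c.
Proof.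
move=> c0 hF.
have [|||h [h1 h2]] := @riesz_graph _ _ dot dE
    (fun u l => exists s, u = comb s /\ l = dual F s) c c0.
- by exists [::]; rewrite /comb /dual !big_nil.
- move=> a u v lu lv [s [-> ->]] [t [-> ->]].
  exists ([seq (a * p.1, p.2) | p <- s] ++ t); split.
    rewrite /comb big_cat big_map/= scaler_sumr; congr (_ + _).
    by apply: eq_bigr => p _; rewrite scalerA.
  rewrite /dual big_cat big_map/= mulr_sumr; congr (_ + _).
  by apply: eq_bigr => p _; rewrite mulrA.
- by move=> u l [s [-> ->]].
exists h; split => //; apply/funext => w.
have := h1 (comb [:: (1, w)]) (dual F [:: (1, w)]) (ex_intro _ _ (conj erefl erefl)).
rewrite dot_comb /dual !big_seq1 !mul1r /= => e.
by rewrite -[LHS]conjcK e conjcK.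
Qed.

Lemma dual_le (h : H) s : abs (dual (fn h) s) <= hnorm h * hnorm (comb s).
Proof. by rewrite -dot_comb mulrC; apply: cauchy_schwarz dE _ _. Qed.

(** The adjoint of multiplication by [phi] multiplies the kernel function at [w] by
[conj (phi w)], so the condition bounds its norm by [c]. *)
Lemma multiplier_bound (phi : X -> C) (c : R) : 0 <= c ->
  (forall s, hnorm (comb [seq (p.1 * cj (phi p.2), p.2) | p <- s]) <= c * hnorm (comb s)) ->
  forall f : H, exists g : H, fn g = (phi \* fn f) /\ hnorm g <= c * hnorm f.
Proof.
move=> c0 hphi f.
have := @dominated_in_rkhs (phi \* fn f) (c * hnorm f).
apply; first by rewrite mulr_ge0.
move=> s; have -> : dual (phi \* fn f) s =
    dual (fn f) [seq (p.1 * cj (phi p.2), p.2) | p <- s].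
  by rewrite /dual big_map; apply: eq_bigr => p _; rewrite cjM mulrA.
by rewrite (le_trans (dual_le _ _))// [c * _]mulrC -mulrA ler_wpM2l.
Qed.

(** A kernel-preserving map [tau] preserves the norms of combinations of kernel
functions. *)
Lemma comp_contraction (tau : X -> X) : (forall z w, K (tau z) (tau w) = K z w) ->
  forall h : H, exists g : H, fn g = fn h \o tau /\ hnorm g <= hnorm h.
Proof.
move=> Kt h; apply: dominated_in_rkhs => // s.
have -> : dual (fn h \o tau) s = dual (fn h) [seq (p.1, tau p.2) | p <- s].
  by rewrite /dual big_map.
rewrite (le_trans (dual_le _ _))// ler_wpM2l// -(ler_pXn2r (n := 2)) ?nnegrE//.
rewrite -lecR !comb_sqr big_map le_eqVlt; apply/orP; left; apply/eqP.
by apply: eq_bigr => p _; rewrite big_map; apply: eq_bigr => q _; rewrite Kt.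
Qed.

(** If composition with [tau] preserves the kernel and multiplies [f] and [g] by
opposite unimodular scalars, then it exchanges [f + c g] and [f - c g] up to a scalar,
so these have the same norm for every [c]. *)
Lemma orthogonal_eigen (tau : X -> X) (f g : H) (om : C) :
  (forall z w, K (tau z) (tau w) = K z w) -> abs om = 1 ->
  (forall z, fn f (tau z) = om * fn f z) -> (forall z, fn g (tau z) = - om * fn g z) ->
  dot f g = 0.
Proof.
move=> Kt om1 hf hg.
have key (c : C) : 0 <= complex.Re (dot f (c *: g)).
  have [k [kE kn]] := comp_contraction Kt (f + c *: g).
  have {}kE : k = om *: (f - c *: g).
    apply: (@rkhs_fun_inj _ _ _ H); rewrite kE; apply/funext => z.
    by rewrite fnZ fnB fnZ /= fnD fnZ hf hg; ring.
  move: kn; rewrite kE hnormZ om1 mul1r -(ler_pXn2r (n := 2)) ?nnegrE//.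
  by rewrite (hnorm_sqrB dE) (hnorm_sqrD dE); set x := complex.Re _; lra.
have := key (- dot f g).
rewrite dotZr rmorphN/= mulNr mulrC -[_ * _]/(dot f g * cj (dot f g)) mul_conj cReN /=.
rewrite oppr_ge0 => h; apply/eqP; rewrite -normr_eq0.
have : abs (dot f g) ^+ 2 == 0 by rewrite eq_le h sqr_ge0.
by rewrite expf_eq0/= => /eqP /eq0_normc ->; rewrite normr0.
Qed.

End ReproducingKernel.

(** The kernel is diagonal in the family [F]; the exhaustion [S] fixes the order of
summation, which avoids any discussion of unconditional convergence. *)
Section Features.
Variables (R : realType) (X : Type) (K : X -> X -> R[i]) (H : rkhs K).
Local Notation C := R[i].
Local Notation abs := (@normc R).
Local Notation cj := (@conjc R).
Local Notation dot := (rkhs_dot H).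
Local Notation fn := (rkhs_fun H).
Local Notation ker := (rkhs_kernel H).
Local Notation dE := (@rkhs_dotE _ _ _ H).
Variables (I : eqType) (k : I -> R) (F : I -> X -> C) (S : nat -> seq I).
Hypothesis k_gt0 : forall g, 0 < k g.
Hypothesis S_uniq : forall M, uniq (S M).
Hypothesis S_exhaust : forall g, exists M0, forall M, (M0 <= M)%N -> g \in S M.
Hypothesis K_expand : forall z w,
  tends (fun M => \sum_(g <- S M) (k g)%:C * (F g z * cj (F g w))) (K z w).

Lemma gram_tends s : tends
  (fun M => (\sum_(g <- S M) k g * abs (dual (F g) s) ^+ 2)%:C)
  (hnorm (comb H s) ^+ 2)%:C.
Proof.
rewrite comb_sqr; apply: (@tends_ext _ (fun M => \sum_(p <- s) \sum_(q <- s)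
    (p.1 * cj q.1) * (\sum_(g <- S M) (k g)%:C * (F g q.2 * cj (F g p.2))))).
  move=> M /=; rewrite rc_sum.
  under eq_bigr => p _ do under eq_bigr => q _ do rewrite mulr_sumr.
  under eq_bigr => p _ do rewrite exchange_big/=.
  rewrite exchange_big/=; apply: eq_bigr => g _.
  rewrite rcM -mul_conj /dual cj_sum mulr_suml mulr_sumr; apply: eq_bigr => p _.
  rewrite !mulr_sumr; apply: eq_bigr => q _.
  by rewrite cjM conjcK; ring.
apply: tends_sum => p; apply: tends_sum => q; exact: tendsZ.
Qed.

Lemma finite_exhaust (L : seq I) :
  exists M0, forall M, (M0 <= M)%N -> {subset L <= S M}.
Proof.
elim: L => [|g L [M1 h1]]; first by exists 0%N.
have [M2 h2] := S_exhaust g; exists (maxn M1 M2) => M.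
rewrite geq_max => /andP[m1 m2] x; rewrite inE => /orP[/eqP->|]; first exact: h2.
exact: h1.
Qed.

(** The terms of the expansion of [|sum b K_w|^2] are nonnegative, so finite partial
sums stay below the limit. *)
Lemma gram_bessel (L : seq I) s : uniq L ->
  \sum_(g <- L) k g * abs (dual (F g) s) ^+ 2 <= hnorm (comb H s) ^+ 2.
Proof.
move=> uL; rewrite -[leRHS]/(complex.Re (hnorm (comb H s) ^+ 2)%:C).
apply: tends_ge (gram_tends s) _.
have [M0 h] := finite_exhaust L; exists M0 => M MM.
have pL : perm_eq L [seq g <- S M | g \in L].
  apply: uniq_perm => //; first exact: filter_uniq.
  by move=> g; rewrite mem_filter andb_idr// => /(h M MM).
rewrite (perm_big _ pL) big_filter big_mkcond/=; apply: ler_sum => g _.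
by case: ifP => // _; rewrite mulr_ge0 ?sqr_ge0// ltW.
Qed.

Lemma feature_in_rkhs g : exists h : H, fn h = F g /\ hnorm h <= (Num.sqrt (k g))^-1.
Proof.
have sk : 0 < Num.sqrt (k g) by rewrite sqrtr_gt0.
apply: dominated_in_rkhs => [|s]; first by rewrite invr_ge0 ltW.
rewrite -(ler_pM2l sk) mulrA mulfV ?mul1r ?gt_eqF//.
rewrite -(ler_pXn2r (n := 2)) ?nnegrE ?mulr_ge0 ?(ltW sk)// exprMn sqr_sqrtr ?(ltW (k_gt0 g))//.
by have := @gram_bessel [:: g] s isT; rewrite big_seq1.
Qed.

(** Multiplication by [phi] maps the features to multiples of features and keeps
them distinct, so the bound on Gram matrices can be checked coefficientwise. *)
Lemma multiplier_of_shift (phi : X -> C) (c : R) (r : R) (sh : I -> I) :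
  0 <= c -> injective sh ->
  (forall g z, phi z * F g z = r%:C * F (sh g) z) ->
  (forall g, r ^+ 2 * k g <= c ^+ 2 * k (sh g)) ->
  forall f : H, exists g : H, fn g = (phi \* fn f) /\ hnorm g <= c * hnorm f.
Proof.
move=> c0 ish hphi hk; apply: multiplier_bound => // s.
set t := [seq _ | _ <- _].
rewrite -(ler_pXn2r (n := 2)) ?nnegrE ?mulr_ge0// exprMn.
rewrite -[leLHS]/(complex.Re (hnorm (comb H t) ^+ 2)%:C).
apply: tends_le (gram_tends t) _; exists 0%N => M _.
apply: le_trans (ler_wpM2l (sqr_ge0 c) (@gram_bessel (map sh (S M)) s _)); last first.
  by rewrite map_inj_uniq.
rewrite big_map mulr_sumr; apply: ler_sum => g _.
have -> : dual (F g) t = r%:C * dual (F (sh g)) s.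
  rewrite /dual big_map mulr_sumr; apply: eq_bigr => p _ /=.
  by rewrite -mulrA -cjM hphi cjM conjc_real mulrCA.
rewrite normcM abs_real exprMn real_normK ?num_real//.
set d2 := abs _ ^+ 2; have -> : k g * (r ^+ 2 * d2) = r ^+ 2 * k g * d2 by ring.
by rewrite [leRHS]mulrA ler_wpM2r ?sqr_ge0// hk.
Qed.

Section Orthogonal.
Variable m : I -> H.
Hypothesis mE : forall g, fn (m g) = F g.
Hypothesis m_norm : forall g, hnorm (m g) <= (Num.sqrt (k g))^-1.
Hypothesis m_orth : forall g g', g != g' -> dot (m g) (m g') = 0.

Lemma hnorm_sqr_sum (L : seq I) (a : I -> C) : uniq L ->
  hnorm (\sum_(g <- L) a g *: m g) ^+ 2 = \sum_(g <- L) abs (a g) ^+ 2 * hnorm (m g) ^+ 2.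
Proof.
elim: L => [|g L IH]; first by rewrite !big_nil hnorm0 expr0n.
move=> /= /andP[gL uL].
have z : dot (a g *: m g) (\sum_(g <- L) a g *: m g) = 0.
  rewrite dotZl linear_sum big_seq big1 ?mulr0//= => g' g'L.
  by rewrite dotZr m_orth ?mulr0//; apply: contraNneq gL => ->.
by rewrite !big_cons (hnorm_sqrD dE) IH// hnormZ exprMn z mulr0 addr0.
Qed.

(** Orthogonality forces [K_w = sum_g k_g conj (F_g w) F_g] in norm, and evaluating
the inner product of [F_a] with it determines [|F_a|]. *)
Lemma feature_norm a w : F a w != 0 -> hnorm (m a) ^+ 2 = (k a)^-1.
Proof.
move=> Fa0.
pose c g : C := (k g)%:C * cj (F g w).
pose P M := \sum_(g <- S M) c g *: m g.
pose q M := \sum_(g <- S M) k g * abs (F g w) ^+ 2.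
have m2 g : k g * hnorm (m g) ^+ 2 <= 1.
  have := m_norm g; rewrite -(ler_pXn2r (n := 2)) ?nnegrE ?invr_ge0 ?sqrtr_ge0// exprVn.
  by rewrite sqr_sqrtr ?(ltW (k_gt0 g))// -[(k g)^-1]mul1r ler_pdivlMr// mulrC.
have hP M : hnorm (ker w - P M) ^+ 2 <= complex.Re (K w w) - q M.
  rewrite (hnorm_sqrB dE).
  have -> : hnorm (ker w) ^+ 2 = complex.Re (K w w).
    by rewrite -(dot_ker H) (dot_hnorm dE).
  have -> : complex.Re (dot (ker w) (P M)) = q M.
    rewrite dotC Re_cj -rkhs_reproducing /P linear_sum /= fct_sumE cRe_sum.
    apply: eq_bigr => g _; rewrite fnZ mE /c -mulrA cReMr.
    by rewrite [cj _ * _]mulrC mul_conj.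
  have : hnorm (P M) ^+ 2 <= q M.
    rewrite hnorm_sqr_sum//; apply: ler_sum => g _.
    rewrite /c normcM abs_real abs_conj gtr0_norm// exprMn.
    have -> : k g ^+ 2 * abs (F g w) ^+ 2 * hnorm (m g) ^+ 2 =
      (k g * abs (F g w) ^+ 2) * (k g * hnorm (m g) ^+ 2) by ring.
    by rewrite ler_piMr// mulr_ge0 ?sqr_ge0// ltW.
  by set x := hnorm _ ^+ 2; lra.
have ev M : a \in S M -> F a w = dot (m a) (ker w - P M) + (k a * hnorm (m a) ^+ 2)%:C * F a w.
  move=> aM; have -> : dot (m a) (ker w - P M) = fn (m a) w - dot (m a) (P M).
    by rewrite linearBr rkhs_reproducing.
  rewrite mE.
  have -> : dot (m a) (P M) = (k a * hnorm (m a) ^+ 2)%:C * F a w.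
    rewrite /P linear_sum/= (bigD1_seq a)//= big1_seq; last first.
      by move=> g /andP[ga _]; rewrite dotZr m_orth ?mulr0// eq_sym.
    rewrite addr0 dotZr (dot_hnorm dE) /c cjM conjcK conjc_real rcM; ring.
  by rewrite subrK.
have small : abs ((1 - (k a * hnorm (m a) ^+ 2)%:C) * F a w) = 0.
  apply/le_anti; rewrite abs_ge0 andbT; apply/ler_addgt0Pr => e e0; rewrite add0r.
  have n1 : 0 < hnorm (m a) + 1 by rewrite ltr_pwDr.
  pose d := (e / (hnorm (m a) + 1)) ^+ 2.
  have d0 : 0 < d by rewrite exprn_gt0// divr_gt0.
  have [M1 h1] := K_expand w w d0; have [M2 h2] := S_exhaust a.
  pose M := maxn M1 M2.
  have hd : complex.Re (K w w) - q M <= d.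
    have := h1 M (leq_maxl _ _).
    have -> : \sum_(g <- S M) (k g)%:C * (F g w * cj (F g w)) = (q M)%:C.
      by rewrite rc_sum; apply: eq_bigr => g _; rewrite mul_conj -rcM.
    by apply: le_trans; rewrite (le_trans _ (Re_le_abs _))// cReB.
  rewrite mulrBl mul1r {1}(ev M (h2 M (leq_maxr _ _))) addrK.
  rewrite (le_trans (cauchy_schwarz dE _ _))//.
  have : hnorm (ker w - P M) <= e / (hnorm (m a) + 1).
    rewrite -(ler_pXn2r (n := 2)) ?nnegrE ?divr_ge0 ?(ltW e0) ?(ltW n1)//.
    exact: le_trans (hP M) hd.
  move=> h; rewrite (le_trans (ler_wpM2l _ h))// mulrCA ler_piMr ?(ltW e0)//.
  by rewrite ler_pdivrMr// mul1r lerDl.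
move: small => /eq0_normc /eqP; rewrite mulf_eq0 (negbTE Fa0) orbF subr_eq0.
rewrite -[1]/(1%:C) => /eqP /complexI h.
by rewrite -[RHS]mulr1 h mulKf// gt_eqF.
Qed.

End Orthogonal.
End Features.

(** * Derivatives of complex functions of a real variable *)

Section ComplexDerivative.
Variable R : realType.
Local Notation C := R[i].
Local Notation abs := (@normc R).
Implicit Types (f g : R -> C) (t : R).

(** Splitting into real and imaginary parts gives access to the mean value theorem,
at the price of a factor [2] in [cderiv_bound]. *)
Definition cderiv f t (l : C) : Prop :=
  is_derive t (1 : R) (fun s => complex.Re (f s)) (complex.Re l) /\
  is_derive t (1 : R) (fun s => complex.Im (f s)) (complex.Im l).

Lemma cderiv_eq f t l l' : cderiv f t l -> l = l' -> cderiv f t l'.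
Proof. by move=> h <-. Qed.

Lemma cderiv_ext f g t l : f =1 g -> cderiv f t l -> cderiv g t l.
Proof. by move=> /funext ->. Qed.

Lemma cderiv_cst (c : C) t : cderiv (fun=> c) t 0.
Proof. by split; apply: is_derive_cst. Qed.

Lemma cderiv_id t : cderiv (fun s => s%:C) t 1.
Proof. by split; [apply: is_derive_id|apply: is_derive_cst]. Qed.

Lemma cderivD f g t l m : cderiv f t l -> cderiv g t m ->
  cderiv (fun s => f s + g s) t (l + m).
Proof.
move=> [f1 f2] [g1 g2]; split; rewrite ?cReD ?cImD.
  rewrite (_ : (fun s => complex.Re (f s + g s)) =
    (fun s => complex.Re (f s)) \+ (fun s => complex.Re (g s))); first exact: is_deriveD.
  by apply/funext => s; rewrite cReD.
rewrite (_ : (fun s => complex.Im (f s + g s)) =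
  (fun s => complex.Im (f s)) \+ (fun s => complex.Im (g s))); first exact: is_deriveD.
by apply/funext => s; rewrite cImD.
Qed.

Lemma cReM (x y : C) : complex.Re (x * y) =
  complex.Re x * complex.Re y - complex.Im x * complex.Im y.
Proof. by case: x; case: y. Qed.

Lemma cImM (x y : C) : complex.Im (x * y) =
  complex.Re x * complex.Im y + complex.Im x * complex.Re y.
Proof. by case: x; case: y. Qed.

Lemma cderivM f g t l m : cderiv f t l -> cderiv g t m ->
  cderiv (fun s => f s * g s) t (l * g t + f t * m).
Proof.
move=> [f1 f2] [g1 g2]; split.
  rewrite (_ : (fun s => complex.Re (f s * g s)) =
    (fun s => complex.Re (f s)) \* (fun s => complex.Re (g s)) \-
    (fun s => complex.Im (f s)) \* (fun s => complex.Im (g s))).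
    apply: is_derive_eq; rewrite cReD !cReM /GRing.scale /=; ring.
  by apply/funext => s; rewrite cReM.
rewrite (_ : (fun s => complex.Im (f s * g s)) =
  (fun s => complex.Re (f s)) \* (fun s => complex.Im (g s)) \+
  (fun s => complex.Im (f s)) \* (fun s => complex.Re (g s))).
  apply: is_derive_eq; rewrite cImD !cImM /GRing.scale /=; ring.
by apply/funext => s; rewrite cImM.
Qed.

Lemma cderivZ (c : C) f t l : cderiv f t l -> cderiv (fun s => c * f s) t (c * l).
Proof.
by move=> h; apply: cderiv_eq (cderivM (cderiv_cst c t) h) _; rewrite mul0r add0r.
Qed.

Lemma cderivX n t : cderiv (fun s => s%:C ^+ n) t (n%:R * t%:C ^+ n.-1).
Proof.
elim: n => [|n IH]; first by rewrite mul0r; exact: cderiv_cst.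
apply: (@cderiv_ext (fun s => s%:C * s%:C ^+ n)); first by move=> s; rewrite exprS.
apply: cderiv_eq (cderivM (cderiv_id t) IH) _ => /=.
case: n {IH} => [|n]; first by rewrite !expr0 mul0r mulr0 addr0 !mul1r.
by rewrite /= exprS -[n.+2%:R]natr1; ring.
Qed.

Lemma cderiv_sum (f : nat -> R -> C) (l : nat -> C) t M :
  (forall N, cderiv (f N) t (l N)) ->
  cderiv (fun s => \sum_(N < M) f N s) t (\sum_(N < M) l N).
Proof.
move=> h; elim: M => [|M IH].
  rewrite big_ord0; apply: cderiv_ext (cderiv_cst 0 t) => s.
  by rewrite big_ord0.
rewrite big_ord_recr; apply: cderiv_ext (cderivD IH (h M)) => s.
by rewrite big_ord_recr.
Qed.

Lemma cderiv_bound f (df : R -> C) (B : R) :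
  (forall t, 0 <= t <= 1 -> cderiv f t (df t)) ->
  (forall t, 0 <= t <= 1 -> abs (df t) <= B) -> abs (f 1 - f 0) <= 2 * B.
Proof.
move=> hd hB.
have mvt (F dF : R -> R) : (forall t, 0 <= t <= 1 -> is_derive t (1 : R) F (dF t)) ->
    (forall t, 0 <= t <= 1 -> `|dF t| <= B) -> `|F 1 - F 0| <= B.
  move=> hF hFB; have [||x] := @MVT R F dF 0 1 ltr01.
  - by move=> x; rewrite in_itv/= => /andP[x0 x1]; apply: hF; rewrite !ltW.
  - apply: derivable_within_continuous => x; rewrite in_itv/= => hx.
    by have := hF x hx; case.
  rewrite in_itv/= => /andP[x0 x1] ->; rewrite subr0 mulr1; apply: hFB.
  by rewrite !ltW.
rewrite (le_trans (abs_le_ReIm _))// mulr_natl mulr2n lerD//.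
  rewrite cReB; apply: (mvt (fun t => complex.Re (f t)) (fun t => complex.Re (df t))) => t ht.
    by case: (hd t ht).
  by rewrite (le_trans (abs_Re_le _))// hB.
rewrite cImD (_ : complex.Im (- f 0) = - complex.Im (f 0)); last by case: (f 0).
apply: (mvt (fun t => complex.Im (f t)) (fun t => complex.Im (df t))) => t ht.
  by case: (hd t ht).
by rewrite (le_trans (abs_Im_le _))// hB.
Qed.

Lemma cderiv_cexp f t l : cderiv f t l ->
  cderiv (fun s => cexp (f s)) t (l * cexp (f t)).
Proof.
move=> [f1 f2].
have e1 s : complex.Re (cexp (f s)) = expR (complex.Re (f s)) * cos (complex.Im (f s)).
  by rewrite /cexp cReMr.
have e2 s : complex.Im (cexp (f s)) = expR (complex.Re (f s)) * sin (complex.Im (f s)).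
  by rewrite /cexp cImM /= mul0r addr0.
split.
  rewrite (_ : (fun s => complex.Re (cexp (f s))) =
    (expR \o (fun s => complex.Re (f s))) \* (cos \o (fun s => complex.Im (f s)))).
    apply: is_derive_eq; rewrite cReM e1 e2 /GRing.scale /=; ring.
  by apply/funext.
rewrite (_ : (fun s => complex.Im (cexp (f s))) =
  (expR \o (fun s => complex.Re (f s))) \* (sin \o (fun s => complex.Im (f s)))).
  apply: is_derive_eq; rewrite cImM e1 e2 /GRing.scale /=; ring.
by apply/funext.
Qed.

Lemma abs_cexp (x : C) : abs (cexp x) = expR (complex.Re x).
Proof.
rewrite /cexp normcM abs_real ger0_norm ?expR_ge0//= cos2Dsin2.
by rewrite sqrtr1 mulr1.
Qed.

Section Logarithm.
Variable u : C.
Hypothesis u1 : abs u < 1.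

Lemma segment_Re_gt0 t : 0 <= t <= 1 -> 0 < complex.Re (1 - t%:C * u).
Proof.
move=> /andP[t0 t1]; rewrite cReB cReMr /= subr_gt0 (le_lt_trans _ u1)//.
by rewrite (le_trans (ler_wpM2l t0 (Re_le_abs u)))// ler_piMl.
Qed.

Lemma cderiv_clog t : 0 <= t <= 1 ->
  cderiv (fun s => clog (1 - s%:C * u)) t (- u / (1 - t%:C * u)).
Proof.
move=> ht; have := segment_Re_gt0 ht.
case: u => p q /=; rewrite mul0r !subr0 => x0.
have ReE s : complex.Re (1 - s%:C * (p +i* q)) = 1 - s * p.
  by rewrite /= mul0r !subr0.
have ImE s : complex.Im (1 - s%:C * (p +i* q)) = - (s * q).
  by rewrite /= mul0r !addr0 sub0r.
set x := 1 - t * p in x0 *.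
have s0 : 0 < x ^+ 2 + (t * q) ^+ 2 by rewrite ltr_pwDl ?exprn_gt0 ?sqr_ge0.
have dx : is_derive t (1 : R) (fun s => 1 - s * p) (- p).
  rewrite (_ : (fun s => 1 - s * p) = cst 1 \- p \*: id); last first.
    by apply/funext => s; rewrite /= mulrC.
  by apply: is_derive_eq; rewrite sub0r /GRing.scale /= mulr1.
have dy : is_derive t (1 : R) (fun s => s * q) q.
  rewrite (_ : (fun s => s * q) = q \*: id); last first.
    by apply/funext => s; rewrite /= mulrC.
  by apply: is_derive_eq; rewrite /GRing.scale /= mulr1.
have RE : complex.Re (- (p +i* q) / (1 - t%:C * (p +i* q))) =
    - (x * p + (- (t * q)) * q) / (x ^+ 2 + (t * q) ^+ 2) /\
  complex.Im (- (p +i* q) / (1 - t%:C * (p +i* q))) =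
    (- (x * q) - t * q * p) / (x ^+ 2 + (t * q) ^+ 2).
  rewrite /= !mul0r !subr0 !addr0 sub0r sqrrN -/x; split; ring.
pose X : R -> R := fun s => 1 - s * p; pose Y : R -> R := fun s => s * q.
have [RE1 RE2] := RE; split; rewrite ?RE1 ?RE2.
  have dN : is_derive t (1 : R) (X * X + Y * Y) (- 2 * (x * p + (- (t * q)) * q)).
    by apply: is_derive_eq; rewrite /X /Y /GRing.scale /= -/x; ring.
  have NE : (X * X + Y * Y) t = x ^+ 2 + (t * q) ^+ 2 by rewrite !expr2.
  have sN : 0 < Num.sqrt ((X * X + Y * Y) t) by rewrite sqrtr_gt0 NE.
  have dsq := @is_derive1_comp R _ _ t _ _ (is_derive1_sqrt (eq_ind_r (fun z => 0 < z) s0 NE)) dN.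
  have dln := @is_derive1_comp R _ _ t _ _ (is_derive1_ln sN) dsq.
  rewrite (_ : (fun s => complex.Re (clog (1 - s%:C * (p +i* q)))) =
    @ln R \o (Num.sqrt \o (X * X + Y * Y))).
    refine (is_derive_eq dln _).
    have r2 : x ^+ 2 + (t * q) ^+ 2 = Num.sqrt ((X * X + Y * Y) t) ^+ 2.
      by rewrite sqr_sqrtr NE // ltW.
    by rewrite r2; field; rewrite gt_eqF.
  apply/funext => s; rewrite /clog -[LHS]/(ln _) ReE ImE sqrrN.
  by rewrite !expr2.
have xn0 : X t != 0 by rewrite gt_eqF.
have dV := is_deriveV xn0 dx.
have dat : is_derive t (1 : R) (atan \o (fun s => - Y s * (X s)^-1))
    ((- (x * q) - t * q * p) / (x ^+ 2 + (t * q) ^+ 2)).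
  have dQ : is_derive t (1 : R) (fun s => - Y s * (X s)^-1)
      (- q * x^-1 + (t * q) * x ^- 2 * (- p)).
    have := @is_deriveM R R (fun s => - Y s) (fun s => (X s)^-1) t 1 (- q) _ (is_deriveN dy) dV.
    move=> h; refine (is_derive_eq h _); rewrite /X /Y /GRing.scale /= -/x; ring.
  refine (is_derive_eq (@is_derive1_comp R _ _ t _ _ (is_derive1_atan _) dQ) _).
  rewrite /X /Y -/x; field.
  by rewrite (gt_eqF x0) [_ + _]addrC gt_eqF//; move: s0; congr (0 < _); ring.
rewrite (_ : (fun s => complex.Im (clog (1 - s%:C * (p +i* q)))) =
  atan \o (fun s => - Y s * (X s)^-1)) //.
by apply/funext => s; rewrite /clog -[LHS]/(atan _) ReE ImE.
Qed.

End Logarithm.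
End ComplexDerivative.

(** * Power series of the kernels *)

Section KernelSeries.
Variable R : realType.
Local Notation C := R[i].
Local Notation abs := (@normc R).

(** [(a)_n / n!] *)
Fixpoint poch (a : R) (n : nat) : R :=
  if n is m.+1 then poch a m * (m%:R + a) / m.+1%:R else 1.

Lemma pochS a n : n.+1%:R * poch a n.+1 = (n%:R + a) * poch a n.
Proof. by rewrite /= mulrC divfK ?pnatr_eq0// mulrC. Qed.

Lemma poch_gt0 a n : 0 < a -> 0 < poch a n.
Proof.
move=> a0; elim: n => [//|n IH] /=.
by rewrite divr_gt0 ?mulr_gt0 ?ltr_wpDl ?ltr0n.
Qed.

(** The ratio of consecutive terms tends to [r], so it is eventually below
[(1 + r) / 2]. *)
Lemma poch_geometric_small (a r e : R) : 0 < a -> 0 <= r -> r < 1 -> 0 < e ->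
  exists M0, forall M, (M0 <= M)%N -> M.+1%:R * poch a M.+1 * r ^+ M.+1 <= e.
Proof.
move=> a0 r0 r1 e0; pose y M := M.+1%:R * poch a M.+1 * r ^+ M.+1.
have y0 M : 0 <= y M by rewrite mulr_ge0 ?exprn_ge0// mulr_ge0// ltW// poch_gt0.
pose rho := (1 + r) / 2.
have rho1 : rho < 1 by rewrite ltr_pdivrMr// mul1r; lra.
have rho0 : 0 < rho by rewrite divr_gt0//; lra.
pose N1 := Num.truncn (2 * a / (1 - r)).
have step M : (N1 <= M)%N -> y M.+1 <= rho * y M.
  move=> NM; have M0 : 0 < M.+1%:R :> R by rewrite ltr0n.
  have h : 2 * a <= (1 - r) * M.+1%:R.
    rewrite [leRHS]mulrC -ler_pdivrMr ?subr_gt0// ltW// (lt_le_trans (truncnS_gt _))//.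
    by rewrite ler_nat ltnS.
  have -> : y M.+1 = (M.+1%:R + a) / M.+1%:R * r * y M.
    by rewrite /y pochS exprS; move: M0; set m := M.+1%:R => M0; field; rewrite gt_eqF.
  rewrite ler_wpM2r// mulrAC ler_pdivrMr// /rho.
  have : a * r <= a by rewrite ler_piMr// ltW.
  by move: h; set m := M.+1%:R; nra.
have bound j : y (N1 + j)%N <= rho ^+ j * y N1.
  elim: j => [|j IH]; first by rewrite addn0 expr0 mul1r.
  rewrite addnS exprS -mulrA (le_trans (step _ (leq_addr _ _)))// ler_wpM2l//.
  exact: ltW.
have c0 : 0 < y N1 + 1 by rewrite ltr_pwDr.
have [N2 hN2] := geometric_small (ltW rho0) rho1 (divr_gt0 e0 c0).
exists (N1 + N2)%N => M hM; rewrite -/(y M).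
have -> : M = (N1 + (M - N1))%N by rewrite subnKC// (leq_trans (leq_addr _ _) hM).
rewrite (le_trans (bound _))//.
have := hN2 (M - N1)%N _; rewrite leq_subRL ?(leq_trans (leq_addr _ _) hM)//.
move=> /(_ hM) h; rewrite (le_trans (ler_wpM2r (y0 _) h))//.
by rewrite mulrAC ler_pdivrMr// ler_wpM2l ?(ltW e0)// lerDl.
Qed.

Variable u : C.
Hypothesis u1 : abs u < 1.
Let r := abs u.
Let r0 : 0 <= r. Proof. exact: abs_ge0. Qed.
Let dr : 0 < 1 - r. Proof. by rewrite subr_gt0. Qed.

Lemma segment_abs_ge (t : R) : 0 <= t <= 1 -> 1 - r <= abs (1 - t%:C * u).
Proof.
move=> /andP[t0 t1].
have h : abs (t%:C * u) <= r by rewrite normcM abs_real ger0_norm// ler_piMl.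
have := le_normcD (1 - t%:C * u) (t%:C * u); rewrite subrK abs1.
by move: h; set a := abs _; set b := abs _; lra.
Qed.

Lemma segment_neq0 (t : R) : 0 <= t <= 1 -> 1 - t%:C * u != 0.
Proof. by move=> ht; rewrite -abs_gt0 (lt_le_trans dr)// segment_abs_ge. Qed.

Lemma inv_segment_le (t : R) : 0 <= t <= 1 -> abs (1 - t%:C * u)^-1 <= (1 - r)^-1.
Proof.
move=> ht; rewrite normcV lef_pV2 ?posrE ?segment_abs_ge//.
by rewrite abs_gt0 segment_neq0.
Qed.

Lemma clog1 : clog (1 : C) = 0.
Proof.
by rewrite /clog /= expr0n addr0 expr1n sqrtr1 ln1 mul0r atan0.
Qed.

(** [S_M(t) (1 - t u)^a - 1], with [S_M] the partial sum of the binomial series,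
vanishes at [0] and its derivative is the single term that the truncation leaves. *)
Lemma binomial_series (a : R) : 0 < a ->
  tends (fun M => \sum_(N < M) (poch a N)%:C * u ^+ N) (cpow (1 - u) a)^-1.
Proof.
move=> a0.
pose G (t : R) := cexp (a%:C * clog (1 - t%:C * u)).
have dG t : 0 <= t <= 1 -> cderiv G t (a%:C * (- u / (1 - t%:C * u)) * G t).
  by move=> ht; apply: cderiv_cexp; apply: cderivZ; exact: cderiv_clog.
pose S M (t : R) := \sum_(N < M) (poch a N)%:C * u ^+ N * t%:C ^+ N.
pose dS M (t : R) := \sum_(N < M) (poch a N)%:C * u ^+ N * (N%:R * t%:C ^+ N.-1).
have hS M t : cderiv (S M) t (dS M t).
  apply: (@cderiv_sum R (fun N s => (poch a N)%:C * u ^+ N * s%:C ^+ N)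
    (fun N => (poch a N)%:C * u ^+ N * (N%:R * t%:C ^+ N.-1))) => N.
  by apply: cderivZ; exact: cderivX.
have ode M t : (1 - t%:C * u) * dS M.+1 t - a%:C * u * S M.+1 t =
    - ((M.+1%:R * poch a M.+1)%:C * u ^+ M.+1 * t%:C ^+ M).
  elim: M => [|M IH].
    rewrite /dS /S !big_ord_recr !big_ord0 /= !expr0 pochS !rcM rcD.
    rewrite -[(poch a 0)%:C]/(1 : C) -[0%:C]/(0 : C) expr1; ring.
  rewrite /dS /S big_ord_recr [in X in _ - X]big_ord_recr /= -/(S M.+1 t) -/(dS M.+1 t).
  rewrite -/(poch a M.+1) mulrDr [a%:C * u * (_ + _)]mulrDr opprD addrACA IH.
  have E : (M.+2%:R * poch a M.+2)%:C = (M.+1%:R + a%:C) * (poch a M.+1)%:C.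
    by rewrite pochS rcM rcD rc_nat.
  rewrite E rcM rc_nat !exprS; ring.
pose D M (t : R) := S M.+1 t * G t.
have dD M t : 0 <= t <= 1 -> cderiv (D M) t
    (- ((M.+1%:R * poch a M.+1)%:C * u ^+ M.+1 * t%:C ^+ M) * (1 - t%:C * u)^-1 * G t).
  move=> ht; apply: cderiv_eq (cderivM (hS M.+1 t) (dG t ht)) _.
  by rewrite -ode; field; exact: segment_neq0.
have Gle t : 0 <= t <= 1 -> abs (G t) <= expR (a * ln 2).
  move=> ht; rewrite abs_cexp cReMr ler_expR ler_wpM2l ?(ltW a0)//.
  have -> : complex.Re (clog (1 - t%:C * u)) = ln (abs (1 - t%:C * u)).
    by rewrite /clog; case: (1 - _).
  rewrite ler_ln ?posrE ?abs_gt0 ?segment_neq0//.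
  case/andP: ht => t0 t1; rewrite (le_trans (le_normcD _ _))// normcN abs1.
  rewrite -[leRHS]/(1 + 1) lerD2l normcM abs_real ger0_norm//.
  by rewrite mulr_ile1// ltW.
have D0 M : D M 0 = 1.
  rewrite /D /S /G mul0r subr0 clog1 mulr0 big_ord_recl/= !expr0 !mulr1 big1.
    by rewrite addr0 mul1r /cexp /= expR0 cos0 sin0 -[LHS]/(1%:C * (1 +i* 0)) mul1r.
  by move=> i _; rewrite (_ : (0 : R)%:C = 0 :> C)// expr0n mulr0.
have G1 : G 1 = cpow (1 - u) a by rewrite /G mul1r.
have G10 : 0 < abs (G 1) by rewrite abs_cexp expR_gt0.
pose B := expR (a * ln 2) / (1 - r).
have B0 : 0 < B by rewrite divr_gt0// expR_gt0.
have key M : abs (D M 1 - 1) <= 2 * (M.+1%:R * poch a M.+1 * r ^+ M.+1 * B).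
  rewrite -(D0 M); apply: cderiv_bound (dD M) _ => t ht.
  have p0 : 0 <= M.+1%:R * poch a M.+1 by rewrite mulr_ge0// ltW// poch_gt0.
  rewrite normcM normcM normcN normcM normcM abs_real ger0_norm// !absX abs_real -/r.
  have tM : `|t| ^+ M <= 1 by case/andP: ht => t0 t1; rewrite ger0_norm// exprn_ile1.
  set A := _ * r ^+ M.+1; have A0 : 0 <= A by rewrite mulr_ge0// exprn_ge0.
  move: A A0 => A A0.
  rewrite -[A * _ * _ * _]mulrA; apply: ler_pM; rewrite ?mulr_ge0 ?exprn_ge0//.
    by rewrite ler_piMr.
  by rewrite /B mulrC ler_pM ?inv_segment_le ?Gle.
rewrite -G1 => e e0.
have c0 : 0 < 2 * B / abs (G 1) by rewrite !divr_gt0// mulr_gt0.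
have [M0 hM0] := poch_geometric_small a0 r0 u1 (divr_gt0 e0 c0).
exists M0.+1 => -[//|M] hM.
have -> : \sum_(N < M.+1) (poch a N)%:C * u ^+ N = S M.+1 1.
  by apply: eq_bigr => N _; rewrite expr1n mulr1.
have Gn : G 1 != 0 by rewrite -abs_gt0.
have -> : (G 1)^-1 - S M.+1 1 = - (D M 1 - 1) / G 1 by rewrite /D; field.
rewrite normcM normcN normcV ler_pdivrMr// (le_trans (key M))//.
have := hM0 M hM; rewrite ler_pdivlMr// => h.
rewrite -ler_pdivrMr//; apply: le_trans h.
by rewrite le_eqVlt; apply/orP; left; apply/eqP; field; rewrite gt_eqF.
Qed.

(** As for the binomial series: the difference of the two sides at [t u] vanishes for
[t = 0], and its derivative is a single term. *)
Lemma log_series : tends (fun M => \sum_(N < M) (N.+1%:R^-1 : R)%:C * u ^+ N.+1)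
  (- clog (1 - u)).
Proof.
pose D M (t : R) := - clog (1 - t%:C * u) -
  \sum_(N < M) (N.+1%:R^-1 : R)%:C * u ^+ N.+1 * t%:C ^+ N.+1.
have dD M t : 0 <= t <= 1 -> cderiv (D M) t
    (u ^+ M.+1 * t%:C ^+ M * (1 - t%:C * u)^-1).
  move=> ht.
  have h1 := cderivZ (-1) (cderiv_clog u1 ht).
  have h2 := @cderiv_sum R (fun N s => (N.+1%:R^-1 : R)%:C * u ^+ N.+1 * s%:C ^+ N.+1)
    _ t M (fun N => cderivZ ((N.+1%:R^-1 : R)%:C * u ^+ N.+1) (cderivX N.+1 t)).
  have := cderivD h1 (cderivZ (-1) h2).
  have -> : (fun s : R => -1 * clog (1 - s%:C * u) + -1 *
     \sum_(N < M) (N.+1%:R^-1 : R)%:C * u ^+ N.+1 * s%:C ^+ N.+1) = D M.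
    by apply/funext => s; rewrite /D !mulN1r.
  move=> h; apply: cderiv_eq h _ => {h2 h1}.
  have E : (1 - t%:C * u) * \sum_(N < M) (N.+1%:R^-1 : R)%:C * u ^+ N.+1 *
      (N.+1%:R * t%:C ^+ N.+1.-1) = u - u ^+ M.+1 * t%:C ^+ M.
    elim: M => [|M IH]; first by rewrite big_ord0 mulr0 expr0 mulr1 expr1 subrr.
    rewrite big_ord_recr mulrDr IH /=.
    have Mn : (M.+1%:R^-1 : R)%:C * M.+1%:R = 1.
      by rewrite rcV rc_nat mulVf// pnatr_eq0.
    have -> : (M.+1%:R^-1 : R)%:C * u ^+ M.+1 * (M.+1%:R * t%:C ^+ M) =
      ((M.+1%:R^-1 : R)%:C * M.+1%:R) * (u ^+ M.+1 * t%:C ^+ M) by ring.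
    by rewrite Mn mul1r !exprS; ring.
  have n0 := segment_neq0 ht.
  move: E; set T := \sum_(N < M) _ => E; apply: (mulfI n0).
  have -> : (1 - t%:C * u) * (-1 * (- u / (1 - t%:C * u)) + -1 * T) =
    u - (1 - t%:C * u) * T by field; exact: n0.
  by rewrite E; field; exact: n0.
have D0 M : D M 0 = 0.
  rewrite /D mul0r subr0 clog1 oppr0 sub0r big1 ?oppr0// => i _.
  by rewrite (_ : (0 : R)%:C = 0 :> C)// expr0n mulr0.
have key M : abs (D M 1) <= 2 * (r ^+ M.+1 * (1 - r)^-1).
  rewrite -[D M 1]subr0 -(D0 M); apply: cderiv_bound (dD M) _ => t ht.
  rewrite normcM normcM !absX abs_real -/r; apply: ler_pM; rewrite ?mulr_ge0 ?exprn_ge0//.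
    case/andP: ht => t0 t1; rewrite ler_piMr ?exprn_ge0// ger0_norm// exprn_ile1//.
  exact: inv_segment_le.
move=> e e0.
have e1 : 0 < e * (1 - r) / 2 by rewrite divr_gt0// mulr_gt0.
have [M0 hM0] := geometric_small r0 u1 e1.
exists M0 => M hM.
have -> : - clog (1 - u) - \sum_(N < M) (N.+1%:R^-1 : R)%:C * u ^+ N.+1 = D M 1.
  rewrite /D mul1r; congr (_ - _); apply: eq_bigr => N _.
  by rewrite expr1n mulr1.
rewrite (le_trans (key M))// mulrA ler_pdivrMr// mulrC -ler_pdivlMr//.
by apply: hM0; apply: leqW.
Qed.

Lemma clogV (z : C) : 0 < complex.Re z -> clog z^-1 = - clog z.
Proof.
case: z => x y /= x0; rewrite /clog /=.
have s0 : 0 < x ^+ 2 + y ^+ 2 by rewrite ltr_pwDl ?exprn_gt0 ?sqr_ge0.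
have -> : (x / (x ^+ 2 + y ^+ 2)) ^+ 2 + (- (y / (x ^+ 2 + y ^+ 2))) ^+ 2 =
  (x ^+ 2 + y ^+ 2)^-1 by field; rewrite gt_eqF.
have -> : - (y / (x ^+ 2 + y ^+ 2)) / (x / (x ^+ 2 + y ^+ 2)) = - (y / x).
  by field; rewrite !gt_eqF.
by rewrite sqrtrV ?(ltW s0)// lnV ?posrE ?sqrtr_gt0// atanN.
Qed.

(** The Taylor coefficients, in [<z, w>], of the kernel with parameter [a]. *)
Definition kernel_coef (a : R) (n : nat) : R := if a == 0 then n.+1%:R^-1 else poch a n.

Lemma kernel_series (a : R) : 0 <= a ->
  tends (fun M => \sum_(N < M) (kernel_coef a N)%:C * u ^+ N)
    (if a == 0 then (if u == 0 then 1 else u^-1 * clog ((1 - u)^-1))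
     else (cpow (1 - u) a)^-1).
Proof.
move=> a0; rewrite /kernel_coef; have [an|an] := eqVneq a 0; last first.
  by apply: binomial_series; rewrite lt_neqAle eq_sym an.
have [un|un] := eqVneq u 0.
  move=> e e0; exists 1%N => -[//|M] _.
  rewrite big_ord_recl/= expr0 invr1 mulr1 big1 ?addr0 ?subrr ?abs0 ?ltW//.
  by move=> i _; rewrite un exprS mul0r mulr0.
rewrite clogV; last first.
  have h : (0 : R) <= (1 : R) <= 1 by rewrite ler01 lexx.
  by have := segment_Re_gt0 u1 h; rewrite mul1r.
apply: tends_ext (tendsZ u^-1 log_series) => M.
rewrite mulr_sumr; apply: eq_bigr => N _; rewrite exprS mulrCA.
by rewrite mulKf.
Qed.

End KernelSeries.

(** * The multinomial formula *)

Section MultiIndices.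
Variable d : nat.

Definition mindex := {ffun 'I_d -> nat}.
Definition mdeg (g : mindex) : nat := (\sum_i g i)%N.
Definition mfact (g : mindex) : nat := (\prod_i (g i)`!)%N.

(** The multi-indices of degree below [M].  Their entries are below [M], so they can be
listed from the finite type of functions to ['I_M]. *)
Definition mindices (M : nat) : seq mindex :=
  [seq ([ffun i => nat_of_ord (h i)] : mindex) |
    h : {ffun 'I_d -> 'I_M} <- [seq h : {ffun 'I_d -> 'I_M} <- index_enum {ffun 'I_d -> 'I_M} | (\sum_i h i < M)%N]].

Lemma mem_mindices M g : (g \in mindices M) = (mdeg g < M)%N.
Proof.
apply/mapP/idP => [[h]|hg].
  rewrite mem_filter => /andP[hM _] ->; rewrite /mdeg.
  by under eq_bigr => i _ do rewrite ffunE.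
have gM i : (g i < M)%N by rewrite (leq_ltn_trans _ hg)// /mdeg (bigD1 i)//= leq_addr.
exists [ffun i => Ordinal (gM i)]; last by apply/ffunP => i; rewrite !ffunE.
rewrite mem_filter mem_index_enum andbT.
by under eq_bigr => i _ do rewrite ffunE.
Qed.

Lemma uniq_mindices M : uniq (mindices M).
Proof.
rewrite map_inj_uniq ?filter_uniq ?index_enum_uniq// => h h' /ffunP e.
by apply/ffunP => i; apply/val_inj; have := e i; rewrite !ffunE.
Qed.

Section Multinomial.
Variable F : numFieldType.

Definition exp_poly M (x : F) : {poly F} := \poly_(j < M) (x ^+ j / j`!%:R).

(** The exponential series turn the multinomial formula into the
multiplicativity of exponentials. *)
Lemma coef_prod_exp_poly M (s : seq F) N : (N < M)%N ->
  (\prod_(x <- s) exp_poly M x)`_N = (\sum_(x <- s) x) ^+ N / N`!%:R.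
Proof.
elim: s N => [|x s IH] N NM.
  rewrite !big_nil coef1 expr0n; case: N NM => [|N] _ /=; first by rewrite fact0 divr1.
  by rewrite mul0r.
rewrite !big_cons coefMr exprDn mulr_suml; apply: eq_bigr => i _.
have iN : (i <= N)%N by rewrite -ltnS.
rewrite IH ?(leq_ltn_trans iN)// /exp_poly coef_poly.
rewrite (leq_ltn_trans (leq_subr _ _) NM) -[_ *+ 'C(N, i)]mulr_natr -!mulrA; congr (_ * _).
rewrite mulrCA; congr (_ * _).
rewrite -(bin_fact iN) !natrM.
have b0 : 'C(N, i)%:R != 0 :> F by rewrite pnatr_eq0 -lt0n bin_gt0.
have f1 : i`!%:R != 0 :> F by rewrite pnatr_eq0 -lt0n fact_gt0.
have f2 : (N - i)`!%:R != 0 :> F by rewrite pnatr_eq0 -lt0n fact_gt0.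
by field; rewrite b0 f1 f2.
Qed.

Lemma multinomial (c : nat -> F) (x : 'I_d -> F) M :
  \sum_(N < M) c N * (\sum_i x i) ^+ N =
  \sum_(g <- mindices M) c (mdeg g) * ((mdeg g)`!%:R / (mfact g)%:R) * \prod_i x i ^+ g i.
Proof.
rewrite /mindices big_map big_filter.
have -> : \sum_(N < M) c N * (\sum_i x i) ^+ N = \sum_(N < M)
    \sum_(h : {ffun 'I_d -> 'I_M} | (\sum_i h i == N)%N)
      c N * N`!%:R * \prod_i (x i ^+ h i / (h i)`!%:R).
  apply: eq_bigr => N _; rewrite -mulr_sumr -mulrA; congr (_ * _).
  have := @coef_prod_exp_poly M (map x (index_enum 'I_d)) N (ltn_ord N).
  rewrite !big_map => e.
  have N0 : N`!%:R != 0 :> F by rewrite pnatr_eq0 -lt0n fact_gt0.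
  rewrite -[LHS](divfK N0) -e mulrC; congr (_ * _).
  have -> : \prod_i exp_poly M (x i) =
      \prod_i \sum_(j < M) (x i ^+ j / j`!%:R)%:P * 'X^j.
    by apply: eq_bigr => i _; rewrite /exp_poly poly_def; apply: eq_bigr => j _; rewrite mul_polyC.
  rewrite bigA_distr_bigA coef_sum [RHS]big_mkcond; apply: eq_bigr => h _.
  rewrite big_split/= -rmorph_prod prodrXr coefCM coefXn eq_sym.
  by case: eqP => _; rewrite ?mulr1 ?mulr0.
rewrite [RHS](eq_bigr (fun h : {ffun 'I_d -> 'I_M} =>
    c (\sum_i h i)%N * ((\sum_i h i)`!)%:R * \prod_i (x i ^+ h i / (h i)`!%:R))); last first.
  move=> h _; rewrite /mdeg /mfact.
  have -> : (\sum_i [ffun i0 => nat_of_ord (h i0)] i = \sum_i h i)%N.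
    by apply: eq_bigr => i _; rewrite ffunE.
  rewrite natr_prod big_split/= -prodfV -!mulrA; congr (_ * (_ * _)).
  rewrite mulrC; congr (_ * _); first by apply: eq_bigr => i _; rewrite ffunE.
  by apply: eq_bigr => i _; rewrite ffunE.
rewrite [RHS](eq_bigr (fun h : {ffun 'I_d -> 'I_M} => \sum_(N < M | (\sum_i h i == N)%N)
    c N * N`!%:R * \prod_i (x i ^+ h i / (h i)`!%:R))); last first.
  by move=> h hM; rewrite (big_pred1 (Ordinal hM)).
rewrite [RHS](exchange_big_dep xpredT)//=; apply: eq_bigr => N _.
apply: eq_bigl => h; rewrite andb_idl// => /eqP ->; exact: ltn_ord.
Qed.

End Multinomial.
End MultiIndices.

(** * Monomials on the ball *)

Section BallFeatures.
Variables (R : realType) (d : nat).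
Local Notation C := R[i].
Local Notation abs := (@normc R).
Local Notation cj := (@conjc R).
Local Notation B := (unit_ball R d).
Implicit Types (z w : B) (g : mindex d).

Definition monomial g z : C := \prod_i sval z 0 i ^+ g i.

Lemma ball_dotE z w : ball_dot z w = \sum_i sval z 0 i * cj (sval w 0 i).
Proof. by []. Qed.

Lemma ball_sqr_lt1 z : \sum_i abs (sval z 0 i) ^+ 2 < 1.
Proof.
case: z => z hz /=; rewrite -ltcR rc_sum; under eq_bigr => i _ do rewrite rcX.
exact: hz.
Qed.

Lemma abs_ball_dot z w : abs (ball_dot z w) < 1.
Proof.
rewrite ball_dotE (le_lt_trans (abs_sum _ _ _))//.
apply: (@le_lt_trans _ _ (\sum_i (abs (sval z 0 i) ^+ 2 + abs (sval w 0 i) ^+ 2) / 2)).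
  apply: ler_sum => i _; rewrite normcM abs_conj.
  by have := sqr_ge0 (abs (sval z 0 i) - abs (sval w 0 i)); nra.
rewrite -mulr_suml big_split/=.
by have := ball_sqr_lt1 z; have := ball_sqr_lt1 w; lra.
Qed.

Section Weights.
Variable a : R.
Hypothesis a0 : 0 <= a.

(** [kweight g] is the coefficient of [z^g conj (w^g)] in the kernel, that is, the
inverse of the squared norm of [z^g]. *)
Definition ecoef (N : nat) : R := kernel_coef a N * N`!%:R.
Definition kweight g : R := ecoef (mdeg g) / (mfact g)%:R.

Lemma kernel_coef_gt0 N : 0 < kernel_coef a N.
Proof.
rewrite /kernel_coef; have [_|an] := eqVneq a 0; first by rewrite invr_gt0 ltr0n.
by apply: poch_gt0; rewrite lt_neqAle eq_sym an.
Qed.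

Lemma ecoef_gt0 N : 0 < ecoef N.
Proof. by rewrite mulr_gt0 ?kernel_coef_gt0// ltr0n fact_gt0. Qed.

Lemma mfact_gt0 g : (0 < mfact g)%N.
Proof. by rewrite prodn_gt0// => i; exact: fact_gt0. Qed.

Lemma kweight_gt0 g : 0 < kweight g.
Proof. by rewrite divr_gt0 ?ecoef_gt0// ltr0n mfact_gt0. Qed.

(** The multinomial formula is applied to the powers of [<z, w>]. *)
Lemma kernel_expand z w : tends
  (fun M => \sum_(g <- mindices d M) (kweight g)%:C * (monomial g z * cj (monomial g w)))
  (dirichlet_kernel a z w).
Proof.
apply: tends_ext (kernel_series (abs_ball_dot z w) a0) => M.
rewrite (multinomial (fun N => (kernel_coef a N)%:C) (fun i => sval z 0 i * cj (sval w 0 i)) M).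
apply: eq_bigr => g _; congr (_ * _).
  by rewrite /kweight /ecoef -mulrA !rcM rcV !rc_nat.
rewrite /monomial cj_prod -big_split/=; apply: eq_bigr => i _.
by rewrite exprMn cjX.
Qed.

Lemma mindices_exhaust g : exists M0, forall M, (M0 <= M)%N -> g \in mindices d M.
Proof. by exists (mdeg g).+1 => M h; rewrite mem_mindices. Qed.

End Weights.

Section Rotation.
Variables (i : 'I_d) (c : C).
Hypothesis c1 : abs c = 1.

Lemma rotate_ok z : \sum_(j < d)
  `|(\row_j (if j == i then c * sval z 0 j else sval z 0 j)) 0 j| ^+ 2 < 1.
Proof.
case: z => z hz /=; rewrite (eq_bigr (fun j => `|z 0 j| ^+ 2))// => j _.
by rewrite mxE; case: eqP => // _; rewrite normrM -[`|c|]/((abs c)%:C) c1 mul1r.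
Qed.

Definition rotate z : B :=
  exist (fun v : 'rV[C]_d => \sum_(j < d) `|v 0 j| ^+ 2 < 1) _ (rotate_ok z).

Lemma rotate_dot z w : ball_dot (rotate z) (rotate w) = ball_dot z w.
Proof.
rewrite !ball_dotE; apply: eq_bigr => j _; rewrite /= !mxE; case: eqP => // _.
by rewrite cjM mulrACA mul_conj c1 expr1n mul1r.
Qed.

Lemma rotate_monomial g z : monomial g (rotate z) = c ^+ g i * monomial g z.
Proof.
rewrite /monomial (bigD1 i)// [in RHS](bigD1 i)//= mxE eqxx exprMn -!mulrA.
congr (_ * (_ * _)); apply: eq_bigr => j ji.
by rewrite mxE (negbTE ji).
Qed.

End Rotation.

Lemma root_of_minus_one (n : nat) : (0 < n)%N -> exists c : C, abs c = 1 /\ c ^+ n = -1.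
Proof.
move=> n0; exists (n.-root (-1)); split; last by rewrite rootCK.
have : abs (n.-root (-1 : C)) ^+ n = 1 by rewrite -absX rootCK// normcN abs1.
by move=> /eqP; rewrite pexpr_eq1// => /eqP.
Qed.

(** If [g] and [g'] differ in the [i]-th entry, then rotating the [i]-th coordinate by a
root of order [g' i - g i] of [-1] multiplies the two monomials by opposite scalars. *)
Lemma monomials_orthogonal (a : R) (H : rkhs (@dirichlet_kernel R d a)) (m : mindex d -> H) :
  (forall g, rkhs_fun H (m g) = monomial g) ->
  forall g g', g != g' -> rkhs_dot H (m g) (m g') = 0.
Proof.
move=> mE; have lt i g g' : (g i < g' i)%N -> rkhs_dot H (m g) (m g') = 0.
  move=> gi; have [|c [c1 cn]] := @root_of_minus_one (g' i - g i); first by rewrite subn_gt0.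
  apply: (@orthogonal_eigen _ _ _ H (rotate i c1) _ _ (c ^+ g i)).
  - by move=> z w; rewrite /dirichlet_kernel rotate_dot.
  - by rewrite absX c1 expr1n.
  - by move=> z; rewrite mE rotate_monomial.
  - by move=> z; rewrite mE rotate_monomial -(subnKC (ltnW gi)) exprD cn mulrN1.
move=> g g' gg'.
have [i gi] : exists i, g i != g' i.
  apply/existsP; apply: contraNT gg' => /existsPn h; apply/eqP/ffunP => i.
  by apply/eqP; have := h i; rewrite negbK.
move: gi; rewrite neq_ltn => /orP[/lt//|/lt h].
by rewrite dotC h conjc0.
Qed.

Section Shift.
Variable m : nat.
Hypothesis m0 : (0 < m)%N.
Hypothesis md : (m <= d)%N.

(** Multiplication by [(z_1 .. z_m)^n] on the exponents. *)
Definition mshift (n : nat) g : mindex d := [ffun i => (g i + n * (i < m))%N].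

Lemma mshift_inj n : injective (mshift n).
Proof.
by move=> g g' /ffunP e; apply/ffunP => i; have := e i; rewrite !ffunE => /addIn.
Qed.

Lemma mshiftS n g : mshift n.+1 g = mshift 1 (mshift n g).
Proof. by apply/ffunP => i; rewrite !ffunE mul1n mulSn addnAC addnA. Qed.

Lemma mshift0 g : mshift 0 g = g.
Proof. by apply/ffunP => i; rewrite !ffunE mul0n addn0. Qed.

Lemma card_lt_m : #|[pred i : 'I_d | (i < m)%N]| = m.
Proof.
have wi : injective (widen_ord md) by move=> x y /(congr1 val) /= e; apply/val_inj.
rewrite -[RHS]card_ord -(fintype.card_image wi).
apply: eq_card => i; rewrite inE; apply/idP/fintype.imageP => [im|[j _ ->]] /=.
  by exists (Ordinal im) => //; apply/val_inj.
exact: ltn_ord.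
Qed.

Lemma mdeg_shift n g : mdeg (mshift n g) = (mdeg g + n * m)%N.
Proof.
rewrite /mdeg; under eq_bigr => i _ do rewrite ffunE.
rewrite big_split/= -big_distrr/=; congr (_ + _ * _)%N.
rewrite -[RHS]card_lt_m -sum1_card [RHS]big_mkcond; apply: eq_bigr => i _ /=.
by rewrite inE; case: (i < m)%N.
Qed.

(** The factor [sqrt (m^m)] makes the supremum over the ball equal to [1]. *)
Definition diag_monomial (z : B) : C :=
  (Num.sqrt (m%:R ^+ m : R))%:C * \prod_(i < d | (i < m)%N) sval z 0 i.

Lemma diag_monomial_shift n g z : diag_monomial z ^+ n * monomial g z =
  (Num.sqrt (m%:R ^+ m) ^+ n : R)%:C * monomial (mshift n g) z.
Proof.
rewrite /diag_monomial exprMn rcX -mulrA; congr (_ * _).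
rewrite -prodrXl /monomial [X in X * _]big_mkcond -big_split/=; apply: eq_bigr => i _.
rewrite ffunE; case: (i < m)%N; last by rewrite muln0 addn0 mul1r.
by rewrite muln1 addnC exprD.
Qed.

(** The factor by which multiplication by [diag_monomial] increases the squared norm of
[(z_1 .. z_m)^l], where [N = l m] ([weight_step_diag]). *)
Definition theta (a : R) (N : nat) : R :=
  (N + m)%:R ^+ m * ecoef a N / ecoef a (N + m).

Lemma mfact_shift1 g : mfact (mshift 1 g) = (mfact g * \prod_(i < d | (i < m)%N) (g i).+1)%N.
Proof.
rewrite /mfact [X in (_ * X)%N]big_mkcond -big_split/=; apply: eq_bigr => i _.
rewrite ffunE mul1n; case: (i < m)%N; last by rewrite addn0 muln1.
by rewrite addn1 factS mulnC.
Qed.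

Lemma shift1_weight (a : R) g : 0 <= a ->
  theta a (mdeg g) * kweight a (mshift 1 g) =
  (mdeg g + m)%:R ^+ m / (\prod_(i < d | (i < m)%N) (g i).+1)%:R * kweight a g.
Proof.
move=> a0; rewrite /theta /kweight mdeg_shift mul1n mfact_shift1 natrM.
have e0 := gt_eqF (ecoef_gt0 a0 (mdeg g + m)).
have f0 : (mfact g)%:R != 0 :> R by rewrite pnatr_eq0 -lt0n mfact_gt0.
have p0 : (\prod_(i < d | (i < m)%N) (g i).+1)%:R != 0 :> R.
  by rewrite pnatr_eq0 -lt0n prodn_cond_gt0.
by move: (_ ^+ m) => x; field; rewrite e0 f0 p0.
Qed.

(** By the inequality of arithmetic and geometric means for the [m] numbers [g i + 1],
among multi-indices of a given degree the diagonal ones show the largest increase. *)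
Lemma weight_step (a : R) g : 0 <= a ->
  m%:R ^+ m * kweight a g <= theta a (mdeg g) * kweight a (mshift 1 g).
Proof.
move=> a0; rewrite shift1_weight// ler_wpM2r ?(ltW (kweight_gt0 a0 g))//.
rewrite ler_pdivlMr ?ltr0n ?prodn_cond_gt0// natr_prod.
have [+ _] := @leif_AGM_scaled R 'I_d [pred i : 'I_d | (i < m)%N]
  (fun i => (g i).+1%:R) (fun i _ => mulrn_wge0 _ (ler0n R (g i).+1)).
rewrite card_lt_m => H.
have -> : m%:R ^+ m * \prod_(i < d | (i < m)%N) (g i).+1%:R =
    \prod_(i in [pred i : 'I_d | (i < m)%N]) ((g i).+1%:R *+ m) :> R.
  transitivity ((\prod_(i in [pred i : 'I_d | (i < m)%N]) m%:R) *
      \prod_(i in [pred i : 'I_d | (i < m)%N]) (g i).+1%:R : R).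
    by rewrite prodr_const card_lt_m.
  by rewrite -big_split/=; apply: eq_bigr => i _; rewrite mulr_natl.
apply: le_trans H _; rewrite lerXn2r ?nnegrE ?sumr_ge0//.
rewrite -natr_sum ler_nat.
apply: (@leq_trans (mdeg (mshift 1 g))); last by rewrite mdeg_shift mul1n.
rewrite /mdeg [X in (X <= _)%N]big_mkcond/=; apply: leq_sum => i _.
by rewrite ffunE mul1n inE; case: (i < m)%N; rewrite ?addn1.
Qed.

Lemma weight_step_diag (a : R) n : 0 <= a -> let g := mshift n [ffun=> 0%N] in
  m%:R ^+ m * kweight a g = theta a (n * m) * kweight a (mshift 1 g).
Proof.
move=> a0 g; have dg : mdeg g = (n * m)%N.
  by rewrite mdeg_shift /mdeg big1 ?add0n// => i _; rewrite ffunE.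
rewrite -dg shift1_weight//; congr (_ * _).
have -> : (\prod_(i < d | (i < m)%N) (g i).+1 = n.+1 ^ m)%N.
  rewrite (eq_bigr (fun=> n.+1)); last by move=> i im; rewrite !ffunE im muln1.
  by rewrite big_const iter_muln_1 card_lt_m.
by rewrite dg -mulSnr natrM natrX exprMn mulrAC mulfV ?mul1r// expf_neq0// pnatr_eq0.
Qed.

Lemma weight_steps (a : R) n g : 0 <= a ->
  m%:R ^+ m ^+ n * kweight a g <=
  (\prod_(l < n) theta a (mdeg g + l * m)) * kweight a (mshift n g).
Proof.
move=> a0; elim: n => [|n IH]; first by rewrite big_ord0 expr0 mshift0.
have th0 N : 0 <= theta a N.
  have e0 k := ltW (ecoef_gt0 a0 k).
  exact: divr_ge0 (mulr_ge0 (exprn_ge0 _ (ler0n _ _)) (e0 _)) (e0 _).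
rewrite exprS -mulrA (le_trans (ler_wpM2l _ IH)) ?exprn_ge0//.
rewrite mulrCA big_ord_recr/= -mulrA ler_wpM2l ?prodr_ge0//.
by rewrite mshiftS -mdeg_shift; exact: weight_step.
Qed.

Lemma weight_steps_diag (a : R) n : 0 <= a ->
  m%:R ^+ m ^+ n * kweight a [ffun=> 0%N] =
  (\prod_(l < n) theta a (l * m)) * kweight a (mshift n [ffun=> 0%N]).
Proof.
move=> a0; elim: n => [|n IH]; first by rewrite big_ord0 expr0 mshift0.
rewrite exprS -mulrA IH mulrCA big_ord_recr/= -mulrA.
by rewrite weight_step_diag// -mshiftS.
Qed.

End Shift.
End BallFeatures.

(** * Growth of the norms of the diagonal monomials *)

Section Growth.
Variable R : realType.

Lemma harmonic_ge_ln n : ln (1 + n%:R) <= \sum_(l < n) l.+1%:R^-1 :> R.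
Proof.
elim: n => [|n IH]; first by rewrite big_ord0 addr0 ln1.
have n0 : 0 < 1 + n%:R :> R by rewrite ltr_pwDl.
rewrite big_ord_recr/=.
have -> : 1 + n.+1%:R = (1 + n%:R) * (1 + n.+1%:R^-1) :> R.
  by rewrite -natr1 [n%:R + 1]addrC; field; rewrite addrC gt_eqF.
rewrite lnM ?posrE// ?addr_gt0 ?invr_gt0// lerD//.
by rewrite le_ln1Dx// (lt_le_trans (ltrN10 R))// invr_ge0.
Qed.

Lemma harmonic_le_ln n : \sum_(l < n) l.+1%:R^-1 <= 1 + ln (1 + n%:R) :> R.
Proof.
case: n => [|n]; first by rewrite big_ord0 addr0 ln1 addr0.
apply: (@le_trans _ _ (1 + ln n.+1%:R)).
  elim: n => [|n IH]; first by rewrite big_ord_recr big_ord0/= add0r invr1 ln1 addr0.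
  rewrite big_ord_recr/= (le_trans (lerD IH (lexx _)))// -addrA lerD2l -lerBrDl.
  have n1 : 0 < n.+1%:R :> R by rewrite ltr0n.
  have n2 : 0 < n.+2%:R :> R by rewrite ltr0n.
  rewrite -ln_div ?posrE//.
  have -> : (n.+2%:R^-1 : R) = - - n.+2%:R^-1 by rewrite opprK.
  rewrite lerNl -lnV ?posrE ?divr_gt0// invf_div.
  have -> : n.+1%:R / n.+2%:R = 1 + - n.+2%:R^-1 :> R.
    rewrite -[n.+2%:R]natr1; move: (n.+1%:R : R) n1 => x x0; field.
    by rewrite gt_eqF// addr_gt0.
  by rewrite le_ln1Dx// ltrN2 invf_lt1// ltr1n.
by rewrite lerD2l ler_ln ?posrE ?addr_gt0// lerDr.
Qed.

Lemma sum_inv_sqr n : \sum_(l < n) (l.+1%:R ^+ 2)^-1 <= 2 :> R.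
Proof.
case: n => [|n]; first by rewrite big_ord0.
apply: (@le_trans _ _ (2 - n.+1%:R^-1)); last by rewrite gerBl invr_ge0.
elim: n => [|n IH].
  by rewrite big_ord_recr big_ord0/= add0r expr1n invr1; lra.
rewrite big_ord_recr/= (le_trans (lerD IH (lexx _)))// -subr_ge0.
have n1 : 0 < n.+1%:R :> R by rewrite ltr0n.
have -> : 2 - n.+2%:R^-1 - (2 - n.+1%:R^-1 + (n.+2%:R ^+ 2)^-1) =
  (n.+1%:R * (n.+1%:R + 1) ^+ 2)^-1 :> R.
  rewrite -[n.+2%:R]natr1; move: (n.+1%:R : R) n1 => x x0; field.
  by rewrite (gt_eqF x0) gt_eqF// addr_gt0.
by rewrite invr_ge0 mulr_ge0// ?sqr_ge0.
Qed.

Variables (a : R) (m : nat).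
Hypothesis m0 : (0 < m)%N.
Local Notation s := ((m%:R + 1) / 2 - a).

Lemma sum_arith (c : R) k :
  \sum_(j < k) (c - j%:R) = k%:R * (c - (k%:R - 1) / 2).
Proof.
elim: k => [|k IH]; first by rewrite big_ord0 mul0r.
by rewrite big_ord_recr/= IH -natr1; field.
Qed.

Lemma ecoefS N : a != 0 -> ecoef a N.+1 = (N%:R + a) * ecoef a N.
Proof.
move=> an; rewrite /ecoef /kernel_coef (negbTE an) factS natrM mulrA.
by rewrite [poch a N.+1 * _]mulrC pochS mulrA.
Qed.

Lemma theta_prod N : 0 < a ->
  theta m a N = \prod_(j < m) ((N + m)%:R / (N%:R + j%:R + a)).
Proof.
move=> a0; have an : a != 0 by rewrite gt_eqF.
have e0 := gt_eqF (ecoef_gt0 (ltW a0) N).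
have E k : ecoef a (N + k) = (\prod_(j < k) (N%:R + j%:R + a)) * ecoef a N.
  elim: k => [|k IH]; first by rewrite addn0 big_ord0 mul1r.
  by rewrite addnS ecoefS// IH big_ord_recr/= natrD mulrA [_ * \prod_(_ < _) _]mulrC.
rewrite /theta E big_split/= prodr_const card_ord prodfV -mulrA; congr (_ * _).
by rewrite invfM mulrCA mulfV ?mulr1// e0.
Qed.

Hypothesis s0 : 0 < s.

Section Positive.
Hypothesis a0 : 0 < a.
Hypothesis am : a <= m%:R.

(** With [X = (l + 1) m], the factors of [theta_prod] are [1 / (1 - y_j)] for
[y_j = (m - a - j) / X].  They are at least [exp y_j], and the sum of the [y_j] is
[s / (l + 1)]. *)
Lemma theta_ge l : expR (s / l.+1%:R) <= theta m a (l * m).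
Proof.
have mR : 0 < m%:R :> R by rewrite ltr0n.
have lR : 0 < l.+1%:R :> R by rewrite ltr0n.
rewrite theta_prod//; set N := (l * m)%N; set X : R := (N + m)%:R.
have X0 : 0 < X by rewrite ltr0n addn_gt0 m0 orbT.
have XE : X = l.+1%:R * m%:R by rewrite /X /N -natrM mulSnr.
have -> : s / l.+1%:R = \sum_(j < m) (m%:R - a - j%:R) / X.
  rewrite -mulr_suml sum_arith XE; field.
  by rewrite (gt_eqF mR) /= addrC natr1 gt_eqF.
rewrite expR_sum; apply: ler_prod => j _; rewrite expR_ge0/=.
have q0 : 0 < N%:R + j%:R + a by rewrite ltr_wpDl// addr_ge0.
rewrite -[leRHS]invrK -[leLHS]invrK lef_pV2 ?posrE ?invr_gt0 ?divr_gt0 ?expR_gt0//.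
rewrite -expRN invf_div (le_trans _ (expR_ge1Dx _))//.
have -> : (N%:R + j%:R + a) / X = 1 + - ((m%:R - a - j%:R) / X).
  by rewrite /X natrD; field; rewrite -natrD gt_eqF.
exact: lexx.
Qed.

(** The factors satisfy [1 / (1 - y) <= exp (y + y^2 / (1 - y))], and the quadratic terms
are summable in [l], uniformly in the starting degree [G]. *)
Lemma theta_le G l : theta m a (G + l * m) <=
  expR (s / l.+1%:R + m%:R ^+ 4 / a * (l.+1%:R ^+ 2)^-1).
Proof.
have mR : 0 < m%:R :> R by rewrite ltr0n.
have m1 : 1 <= m%:R :> R by rewrite ler1n.
have lR : 0 < l.+1%:R :> R by rewrite ltr0n.
rewrite theta_prod//; set N := (G + l * m)%N; set X : R := (N + m)%:R.
have X0 : 0 < X by rewrite ltr0n addn_gt0 m0 orbT.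
have XE : X = N%:R + m%:R by rewrite /X natrD.
have Xl : l.+1%:R * m%:R <= X by rewrite /X /N -natrM ler_nat mulSnr -addnA leq_addl.
apply: (@le_trans _ _ (expR (\sum_(j < m) ((m%:R - a - j%:R) / X + m%:R ^+ 3 / a / X ^+ 2)))).
  rewrite expR_sum; apply: ler_prod => j _.
  have q0 : 0 < N%:R + j%:R + a by rewrite ltr_wpDl// addr_ge0.
  rewrite divr_ge0 ?(ltW X0) ?(ltW q0)//=.
  set q := N%:R + j%:R + a in q0 *.
  have -> : X / q = 1 + (X - q) / q by rewrite mulrBl divff ?gt_eqF// addrC subrK.
  rewrite (le_trans (expR_ge1Dx _))// ler_expR.
  have -> : m%:R - a - j%:R = X - q by rewrite XE /q; ring.
  have -> : (X - q) / q = (X - q) / X + (X - q) ^+ 2 / (q * X).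
    by move: X X0 q q0 {XE Xl} => x x0 y y0; field; rewrite !gt_eqF.
  rewrite lerD2l.
  have jm : j.+1%:R <= m%:R :> R by rewrite ler_nat.
  have d2 : (X - q) ^+ 2 <= m%:R ^+ 2.
    rewrite -ler_sqrt ?exprn_gt0// !sqrtr_sqr [leRHS]ger0_norm ?ler0n//.
    have -> : X - q = m%:R - j%:R - a by rewrite XE /q; ring.
    by rewrite ler_norml; move: jm; rewrite -natr1; have : 0 <= j%:R :> R by []; move: am a0; lra.
  have qX : a * X <= m%:R * q.
    rewrite XE /q; have : 0 <= N%:R :> R by []; have : 0 <= j%:R :> R by [].
    by set n := N%:R; set jj := j%:R; move: am a0 mR; set M := m%:R; nra.
  rewrite ler_pdivrMr ?mulr_gt0//.
  apply: (le_trans d2).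
  have aux (x y M : R) : 0 < x ->
      M ^+ 3 / a / x ^+ 2 * (y * x) = M ^+ 2 * ((M * y) / (a * x)).
    by move=> x0; field; rewrite !gt_eqF.
  by rewrite aux// ler_peMr ?sqr_ge0// ler_pdivlMr ?mulr_gt0// mul1r.
rewrite ler_expR big_split/= -mulr_suml sum_arith sumr_const card_ord lerD//.
  have -> : m%:R * (m%:R - a - (m%:R - 1) / 2) / X = m%:R * s / X by congr (_ * _ / _); field.
  rewrite ler_pdivrMr// mulrAC ler_pdivlMr//.
  apply: le_trans (ler_wpM2l (ltW s0) Xl).
  by rewrite le_eqVlt; apply/orP; left; apply/eqP; ring.
rewrite -[_ *+ m]mulr_natr.
have -> : m%:R ^+ 3 / a / X ^+ 2 * m%:R = m%:R ^+ 4 / a * (X ^+ 2)^-1.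
  by rewrite [m%:R ^+ 4]exprS; ring.
rewrite ler_wpM2l ?divr_ge0 ?exprn_ge0 ?(ltW a0)//.
rewrite lef_pV2 ?posrE ?exprn_gt0// lerXn2r ?nnegrE ?(ltW X0)//.
by rewrite (le_trans _ Xl)// ler_peMr.
Qed.

End Positive.

(** The products are exponentials of [s] times harmonic sums, up to a bounded factor.
For [a = 0] and [m = 1] they telescope. *)
Lemma theta_growth : 0 <= a -> a <= m%:R -> (a == 0 -> m = 1%N) ->
  exists c : R, [/\ 0 < c,
    forall G n, \prod_(l < n) theta m a (G + l * m) <= c * (1 + n%:R) `^ s &
    forall n, (1 + n%:R) `^ s <= \prod_(l < n) theta m a (l * m)].
Proof.
move=> a0 am am1.
have p0 n : 0 < 1 + n%:R :> R by rewrite ltr_pwDl.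
have powE n : (1 + n%:R) `^ s = expR (s * ln (1 + n%:R)) by rewrite /powR gt_eqF.
have [az|an] := eqVneq a 0.
  have mm := am1 (introT eqP az).
  have thE N : theta m a N = N.+2%:R / N.+1%:R.
    rewrite /theta /ecoef /kernel_coef az eqxx mm expr1 addn1 factS natrM.
    have f0 : N`!%:R != 0 :> R by rewrite pnatr_eq0 -lt0n fact_gt0.
    have n1 : N.+1%:R != 0 :> R by rewrite pnatr_eq0.
    have n2 : N.+2%:R != 0 :> R by rewrite pnatr_eq0.
    move: (N`!%:R : R) f0 (N.+1%:R : R) n1 (N.+2%:R : R) n2 => f f0 x x0 y y0.
    by field; rewrite f0 x0 y0.
  have prodE G n : \prod_(l < n) theta m a (G + l * m) = (G + n).+1%:R / G.+1%:R.
    elim: n => [|n IH]; first by rewrite big_ord0 addn0 divff// pnatr_eq0.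
    by rewrite big_ord_recr/= IH thE mm muln1 addnS mulrC mulrA divfK// pnatr_eq0.
  have sE : s = 1 by rewrite az mm; field.
  exists 1; split => // [G n|n]; rewrite ?sE powRr1 ?(ltW (p0 n))//.
    rewrite prodE mul1r ler_pdivrMr ?ltr0n// nat1r -natrM ler_nat; lia.
  by rewrite -[leRHS]/(\prod_(l < n) theta m a (0 + l * m)) prodE add0n divr1 nat1r.
have a1 : 0 < a by rewrite lt_neqAle eq_sym an.
pose D := m%:R ^+ 4 / a; have D0 : 0 <= D by rewrite divr_ge0 ?exprn_ge0.
exists (expR (s + D * 2)); split; first exact: expR_gt0.
  move=> G n; rewrite powE -expRD.
  apply: (@le_trans _ _ (expR (\sum_(l < n) (s / l.+1%:R + D * (l.+1%:R ^+ 2)^-1)))).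
    rewrite expR_sum; apply: ler_prod => l _; apply/andP; split; last exact: theta_le.
    have e0 k := ltW (ecoef_gt0 a0 k).
    exact: divr_ge0 (mulr_ge0 (exprn_ge0 _ (ler0n _ _)) (e0 _)) (e0 _).
  rewrite ler_expR big_split/= -!mulr_sumr.
  rewrite [s + D * 2 + _]addrAC -[X in _ <= X + _ + _]mulr1 -mulrDr lerD//.
    by rewrite ler_wpM2l ?(ltW s0)// harmonic_le_ln.
  by rewrite ler_wpM2l// sum_inv_sqr.
move=> n; rewrite powE.
apply: (@le_trans _ _ (expR (\sum_(l < n) s / l.+1%:R))).
  by rewrite ler_expR -mulr_sumr ler_wpM2l ?(ltW s0)// harmonic_ge_ln.
rewrite expR_sum; apply: ler_prod => l _; rewrite expR_ge0 /=; exact: theta_ge.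
Qed.

End Growth.

(** * Power weights, matrix norms and the algebra of multipliers *)

Section PowerWeight.
Variables (R : realType) (b : R).
Hypothesis b0 : 0 < b.
Let p_gt0 (n : nat) : 0 < 1 + n%:R :> R. Proof. by rewrite ltr_pwDl. Qed.

Fact pow_weight0 : (1 + 0%:R : R) `^ b = 1. Proof. by rewrite addr0 powR1. Qed.

Fact pow_weight_mono :
  {homo (fun n : nat => (1 + n%:R : R) `^ b) : i j / (i <= j)%N >-> i <= j}.
Proof.
move=> i j ij; apply: ge0_ler_powR; rewrite ?nnegrE ?(ltW b0) ?(ltW (p_gt0 _))//.
by rewrite lerD2l ler_nat.
Qed.

Fact pow_weightD i j :
  (1 + (i + j)%:R : R) `^ b <= (1 + i%:R) `^ b * (1 + j%:R) `^ b.
Proof.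
rewrite -powRM ?(ltW (p_gt0 _))//.
apply: ge0_ler_powR; rewrite ?nnegrE ?(ltW b0) ?mulr_ge0 ?(ltW (p_gt0 _))//.
by rewrite !nat1r -natrM ler_nat; nia.
Qed.

Definition pow_weight : weight R := Weight pow_weight0 pow_weight_mono pow_weightD.

Lemma pow_weight_gt0 n : 0 < pow_weight n.
Proof. exact: powR_gt0. Qed.

Lemma pow_weight_sqr n : pow_weight n ^+ 2 = (1 + n%:R) `^ (b * 2).
Proof. by rewrite /= powRrM powR_mulrn ?powR_ge0. Qed.

Lemma pow_weight_unbounded : unbounded_weight pow_weight.
Proof.
move=> A; exists (Num.truncn (`|A| `^ b^-1)) => n hn.
apply: (le_trans (ler_norm A)).
have -> : `|A| = (`|A| `^ b^-1) `^ b by rewrite -powRrM mulVf ?gt_eqF// powRr1.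
apply: ge0_ler_powR; rewrite ?nnegrE ?powR_ge0 ?(ltW b0) ?(ltW (p_gt0 _))//.
by rewrite nat1r (le_trans (ltW (truncnS_gt _)))// ler_nat ltnS.
Qed.

Hypothesis b1 : b <= 2^-1.

(** For [b <= 1/2] stretching by [q^2] costs at most [q (K + 1)], which is less than
[eta q^2] for large [q]. *)
Lemma pow_weight_sublinear : sublinear_weight pow_weight.
Proof.
move=> K eta eta0.
pose q := (Num.truncn (K.+1%:R / eta)).+1.
exists (q * q)%N => // n n0.
have h1 : (1 + (n * (q * q) * K)%:R : R) <= (q%:R ^+ 2 * K.+1%:R) * (1 + n%:R).
  by rewrite !nat1r -natrX -!natrM ler_nat; nia.
have q0 : 0 <= q%:R ^+ 2 * K.+1%:R :> R by rewrite mulr_ge0// sqr_ge0.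
rewrite /= (le_trans (ge0_ler_powR _ _ _ h1)) ?nnegrE ?mulr_ge0 ?(ltW b0) ?(ltW (p_gt0 _))//.
rewrite powRM ?(ltW (p_gt0 _))// ler_wpM2r ?powR_ge0//.
rewrite powRM ?sqr_ge0//.
have q1 : 1 <= q%:R :> R by rewrite ler1n.
have le1 : (q%:R ^+ 2) `^ b <= q%:R.
  rewrite (le_trans (ler_powR _ b1)) ?exprn_ege1//.
  by rewrite powR12_sqrt ?sqr_ge0// sqrtr_sqr ger0_norm.
have le2 : K.+1%:R `^ b <= K.+1%:R :> R.
  have b1' : b <= 1 by rewrite (le_trans b1)// invf_le1// ler1n.
  by rewrite (le_trans (ler_powR _ b1')) ?powRr1// ler1n.
rewrite (le_trans (ler_pM _ _ le1 le2)) ?powR_ge0// natrM [leRHS]mulrCA ler_wpM2l//.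
by rewrite mulrC -ler_pdivrMr// ltW// truncnS_gt.
Qed.

End PowerWeight.

Section MatrixNorms.
Variable R : realType.
Local Notation C := R[i].
Local Notation abs := (@normc R).

Lemma l2norm_entry k (v : 'cV[C]_k) i : ((abs (v i 0))%:E <= cV_l2norm v)%E.
Proof.
rewrite /cV_l2norm lee_fin -[abs _]ger0_norm// -sqrtr_sqr ler_sqrt; last first.
  by rewrite sumr_ge0// => j _; rewrite addr_ge0// sqr_ge0.
rewrite (bigD1 i)//= -abs_sqr lerDl sumr_ge0// => j _.
by rewrite addr_ge0// sqr_ge0.
Qed.

Lemma l2norm_le_sum k (v : 'cV[C]_k) : (cV_l2norm v <= (\sum_i abs (v i 0))%:E)%E.
Proof.
have s0 : 0 <= \sum_i abs (v i 0) by apply: sumr_ge0.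
rewrite /cV_l2norm lee_fin -[leRHS]ger0_norm// -sqrtr_sqr ler_sqrt ?sqr_ge0//.
rewrite expr2 mulr_suml; apply: ler_sum => i _; rewrite -abs_sqr expr2.
by rewrite ler_wpM2l// (bigD1 i)//= lerDl sumr_ge0.
Qed.

Lemma mx_opnorm_entry k (M : 'M[C]_k) (c : R) i j :
  (mx_opnorm M <= c%:E)%E -> abs (M i j) <= c.
Proof.
move=> h; rewrite -lee_fin; apply: le_trans h.
have e1 : (cV_l2norm (delta_mx j ord0 : 'cV[C]_k) <= 1)%E.
  apply: le_trans (l2norm_le_sum _) _; rewrite lee_fin (bigD1 j)//= big1.
    by rewrite addr0 mxE !eqxx abs1.
  by move=> l lj; rewrite mxE (negbTE lj) abs0.
apply: le_trans (ereal_sup_ubound _); last by exists (delta_mx j ord0).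
by have := l2norm_entry (M *m delta_mx j ord0) i; rewrite -colE mxE.
Qed.

Lemma mx_opnorm_le k (M : 'M[C]_k) (c : R) : 0 <= c ->
  (forall i j, abs (M i j) <= c) -> (mx_opnorm M <= (k%:R * (k%:R * c))%:E)%E.
Proof.
move=> c0 h; apply: ge_ereal_sup => _ [v /= v1 <-].
apply: le_trans (l2norm_le_sum _) _; rewrite lee_fin.
have kE (x : R) : k%:R * x = \sum_(i < k) x by rewrite sumr_const card_ord mulr_natl.
rewrite kE; apply: ler_sum => i _; rewrite mxE (le_trans (abs_sum _ _ _))// kE.
apply: ler_sum => j _; rewrite normcM -[leRHS]mulr1 ler_pM//.
by rewrite -lee_fin (le_trans (l2norm_entry _ _)).
Qed.

End MatrixNorms.

Section MultAlgebra.
Variables (R : realType) (X : pointedType) (K : X -> X -> R[i]) (H : rkhs K).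
Local Notation C := R[i].

Lemma mult_funX (f : Mult H) n : mult_fun (f ^+ n) = mult_fun f ^+ n.
Proof. by elim: n => [|n IH]; rewrite ?expr0// !exprS -IH. Qed.

Lemma mult_funZ (c : C) (f : Mult H) : mult_fun (c *: f) = c *: mult_fun f.
Proof. by []. Qed.

Lemma mult_fun_sum N (f : nat -> Mult H) :
  mult_fun (\sum_(j < N) f j) = \sum_(j < N) mult_fun (f j).
Proof. by elim: N => [|N IH]; rewrite ?big_ord0// !big_ord_recr/= -IH. Qed.

Lemma mult_norm_le1 (f : Mult H) :
  (forall h : H, exists g : H, rkhs_fun H g = (mult_fun f \* rkhs_fun H h) /\
     hnorm g <= hnorm h) -> (mult_norm H f <= 1)%E.
Proof.
move=> hf; apply: ge_ereal_sup => _ [h /= h1 <-].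
have [g [gE gh]] := hf h.
have -> : mult_op f h = g.
  by apply: (@rkhs_fun_inj _ _ _ H); rewrite mult_opE gE.
by apply: le_trans h1; rewrite lee_fin.
Qed.

Lemma mult_norm_ge (f : Mult H) (h g : H) : hnorm h <= 1 ->
  rkhs_fun H g = (mult_fun f \* rkhs_fun H h) -> ((hnorm g)%:E <= mult_norm H f)%E.
Proof.
move=> h1 gE; apply: ereal_sup_ubound; exists h; first by rewrite /= lee_fin.
by congr (_%:E); congr hnorm; apply: (@rkhs_fun_inj _ _ _ H); rewrite mult_opE gE.
Qed.

End MultAlgebra.

(** * Failure of subhomogeneity *)

Section DiagonalPowers.
Variables (R : realType) (d : nat) (a : R) (H : rkhs (@dirichlet_kernel R d a)).
Local Notation C := R[i].
Local Notation fn := (rkhs_fun H).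
Hypothesis a0 : 0 <= a.

(** The least [m] with [a < (m + 1) / 2].  Its minimality bounds the exponent
[s = (m + 1) / 2 - a] by [1], so that the weight [(1 + n)^(s/2)] is sublinear. *)
Lemma choose_dimension : (0 < d)%N -> a < (d%:R + 1) / 2 ->
  exists m : nat, [/\ (0 < m)%N, (m <= d)%N,
  0 < (m%:R + 1) / 2 - a <= 1, a <= m%:R & (a == 0 -> m = 1%N)].
Proof.
move=> d0 ad; pose P m := (0 < m)%N && (a < (m%:R + 1) / 2).
have exP : exists m, P m by exists d; rewrite /P d0.
case: (ex_minnP exP) => m /andP[m0 am] mmin; exists m.
have md : (m <= d)%N by apply: mmin; rewrite /P d0.
have m1 : 1 <= m%:R :> R by rewrite ler1n.
split=> //; first last.
- move=> /eqP az; apply/eqP; rewrite eqn_leq m0 andbT; apply: mmin.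
  by rewrite /P az /= divr_gt0.
- by move: am m1; lra.
rewrite subr_gt0 am /=.
case: m m0 am mmin md m1 => [//|[|m]] _ am mmin _ _.
  by move: a0 am; lra.
have : ~~ P m.+1 by apply/negP => /mmin; rewrite ltnn.
rewrite /P /= -leNgt -[m.+2%:R]natr1; move: a0.
by set x := m.+1%:R; lra.
Qed.

Definition generic_point_row : 'rV[C]_d := \row_(j < d) ((d.+1%:R^-1 : R)%:C).

Lemma generic_point : exists z : unit_ball R d, forall g, monomial g z != 0.
Proof.
have ok : \sum_(j < d) `|generic_point_row 0 j| ^+ 2 < 1.
  have d1 : 0 < d.+1%:R :> R by rewrite ltr0n.
  have -> : \sum_(j < d) `|generic_point_row 0 j| ^+ 2 = (d%:R * d.+1%:R^-1 ^+ 2 : R)%:C.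
    rewrite -[d in d%:R]card_ord mulr_natl -sumr_const rc_sum; apply: eq_bigr => j _.
    by rewrite mxE rcX -[`|_|]/((normc _)%:C) abs_real ger0_norm// invr_ge0.
  rewrite -[ltRHS]/((1 : R)%:C) ltcR expr2 mulrA !ltr_pdivrMr// mul1r -natrM ltr_nat; nia.
exists (exist (fun v : 'rV[C]_d => \sum_(j < d) `|v 0 j| ^+ 2 < 1) _ ok) => g.
apply/prodf_neq0 => j _; rewrite expf_neq0//= mxE -abs_gt0 abs_real normr_gt0.
by rewrite invr_eq0 pnatr_eq0.
Qed.

(** The function [phi] is [diag_monomial] and the weight is [n |-> (1 + n)^(s/2)]: the
bounds of [weight_steps] for all multi-indices give the multiplier norms of the
powers, the equality [weight_steps_diag] gives their norms in the space.  These
powers are multiples of distinct monomials, hence orthogonal. *)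
Lemma diagonal_powers (m : nat) : (0 < m)%N -> (m <= d)%N ->
  0 < (m%:R + 1) / 2 - a <= 1 -> a <= m%:R -> (a == 0 -> m = 1%N) ->
  exists (w : weight R) (c : R) (phi : unit_ball R d -> C),
    [/\ sublinear_weight w, unbounded_weight w, 0 < c,
     forall n (f : H), exists g : H,
       fn g = (phi ^+ n \* fn f) /\ hnorm g <= c * w n * hnorm f &
     exists (one : H) (p : nat -> H), [/\ hnorm one <= 1,
       forall n, fn (p n) = (phi ^+ n \* fn one),
       forall n n', n != n' -> rkhs_dot H (p n) (p n') = 0 &
       forall n, w n <= hnorm (p n)]].
Proof.
move=> m0 md /andP[s0 s1] am a1; set s := (m%:R + 1) / 2 - a in s0 s1.
have b0 : 0 < s / 2 by rewrite divr_gt0.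
have b1 : s / 2 <= 2^-1 by rewrite ler_pdivrMr// mulVf ?pnatr_eq0.
pose w := pow_weight b0.
have wsq n : w n ^+ 2 = (1 + n%:R) `^ s by rewrite pow_weight_sqr divfK.
have w0 n : 0 < w n by apply: pow_weight_gt0.
have [c [c0 hup hlow]] := theta_growth m0 s0 a0 am a1.
have sc0 : 0 < Num.sqrt c by rewrite sqrtr_gt0.
pose phi := @diag_monomial R d m.
have phiX n z : (phi ^+ n) z = phi z ^+ n.
  by elim: n => [//|n IH]; rewrite !exprS -IH.
pose r n : R := Num.sqrt (m%:R ^+ m) ^+ n.
have r2 n : r n ^+ 2 = (m%:R ^+ m) ^+ n.
  by rewrite /r -[LHS]exprM mulnC [LHS]exprM sqr_sqrtr// exprn_ge0.
have k0 := kweight_gt0 (d := d) a0.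
have Kx := kernel_expand (d := d) a0.
have [mon hmon] := boolp.choice (feature_in_rkhs H k0 (@uniq_mindices d)
  (@mindices_exhaust d) Kx).
have monE g : fn (mon g) = monomial g by case: (hmon g).
have mon_norm g : hnorm (mon g) <= (Num.sqrt (kweight a g))^-1 by case: (hmon g).
have orth := monomials_orthogonal monE.
have [z0 hz0] := generic_point.
have normE g := feature_norm k0 (@uniq_mindices d) (@mindices_exhaust d) Kx monE mon_norm
  orth (hz0 g).
pose o : mindex d := [ffun=> 0%N].
have ko : kweight a o = 1.
  rewrite /kweight /ecoef /mdeg /mfact !big1 => [|i _|i _]; rewrite ?ffunE//.
  rewrite fact0 divr1 mulr1 /kernel_coef; case: eqP => // _.
  by rewrite invr1.
pose sh n := mshift m n o.
have shI n n' : n != n' -> sh n != sh n'.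
  apply: contraNneq => /(congr1 (@mdeg d)); rewrite !mdeg_shift// => /addnI/eqP.
  by rewrite eqn_pmul2r.
exists w, (Num.sqrt c), phi; split => //.
- exact: pow_weight_sublinear.
- exact: pow_weight_unbounded.
- move=> n f.
  apply: (multiplier_of_shift (F := @monomial R d) (r := r n) (sh := mshift m n) k0
    (@uniq_mindices d) (@mindices_exhaust d) Kx).
  + by rewrite mulr_ge0// ltW.
  + exact: mshift_inj.
  + by move=> g z; rewrite phiX diag_monomial_shift.
  + move=> g; rewrite r2 exprMn sqr_sqrtr ?(ltW c0)// wsq.
    rewrite (le_trans (weight_steps md n g a0))// ler_wpM2r ?(ltW (k0 _))//.
exists (mon o), (fun n => (r n)%:C *: mon (sh n)); split.
- by rewrite (le_trans (mon_norm o))// ko sqrtr1 invr1.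
- move=> n; apply/funext => z; rewrite fnZ !monE /= phiX.
  by rewrite diag_monomial_shift.
- by move=> n n' nn'; rewrite dotZl dotZr orth ?mulr0// shI.
move=> n; rewrite -(ler_pXn2r (n := 2)) ?nnegrE ?(ltW (w0 n))// wsq.
rewrite hnormZ exprMn abs_real real_normK ?num_real// normE r2.
rewrite ler_pdivlMr// (le_trans (ler_wpM2r (ltW (k0 _)) (hlow n)))//.
by rewrite -weight_steps_diag// ko mulr1.
Qed.

End DiagonalPowers.

Theorem theorem1p7 (R : realType) (d : nat) (a : R)
    (H : rkhs (@dirichlet_kernel R d a)) :
  (0 < d)%N -> 0 <= a -> a < (d%:R + 1) / 2 ->
  ~ topologically_subhomogeneous (Mult H) (mult_norm H).
Proof.
move=> d0 a0 ad [K [C1 [C2 [C1_gt0 C2_gt0 hsub]]]].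
have [m [m0 md ms am am1]] := choose_dimension a0 d0 ad.
have [w [c [phi [wsub wunb c0 hphi [one [p [one1 pE porth pn]]]]]]] :=
  diagonal_powers H a0 m0 md ms am am1.
have w0 n : 0 < w n by rewrite (lt_le_trans ltr01)// w_ge1.
have phiM : phi \in multiplier H.
  by rewrite inE => f; have [g [gE _]] := hphi 1%N f; exists g; rewrite gE expr1.
pose Phi : Mult H := MkMult phiM.
pose A := c * C2; have A0 : 0 < A by rewrite mulr_gt0.
(* bounds for the entries of the image of the test function [b] below, and for its
   norm; the test function has [N] terms so that [sqrt N] exceeds the latter *)
pose E := A * (1 + (K + K * K)%:R).
have E0 : 0 <= E by rewrite mulr_ge0 ?(ltW A0)// addr_ge0.
pose BB := C1 * (K%:R * (K%:R * E)).
have BB0 : 0 <= BB by rewrite !mulr_ge0// ltW.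
pose N := (Num.truncn (BB ^+ 2)).+1.
have NBB : BB ^+ 2 < N%:R by exact: truncnS_gt.
have eta0 : 0 < N%:R^-1 :> R by rewrite invr_gt0 ltr0n.
have [n [dd [n_inc dd_dec hscale]]] := scale_sequence wsub wunb K eta0.
have n_mono i j : (i < j)%N -> (n i < n j)%N by exact: (homo_ltn ltn_trans n_inc).
have n_inj : injective n.
  by move=> i j nij; case: (ltngtP i j) => // /n_mono; rewrite nij ltnn.
pose b : Mult H := \sum_(j < N) (((w (n j))^-1)%:C *: Phi ^+ n j).
(* The terms of [b] times the constant function are orthogonal, of norm at least 1. *)
have lower : ((Num.sqrt N%:R)%:E <= mult_norm H b)%E.
  pose g : H := \sum_(j <- index_iota 0 N) ((w (n j))^-1)%:C *: p (n j).
  have gn : N%:R <= hnorm g ^+ 2.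
    rewrite (@hnorm_sqr_sum R _ _ H nat (fun j => p (n j)) _ _ (fun j => ((w (n j))^-1)%:C)).
    - rewrite -[N in N%:R]subn0 -sumr_const_nat; apply: ler_sum => j _.
      rewrite abs_real ger0_norm ?invr_ge0// exprVn mulrC ler_pdivlMr ?exprn_gt0// mul1r.
      by rewrite lerXn2r ?nnegrE// pn.
    - by move=> j j' jj'; apply: porth; apply: contraNneq jj' => /n_inj ->.
    - exact: iota_uniq.
  apply: (@le_trans _ _ (hnorm g)%:E).
    by rewrite lee_fin -(ger0_norm (hnorm_ge0 g)) -sqrtr_sqr ler_sqrt// sqr_ge0.
  apply: mult_norm_ge one1 _.
  rewrite /b (mult_fun_sum N (fun j => ((w (n j))^-1)%:C *: Phi ^+ n j)).
  rewrite /g big_mkord linear_sum.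
  apply/funext => z; rewrite fct_sumE /= fct_sumE mulr_suml; apply: eq_bigr => j _.
  by rewrite fnZ pE mult_funX fctE /= mulrA.
(* The powers of [pi Phi] are bounded by [w], as [Phi ^+ l / (c w l)] is a contraction. *)
have upper : (ereal_sup [set r | exists k : nat, exists pi : {lrmorphism Mult H -> 'M[R[i]]_k.+1},
     [/\ (k < K)%N, (opnorm (mult_norm H) (@mx_opnorm R k.+1) pi <= C2%:E)%E
             & r = mx_opnorm (pi b)]] <= (K%:R * (K%:R * E))%:E)%E.
  apply: ge_ereal_sup => _ [k [pi [kK hpi ->]]].
  pose T := pi Phi.
  have hT l i j : normc ((T ^+ l) i j) <= A * w l.
    pose u : Mult H := ((c * w l)^-1)%:C *: Phi ^+ l.
    have cw : 0 < c * w l by rewrite mulr_gt0.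
    have u1 : (mult_norm H u <= 1)%E.
      apply: mult_norm_le1 => f; have [g [gE gn]] := hphi l f.
      exists (((c * w l)^-1)%:C *: g); split.
        by apply/funext => z; rewrite fnZ gE mult_funZ mult_funX /= -mulrA.
      by rewrite hnormZ abs_real ger0_norm ?invr_ge0 ?(ltW cw)// mulrC ler_pdivrMr// mulrC.
    have h : (mx_opnorm (pi u) <= C2%:E)%E.
      by apply: le_trans hpi; apply: ereal_sup_ubound; exists u.
    have := mx_opnorm_entry i j h.
    rewrite /u linearZ rmorphXn mxE normcM abs_real ger0_norm ?invr_ge0 ?(ltW cw)//.
    rewrite mulrC ler_pdivrMr// -/T.
    by have -> : A * w l = C2 * (c * w l) by rewrite /A; ring.
  apply: (@le_trans _ _ (k.+1%:R * (k.+1%:R * E))%:E); last first.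
    have kKR : k.+1%:R <= K%:R :> R by rewrite ler_nat.
    have kE : k.+1%:R * E <= K%:R * E by exact: ler_wpM2r.
    by rewrite lee_fin; apply: ler_pM => //; exact: mulr_ge0.
  apply: mx_opnorm_le => // i j.
  have -> : pi b = \sum_(l < N) ((w (n l))^-1)%:C *: T ^+ n l.
    by rewrite /b linear_sum; apply: eq_bigr => l _; rewrite linearZ rmorphXn.
  rewrite summxE (le_trans (abs_sum _ _ _))//.
  apply: (@le_trans _ _ (\sum_(l < N) normc ((T ^+ n l) i j) / w (n l))).
    apply: ler_sum => l _; rewrite mxE normcM abs_real ger0_norm ?invr_ge0//.
    by rewrite mulrC.
  have := power_sum_bound wsub kK hT eta0 dd_dec hscale N i j.
  by rewrite mulfV ?pnatr_eq0.
have := le_trans lower (hsub b).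
move=> /le_trans /(_ (lee_wpmul2l _ upper)).
rewrite lee_fin -EFinM lee_fin ltW// => /(_ isT).
rewrite -/BB leNgt => /negP; apply.
by rewrite -(ger0_norm BB0) -sqrtr_sqr ltr_sqrt// ltr0n.
Qed.
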